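(* Let $K$ be a field, $c\ge 0$ an integer and $\mathbf{P}=\mathbf{P}^{\mathrm{FI},c}$. There is a finite algorithm which, given as input an integer $p\ge 1$ and a finite subset $B$ of a finitely generated free FI-module $\mathbf{F}=\bigoplus_{i=1}^r \mathbf{F}^{\mathrm{FI},d_i}$ over $\mathbf{P}$ (with integers $d_i\ge 0$), outputs an exact sequence of finitely generated FI-modules over $\mathbf{P}$ $$\mathbf{F}^p\to\mathbf{F}^{p-1}\to\cdots\to\mathbf{F}^1\to\mathbf{M}\to 0,$$ where $\mathbf{M}=\langle B\rangle_{\mathbf{F}}$ is the FI-submodule of $\mathbf{F}$ generated by $B$ and each $\mathbf{F}^i$ is a finitely generated free FI-module over $\mathbf{P}$.
   Context: Write $[n]=\{1,\dots,n\}$, $[0]=\emptyset$. FI is the category with objects $[n]$, $n\in\mathbb{N}_0$ (a skeleton of the category of finite sets and injections) and injective maps as morphisms; $\operatorname{Hom}_{\mathrm{FI}}(m,n)$ is the set of injections $[m]\to[n]$. An FI-algebra over $K$ is a covariant functor $\mathbf{A}$ from FI to commutative, associative, unital $K$-algebras; write $\mathbf{A}_n=\mathbf{A}([n])$. An FI-module over $\mathbf{A}$ is a covariant functor $\mathbf{M}$ from FI to $K$-modules such that each $\mathbf{M}_n=\mathbf M([n])$ is an $\mathbf{A}_n$-module and $\mathbf{M}(\epsilon)(aq)=\mathbf{A}(\epsilon)(a)\,\mathbf{M}(\epsilon)(q)$ for all $\epsilon\in\operatorname{Hom}_{\mathrm{FI}}(m,n)$, $a\in\mathbf{A}_m$,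 $q\in\mathbf{M}_m$. A morphism of FI-modules over $\mathbf{A}$ is a natural transformation $\phi$ such that each $\phi_n$ is $\mathbf{A}_n$-linear; exactness is checked for each $n$. A subset of $\mathbf{M}$ is a subset of $\coprod_{n\ge0}\mathbf{M}_n$; the submodule generated by a subset $S$ is the smallest FI-submodule containing $S$; $\mathbf M$ is finitely generated if it is generated by a finite subset. $\mathbf{P}^{\mathrm{FI},c}$ is the FI-algebra with $\mathbf{P}_n=K[x_{i,j}\mid 1\le i\le c,\ 1\le j\le n]$ and $\mathbf{P}(\epsilon)\colon x_{i,j}\mapsto x_{i,\epsilon(j)}$. For $d\ge 0$, $\mathbf{F}^{\mathrm{FI},d}$ is the FI-module over $\mathbf{P}$ with $\mathbf{F}^{\mathrm{FI},d}_n=\bigoplus_{\pi\in\operatorname{Hom}_{\mathrm{FI}}(d,n)}\mathbf{P}_n e_\pi$ and $\mathbf{F}^{\mathrm{FI},d}(\sigma)(a e_\pi)=\mathbf{P}(\sigma)(a)e_{\sigma\circ\pi}$. A finitely generated free FI-module is a finite direct sum of such modules (up to isomorphism). Conventions on computation: the field operations and equality tests in $K$ count as elementary steps; elements of free modules are given explicitly as finite linear combinations of basis elements with polynomial coefficients; morphisms out of free modules are given by the images of the basis elements $e_{\mathrm{id}_{[d_i]},i}$. A finite algorithm is one that terminates after finitely many steps on every input. *)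

(* Defs.v *)
From HB Require Import structures.
From mathcomp Require Import all_boot all_order all_algebra.
From mathcomp Require Import mpoly.
From mathcomp Require Import boolp.

Set Implicit Arguments.
Unset Strict Implicit.
Unset Printing Implicit Defensive.

Import GRing.Theory.
Local Open Scope ring_scope.

(* The object [n] is the type 'I_n = {0, .., n-1}. *)
Record fi_hom (m n : nat) := FIHom {
  fi_fun :> {ffun 'I_m -> 'I_n};
  fi_injb : injectiveb fi_fun }.

HB.instance Definition _ m n := [isSub for @fi_fun m n].
HB.instance Definition _ m n := [Equality of fi_hom m n by <:].
HB.instance Definition _ m n := [Choice of fi_hom m n by <:].
HB.instance Definition _ m n := [Countable of fi_hom m n by <:].
HB.instance Definition _ m n := [Finite of fi_hom m n by <:].

Lemma fi_id_subproof n : injectiveb [ffun i : 'I_n => i].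
Proof. by apply/injectiveP => i j; rewrite !ffunE. Qed.

Definition fi_id n : fi_hom n n := FIHom (fi_id_subproof n).

Lemma fi_comp_subproof l m n (g : fi_hom m n) (f : fi_hom l m) :
  injectiveb [ffun i : 'I_l => g (f i)].
Proof.
apply/injectiveP => i j; rewrite !ffunE.
by move/(injectiveP _ (fi_injb g))/(injectiveP _ (fi_injb f)).
Qed.

Definition fi_comp l m n (g : fi_hom m n) (f : fi_hom l m) : fi_hom l n :=
  FIHom (fi_comp_subproof g f).

Lemma fi_comp_idl m n (f : fi_hom m n) : fi_comp (fi_id n) f = f.
Proof. by apply/val_inj/ffunP => i; rewrite !ffunE. Qed.

Lemma fi_compA k l m n (h : fi_hom m n) (g : fi_hom l m) (f : fi_hom k l) :
  fi_comp h (fi_comp g f) = fi_comp (fi_comp h g) f.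
Proof. by apply/val_inj/ffunP => i; rewrite !ffunE. Qed.

(* The variable x_(i,j) is 'X_(enum_rank (i, j)). *)
Notation PFI K c n := {mpoly K[#|{: 'I_c * 'I_n}|]}.

Section PolyAlgebra.
Variables (K : fieldType) (c : nat).

Definition pvar_map m n (s : fi_hom m n) :
    #|{: 'I_c * 'I_m}|.-tuple (PFI K c n) :=
  [tuple let ij := enum_val k in 'X_(enum_rank (ij.1, s ij.2)) | k < _].

Definition pfi_map m n (s : fi_hom m n) (a : PFI K c m) : PFI K c n :=
  a \mPo pvar_map s.

HB.instance Definition _ m n (s : fi_hom m n) :=
  GRing.LRMorphism.copy (pfi_map s) (comp_mpoly (pvar_map s)).

Lemma pfi_mapX m n (s : fi_hom m n) i j :
  pfi_map s 'X_(enum_rank (i, j)) = 'X_(enum_rank (i, s j)).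
Proof. by rewrite /pfi_map comp_mpolyXU -tnth_nth tnth_mktuple enum_rankK. Qed.

Lemma pfi_map_id n (a : PFI K c n) : pfi_map (fi_id n) a = a.
Proof.
rewrite -[RHS]comp_mpoly_id /pfi_map; congr (_ \mPo _).
apply: eq_from_tnth => k; rewrite !tnth_mktuple /= ffunE.
by rewrite -surjective_pairing enum_valK.
Qed.

Lemma pfi_map_comp l m n (t : fi_hom m n) (s : fi_hom l m) (a : PFI K c l) :
  pfi_map (fi_comp t s) a = pfi_map t (pfi_map s a).
Proof.
rewrite {1}/pfi_map (comp_mpolyE a) [pfi_map s a]comp_mpolyE raddf_sum /=.
apply: eq_bigr => e _; rewrite linearZ rmorph_prod /=; congr (_ *: _).
apply: eq_bigr => k _; rewrite rmorphXn /= !tnth_mktuple pfi_mapX /=.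
by rewrite ffunE.
Qed.

End PolyAlgebra.

(* The K-module structure of [M n] is the one restricted from the
   polynomial ring along the inclusion of constants, which [pfi_map] fixes;
   hence [fm_map] is K-linear by [fm_mapD] and [fm_mapZ]. *)
Record fi_module (K : fieldType) (c : nat) := FIModule {
  fm_obj :> forall n, lmodType (PFI K c n);
  fm_map : forall m n, fi_hom m n -> fm_obj m -> fm_obj n;
  fm_mapD : forall m n (s : fi_hom m n) x y,
    fm_map s (x + y) = fm_map s x + fm_map s y;
  fm_mapZ : forall m n (s : fi_hom m n) (a : PFI K c m) x,
    fm_map s (a *: x) = pfi_map s a *: fm_map s x;
  fm_map_id : forall n x, fm_map (fi_id n) x = x;
  fm_map_comp : forall l m n (t : fi_hom m n) (s : fi_hom l m) x,
    fm_map (fi_comp t s) x = fm_map t (fm_map s x) }.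

Record fi_morphism (K : fieldType) (c : nat) (M N : fi_module K c) :=
  FIMorphism {
  fh_fun :> forall n, {linear M n -> N n};
  fh_natural : forall m n (s : fi_hom m n) (x : M m),
    fh_fun n (fm_map s x) = fm_map s (fh_fun m x) }.

Section Submodules.
Variables (K : fieldType) (c : nat) (M : fi_module K c).

Record is_fi_submodule (S : forall n, M n -> Prop) : Prop := FISubmodule {
  fs0 : forall n, S n 0;
  fsD : forall n (x y : M n), S n x -> S n y -> S n (x + y);
  fsZ : forall n (a : PFI K c n) (x : M n), S n x -> S n (a *: x);
  fs_map : forall m n (s : fi_hom m n) (x : M m), S m x -> S n (fm_map s x) }.

Definition fi_generated (S : forall n, M n -> Prop) n (x : M n) : Prop :=
  forall T : forall n, M n -> Prop, is_fi_submodule T ->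
    (forall m (y : M m), S m y -> T m y) -> T n x.

Lemma fi_generated_is_fi_submodule S : is_fi_submodule (fi_generated S).
Proof.
split.
- by move=> n T HT _; apply: fs0.
- by move=> n x y Hx Hy T HT ST; apply: fsD => //; [apply: Hx | apply: Hy].
- by move=> n a x Hx T HT ST; apply: fsZ => //; apply: Hx.
- by move=> m n s x Hx T HT ST; apply: fs_map => //; apply: Hx.
Qed.

Definition finite_subset (s : seq {n : nat & M n}) n (x : M n) : Prop :=
  Tagged (fun k => M k : Type) x \in s.

Definition finitely_generated : Prop :=
  exists s : seq {n : nat & M n}, forall n (x : M n),
    fi_generated (finite_subset s) x.

Section SubModule.
Variables (S : forall n, M n -> Prop) (HS : is_fi_submodule S).

Definition sub_pred n : pred (M n) := fun x => `[< S x >].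

Definition sub_obj n : Type := let _ := HS in {x : M n | @sub_pred n x}.

HB.instance Definition _ n := [isSub of sub_obj n for @sval _ _].
HB.instance Definition _ n := [Choice of sub_obj n by <:].

Lemma sub_pred_closed n : subsemimod_closed (@sub_pred n).
Proof.
split; first split.
- by apply/asboolP; apply: fs0.
- by move=> x y /asboolP Hx /asboolP Hy; apply/asboolP; apply: fsD.
- by move=> a x /asboolP Hx; apply/asboolP; apply: fsZ.
Qed.

HB.instance Definition _ n :=
  GRing.SubChoice_isSubLmodule.Build _ (M n) (@sub_pred n) (sub_obj n)
    (@sub_pred_closed n).

Lemma sub_map_subproof m n (s : fi_hom m n) (x : sub_obj m) :
  sub_pred (fm_map s (val x)).
Proof. by apply/asboolP; apply: fs_map => //; apply/asboolP/(valP x). Qed.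

Definition sub_map m n (s : fi_hom m n) (x : sub_obj m) : sub_obj n :=
  Sub (fm_map s (val x)) (sub_map_subproof s x).

Lemma sub_mapD m n (s : fi_hom m n) x y :
  sub_map s (x + y) = sub_map s x + sub_map s y.
Proof. by apply: val_inj; rewrite /= fm_mapD. Qed.

Lemma sub_mapZ m n (s : fi_hom m n) (a : PFI K c m) x :
  sub_map s (a *: x) = pfi_map s a *: sub_map s x.
Proof. by apply: val_inj; rewrite /= fm_mapZ. Qed.

Lemma sub_map_id n x : sub_map (fi_id n) x = x.
Proof. by apply: val_inj; rewrite SubK fm_map_id. Qed.

Lemma sub_map_comp l m n (t : fi_hom m n) (s : fi_hom l m) x :
  sub_map (fi_comp t s) x = sub_map t (sub_map s x).
Proof. by apply: val_inj; rewrite !SubK fm_map_comp. Qed.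

Definition sub_fi_module : fi_module K c :=
  @FIModule K c (fun n => sub_obj n : lmodType (PFI K c n)) sub_map
    sub_mapD sub_mapZ sub_map_id sub_map_comp.

Definition fi_incl : fi_morphism sub_fi_module M :=
  @FIMorphism K c sub_fi_module M
    (fun n => (val : sub_obj n -> M n) : {linear sub_obj n -> M n})
    (fun m n s x => erefl).

End SubModule.

Definition fi_span (S : forall n, M n -> Prop) : fi_module K c :=
  sub_fi_module (fi_generated_is_fi_submodule S).

Definition fi_span_incl (S : forall n, M n -> Prop) :
    fi_morphism (fi_span S) M :=
  fi_incl (fi_generated_is_fi_submodule S).

End Submodules.

(* Exactness of  N p -> N (p - 1) -> .. -> N 1 -> N 0 -> 0. *)
Definition exact_sequence (K : fieldType) (c p : nat)
    (N : nat -> fi_module K c) (del : forall k, fi_morphism (N k.+1) (N k)) :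
    Prop :=
  (forall n (y : N 0 n), exists x, del 0 n x = y) /\
  (forall k, (k.+1 < p)%N -> forall n (y : N k.+1 n),
     del k n y = 0 <-> exists x, del k.+1 n x = y).

Section Free.
Variables (K : fieldType) (c : nat).

(* [ds] lists d_1, .., d_r. The index (i, pi) of a basis element consists of
   i < r and an injection pi : [d_i] -> [n]. *)
Definition fbasis (ds : seq nat) (n : nat) : finType :=
  {i : 'I_(size ds) & fi_hom (nth 0%N ds i) n}.

Definition fbasis_map ds m n (s : fi_hom m n) (t : fbasis ds m) :
    fbasis ds n :=
  Tagged (fun i : 'I_(size ds) => fi_hom (nth 0%N ds i) n)
    (fi_comp s (tagged t)).

Definition free_obj (ds : seq nat) (n : nat) : lmodType (PFI K c n) :=
  {ffun fbasis ds n -> (PFI K c n)^o}.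

Definition fe ds n (t : fbasis ds n) : free_obj ds n :=
  [ffun u => (u == t)%:R].

Definition free_map ds m n (s : fi_hom m n) (x : free_obj ds m) :
    free_obj ds n :=
  \sum_t pfi_map s (x t) *: fe (fbasis_map s t).

Lemma free_mapD ds m n (s : fi_hom m n) (x y : free_obj ds m) :
  free_map s (x + y) = free_map s x + free_map s y.
Proof.
rewrite -big_split; apply: eq_bigr => t _ /=.
by rewrite ffunE raddfD scalerDl.
Qed.

Lemma free_mapZ ds m n (s : fi_hom m n) (a : PFI K c m) (x : free_obj ds m) :
  free_map s (a *: x) = pfi_map s a *: free_map s x.
Proof.
rewrite scaler_sumr; apply: eq_bigr => t _.
by rewrite ffunE [(a *: x t)%R]/(a * x t)%R rmorphM scalerA.
Qed.

Lemma free_decomp ds n (x : free_obj ds n) : x = \sum_t x t *: fe t.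
Proof.
apply/ffunP => u; rewrite sum_ffunE (bigD1 u) //= big1 ?addr0.
  by rewrite !ffunE eqxx; exact: esym (mulr1 _).
move=> t tu; rewrite !ffunE eq_sym (negPf tu); exact: mulr0.
Qed.

Lemma free_map_sum ds m n (s : fi_hom m n) (I : Type) (r : seq I)
    (F : I -> free_obj ds m) :
  free_map s (\sum_(i <- r) F i) = \sum_(i <- r) free_map s (F i).
Proof.
elim: r => [|i r IH]; last by rewrite !big_cons free_mapD IH.
by rewrite !big_nil -(scale0r (0 : free_obj ds m)) free_mapZ raddf0 scale0r.
Qed.

Lemma free_map_fe ds m n (s : fi_hom m n) (t : fbasis ds m) :
  free_map s (fe t) = fe (fbasis_map s t).
Proof.
rewrite /free_map (bigD1 t) //= big1 ?addr0.
  by rewrite ffunE eqxx rmorph1 scale1r.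
by move=> u ut; rewrite ffunE (negPf ut) raddf0 scale0r.
Qed.

Lemma free_map_id ds n (x : free_obj ds n) : free_map (fi_id n) x = x.
Proof.
rewrite [RHS]free_decomp; apply: eq_bigr => -[i f] _.
by rewrite pfi_map_id /fbasis_map /= fi_comp_idl.
Qed.

Lemma free_map_comp ds l m n (t : fi_hom m n) (s : fi_hom l m)
    (x : free_obj ds l) :
  free_map (fi_comp t s) x = free_map t (free_map s x).
Proof.
rewrite [free_map s x]/free_map free_map_sum; apply: eq_bigr => u _.
by rewrite free_mapZ free_map_fe pfi_map_comp /fbasis_map /= fi_compA.
Qed.

Definition free_fi_module (ds : seq nat) : fi_module K c :=
  @FIModule K c (free_obj ds) (@free_map ds) (@free_mapD ds)
    (@free_mapZ ds) (@free_map_id ds) (@free_map_comp ds).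

(* The j-th generator of the free module, which has width d_j. *)
Definition fgen ds (j : 'I_(size ds)) :
    free_fi_module ds (nth 0%N ds j) :=
  fe (Tagged (fun i : 'I_(size ds) => fi_hom (nth 0%N ds i) (nth 0%N ds j))
        (fi_id _)).

(* Presentations are finite formal sums; a monomial or a basis element may
   occur several times and coefficients may vanish. *)
Definition poly_repr (n : nat) : Type :=
  seq (K * 'X_{1..#|{: 'I_c * 'I_n}|}).

Definition poly_of n (f : poly_repr n) : PFI K c n :=
  \sum_(t <- f) t.1 *: 'X_[t.2].

Definition elt_repr (ds : seq nat) (n : nat) : Type :=
  seq (poly_repr n * fbasis ds n).

Definition elt_of ds n (q : elt_repr ds n) : free_fi_module ds n :=
  \sum_(t <- q) poly_of t.1 *: fe t.2.

Definition subset_of ds (B : seq {n : nat & elt_repr ds n}) :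
    forall n, free_fi_module ds n -> Prop :=
  finite_subset
    [seq Tagged (fun k => free_fi_module ds k : Type) (elt_of (tagged b)) | b <- B].

End Free.

(* Data are binary trees with two kinds of leaves, [VNil] and field
   elements. Programs are those of a WHILE language on such trees, in
   point-free form. The field enters only through [PZero], .., [PEq], so that
   a program has no access to elements of the field other than those it
   computes from its input; in particular, programs are independent of K. *)
Inductive value (K : Type) :=
  | VNil
  | VScal of K
  | VPair of value K & value K.
Arguments VNil {K}.

Inductive prim :=
  | PId | PNil | PHead | PTail
  | PZero | POne | PAdd | POpp | PMul | PInv | PEq.

Inductive program :=
  | Prim of prim
  | Fork of program & program
  | Seq of program & program
  | If of program & program & program
  | While of program & program.

Definition is_pair K (v : value K) : bool :=
  if v is VPair _ _ then true else false.

(* Primitives are total: ill-formed arguments yield [VNil]. Truth values are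
   the pairs (true) and the leaves (false). The inverse of 0 is 0. *)
Definition prim_eval (K : fieldType) (o : prim) (v : value K) : value K :=
  match o, v with
  | PId, _ => v
  | PNil, _ => VNil
  | PHead, VPair x _ => x
  | PTail, VPair _ y => y
  | PZero, _ => VScal 0
  | POne, _ => VScal 1
  | PAdd, VPair (VScal a) (VScal b) => VScal (a + b)
  | POpp, VScal a => VScal (- a)
  | PMul, VPair (VScal a) (VScal b) => VScal (a * b)
  | PInv, VScal a => VScal a^-1
  | PEq, VPair (VScal a) (VScal b) =>
      if a == b then VPair VNil VNil else VNil
  | _, _ => VNil
  end.

(* [eval g v w]: on input v the program g halts after finitely many steps
   with output w. *)
Inductive eval (K : fieldType) : program -> value K -> value K -> Prop :=
  | EvPrim o v : eval (Prim o) v (prim_eval o v)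
  | EvFork g h v x y : eval g v x -> eval h v y ->
      eval (Fork g h) v (VPair x y)
  | EvSeq g h v x y : eval g v x -> eval h x y -> eval (Seq g h) v y
  | EvIfTrue b g h v x y : eval b v x -> is_pair x -> eval g v y ->
      eval (If b g h) v y
  | EvIfFalse b g h v x y : eval b v x -> ~~ is_pair x -> eval h v y ->
      eval (If b g h) v y
  | EvWhileTrue b g v x y z : eval b v x -> is_pair x -> eval g v y ->
      eval (While b g) y z -> eval (While b g) v z
  | EvWhileFalse b g v x : eval b v x -> ~~ is_pair x ->
      eval (While b g) v v.

Lemma eval_deterministic (K : fieldType) g (v w w' : value K) :
  eval g v w -> eval g v w' -> w = w'.
Proof.
move=> H; elim: H w' => {g v w}.
- by move=> o v w' H; inversion H.
- move=> g h v x y _ IHx _ IHy w' H; inversion H; subst.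
  by congr VPair; [apply: IHx | apply: IHy].
- move=> g h v x y _ IHx _ IHy w' H; inversion H as [| |? ? ? x' ? Hx Hy| | | |].
  by subst; apply: IHy; rewrite (IHx x').
- move=> b g h v x y _ IHx px _ IHy w' H; inversion H as
    [| | |? ? ? ? x' ? Hx px' Hy|? ? ? ? x' ? Hx px' Hy| |]; subst.
    exact: IHy.
  by move: px'; rewrite -(IHx x') // px.
- move=> b g h v x y _ IHx px _ IHy w' H; inversion H as
    [| | |? ? ? ? x' ? Hx px' Hy|? ? ? ? x' ? Hx px' Hy| |]; subst.
    by move: px; rewrite (IHx x') // px'.
  exact: IHy.
- move=> b g v x y z _ IHx px _ IHy _ IHz w' H; inversion H as
    [| | | | |? ? ? x' y' ? Hx px' Hy Hz|? ? ? x' Hx px']; subst.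
    by apply: IHz; rewrite (IHy y').
  by move: px'; rewrite -(IHx x') // px.
- move=> b g v x _ IHx px w' H; inversion H as
    [| | | | |? ? ? x' y' ? Hx px' Hy Hz|? ? ? x' Hx px']; subst => //.
  by move: px; rewrite (IHx x') // px'.
Qed.

Section Encoding.
Variables (K : fieldType) (c : nat).

Definition enc_nat (n : nat) : value K := iter n (VPair VNil) VNil.

Definition enc_seq (A : Type) (enc : A -> value K) (s : seq A) : value K :=
  foldr (fun x v => VPair (enc x) v) VNil s.

(* A monomial is encoded by its c x n matrix of exponents. *)
Definition enc_monom n (m : 'X_{1..#|{: 'I_c * 'I_n}|}) : value K :=
  enc_seq (fun i : 'I_c =>
      enc_seq (fun j : 'I_n => enc_nat (m (enum_rank (i, j)))) (enum 'I_n))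
    (enum 'I_c).

Definition enc_poly n (f : poly_repr K c n) : value K :=
  enc_seq (fun t => VPair (VScal t.1) (enc_monom t.2)) f.

(* An injection is encoded by the list of its values. *)
Definition enc_fbasis ds n (t : fbasis ds n) : value K :=
  VPair (enc_nat (tag t))
    (enc_seq (fun j => enc_nat (tagged t j)) (enum 'I_(nth 0%N ds (tag t)))).

Definition enc_elt ds n (q : elt_repr K c ds n) : value K :=
  enc_seq (fun t => VPair (enc_poly t.1) (enc_fbasis t.2)) q.

Definition enc_input (p : nat) (ds : seq nat)
    (B : seq {n : nat & elt_repr K c ds n}) : value K :=
  VPair (enc_nat p)
    (VPair (enc_seq enc_nat ds)
       (enc_seq (fun b => VPair (enc_nat (tag b)) (enc_elt (tagged b))) B)).

(* The output presents the free modules F^(k+1) = free_fi_module (D k),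
   k < p, together with the images of their generators in F^k, where F^0
   stands for the ambient free module F given by [ds]. *)
Definition target (ds : seq nat) (D : nat -> seq nat) (k : nat) : seq nat :=
  if k is l.+1 then D l else ds.

Definition images (ds ds' : seq nat) : Type :=
  forall j : 'I_(size ds'), elt_repr K c ds (nth 0%N ds' j).

Definition enc_output (p : nat) (ds : seq nat) (D : nat -> seq nat)
    (phi : forall k, images (target ds D k) (D k)) : value K :=
  enc_seq (fun k => VPair (enc_seq enc_nat (D k))
                      (enc_seq (fun j => enc_elt (phi k j))
                         (enum 'I_(size (D k)))))
    (iota 0 p).

Definition resolution_obj (M : fi_module K c) (D : nat -> seq nat) (k : nat) :
    fi_module K c :=
  if k is l.+1 then free_fi_module K c (D l) else M.

End Encoding.

(* Main.v *)
(* Restricted to increasing maps, an FI-module is an OI-module, and P keeps its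
   structure; over increasing maps there are monomial orders and, by
   Higman's lemma, finite Groebner bases. If [ext] is a Groebner basis of <B>,
   then the relations of [B ++ ext] are generated by finitely many: those that
   express permuted generators through the Groebner basis, and the reduced
   S-pairs, of which only those of bounded width and degree matter because two
   increasing maps factor through the union of their images.

   Whether given data are a Groebner basis with a complete list of such
   relations is decided by evaluating finitely many identities. The algorithm
   therefore searches, for p steps at once, through all such certificates with
   coefficients in the subfield generated by the input; Higman's lemma and the
   division algorithm, carried out over that subfield, show that the search
   succeeds. Since the language has no other access to K, the subfield is
   exhausted by iterating the field operations on the scalars of the input. *)

Require Import Defs.
From HB Require Import structures.
From mathcomp Require Import all_boot all_order all_algebra.
From mathcomp Require Import mpoly.
From mathcomp Require Import boolp.
From mathcomp Require Import zify ring.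

Set Implicit Arguments.
Unset Strict Implicit.
Unset Printing Implicit Defensive.

Import GRing.Theory.

(** * Computable functions on encoded data *)

(** No monomial order is compatible with all injections: a transposition of two columns exchanges
    two variables and reverses their comparison. This is why the permutations leave the action and
    come back as relations among generators. The generators resolved are [B ++ ext] and not [ext]
    alone, so that the image visibly contains [B]; the relations of type [isM] show that [ext] adds
    nothing to it. That the listed relations generate the kernel is Schreyer's argument: in a kernel
    element, S-pair relations merge all terms with the largest leading monomial into a multiple of
    one term, and the coefficient of that multiple must vanish because nothing else can cancel its
    leading monomial. The well-quasi-order arguments are classical and use choice. They only prove
    that some certificate is accepted, while exactness is derived from the accepted certificate
    itself. Programs see no dependent types: elements are lists of scalars and exponents, possibly
    with repetitions, and are compared through their coefficients. *)

Class Enc (K : fieldType) (A : Type) := encode : A -> value K.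
#[global] Hint Mode Enc - ! : typeclass_instances.

#[global] Instance Enc_unit K : Enc K unit := fun _ => VNil.
#[global] Instance Enc_nat K : Enc K nat := enc_nat K.
#[global] Instance Enc_bool K : Enc K bool :=
  fun b => if b then VPair VNil VNil else VNil.
#[global] Instance Enc_scal (K : fieldType) : Enc K K := @VScal K.
#[global] Instance Enc_prod K A B (EA : Enc K A) (EB : Enc K B) :
  Enc K (A * B) := fun x => VPair (encode x.1) (encode x.2).
#[global] Instance Enc_seq K A (EA : Enc K A) : Enc K (seq A) :=
  enc_seq encode.

(** One program has to serve all arguments. Functions of several arguments are registered in
    uncurried form, on pairs nested to the left. *)
Class cpt (K : fieldType) A B (EA : Enc K A) (EB : Enc K B) (f : A -> B) :=
  computes : exists g, forall a, eval g (encode a) (encode (f a)).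
Arguments cpt {K A B EA EB} f.
#[global] Hint Mode cpt - - - - - ! : typeclass_instances.

Ltac run_prims :=
  repeat first [apply EvPrim | eapply EvSeq | eapply EvFork].

(* Case analysis on a list as an application, so that [cp] recognises it. *)
Definition lcase B C (l : seq B) (f : C) (g : B -> seq B -> C) : C :=
  if l is y :: s then g y s else f.

(** A number and a list of that many [tt] have the same encoding, so iteration by a number becomes a
    fold over such a list. *)
Definition units n := nseq n tt.

Section Combinators.
Variable K : fieldType.

Lemma cpt_ext A B (EA : Enc K A) (EB : Enc K B) (f g : A -> B) :
  f =1 g -> cpt f -> cpt g.
Proof. by move=> fg [p Hp]; exists p => a; rewrite -fg. Qed.

Lemma cpt_id A (EA : Enc K A) : cpt (fun x : A => x).
Proof. by exists (Prim PId) => a; apply: EvPrim. Qed.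

Lemma cpt_comp A B C (EA : Enc K A) (EB : Enc K B) (EC : Enc K C)
    (h : B -> C) (f : A -> B) : cpt h -> cpt f -> cpt (fun x => h (f x)).
Proof. by move=> [p Hp] [q Hq]; exists (Seq q p) => a; apply: EvSeq. Qed.

Lemma cpt_pair A B C (EA : Enc K A) (EB : Enc K B) (EC : Enc K C)
    (f : A -> B) (g : A -> C) : cpt f -> cpt g -> cpt (fun x => (f x, g x)).
Proof. by move=> [p Hp] [q Hq]; exists (Fork p q) => a; apply: EvFork. Qed.

Lemma cpt_comp2 A B1 B2 C (EA : Enc K A) (EB1 : Enc K B1) (EB2 : Enc K B2)
    (EC : Enc K C) (h : B1 -> B2 -> C) (f1 : A -> B1) (f2 : A -> B2) :
  cpt (fun p => h p.1 p.2) -> cpt f1 -> cpt f2 ->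
  cpt (fun x => h (f1 x) (f2 x)).
Proof.
move=> Hh H1 H2.
exact: (cpt_comp (f := fun x => (f1 x, f2 x)) Hh (cpt_pair H1 H2)).
Qed.

Lemma cpt_comp3 A B1 B2 B3 C (EA : Enc K A) (EB1 : Enc K B1)
    (EB2 : Enc K B2) (EB3 : Enc K B3) (EC : Enc K C)
    (h : B1 -> B2 -> B3 -> C) (f1 : A -> B1) (f2 : A -> B2) (f3 : A -> B3) :
  cpt (fun p => h p.1.1 p.1.2 p.2) -> cpt f1 -> cpt f2 -> cpt f3 ->
  cpt (fun x => h (f1 x) (f2 x) (f3 x)).
Proof.
move=> Hh H1 H2 H3; exact: (cpt_comp (f := fun x => (f1 x, f2 x, f3 x)) Hh
  (cpt_pair (cpt_pair H1 H2) H3)).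
Qed.

Lemma cpt_comp4 A B1 B2 B3 B4 C (EA : Enc K A) (EB1 : Enc K B1)
    (EB2 : Enc K B2) (EB3 : Enc K B3) (EB4 : Enc K B4) (EC : Enc K C)
    (h : B1 -> B2 -> B3 -> B4 -> C)
    (f1 : A -> B1) (f2 : A -> B2) (f3 : A -> B3) (f4 : A -> B4) :
  cpt (fun p => h p.1.1.1 p.1.1.2 p.1.2 p.2) ->
  cpt f1 -> cpt f2 -> cpt f3 -> cpt f4 ->
  cpt (fun x => h (f1 x) (f2 x) (f3 x) (f4 x)).
Proof.
move=> Hh H1 H2 H3 H4.
exact: (cpt_comp (f := fun x => (f1 x, f2 x, f3 x, f4 x)) Hh
  (cpt_pair (cpt_pair (cpt_pair H1 H2) H3) H4)).
Qed.

#[global] Instance cpt_fst A B (EA : Enc K A) (EB : Enc K B) :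
  cpt (@fst A B).
Proof. by exists (Prim PHead) => a; apply: EvPrim. Qed.

#[global] Instance cpt_snd A B (EA : Enc K A) (EB : Enc K B) :
  cpt (@snd A B).
Proof. by exists (Prim PTail) => a; apply: EvPrim. Qed.

#[global] Instance cpt_mkpair A B (EA : Enc K A) (EB : Enc K B) :
  cpt (fun p => @pair A B p.1 p.2).
Proof. by apply: cpt_pair; exact _. Qed.

Lemma cpt_nil A B (EA : Enc K A) (EB : Enc K B) :
  cpt (fun _ : A => @nil B).
Proof. by exists (Prim PNil) => a; apply: EvPrim. Qed.

#[global] Instance cpt_cons A (EA : Enc K A) : cpt (fun p => @cons A p.1 p.2).
Proof. by exists (Prim PId) => a; apply: EvPrim. Qed.

Lemma is_pair_bool (b : bool) : is_pair (encode b : value K) = b.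
Proof. by case: b. Qed.

Lemma cpt_if A B (EA : Enc K A) (EB : Enc K B) (b : A -> bool) (f g : A -> B) :
  cpt b -> cpt f -> cpt g -> cpt (fun x => if b x then f x else g x).
Proof.
move=> [pb Hb] [pf Hf] [pg Hg]; exists (If pb pf pg) => a.
cbv beta.
have := Hb a; case Eb: (b a) => H.
  by apply: (EvIfTrue _ H).
by apply: (EvIfFalse _ H).
Qed.

Lemma cpt_case A B C (EA : Enc K A) (EB : Enc K B) (EC : Enc K C)
    (l : A -> seq B) (f : A -> C) (g : A -> B -> seq B -> C) :
  cpt l -> cpt f -> cpt (fun p => g p.1.1 p.1.2 p.2) ->
  cpt (fun x => lcase (l x) (f x) (g x)).
Proof.
move=> [pl Hl] [pf Hf] [pg Hg].
exists (If pl (Seq (Fork (Fork (Prim PId) (Seq pl (Prim PHead)))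
                         (Seq pl (Prim PTail))) pg) pf) => a.
cbv beta.
have := Hl a; case El: (l a) => [|y s] H.
  by apply: (EvIfFalse _ H).
apply: (EvIfTrue _ H) => //; apply: (@EvSeq _ _ _ _ (encode ((a, y), s))).
  apply: EvFork; last by apply: (EvSeq H); apply: EvPrim.
  by apply: EvFork; [apply: EvPrim | apply: (EvSeq H); apply: EvPrim].
exact: (Hg ((a, y), s)).
Qed.

(** The loop state is [(a, (s, l))], with the parameter [a] carried along unchanged. The loop test
    returns the unread list, whose encoding is a pair exactly when it is nonempty. *)
Lemma cpt_foldl A B S (EA : Enc K A) (EB : Enc K B) (ES : Enc K S)
    (f : A -> S -> B -> S) (i : A -> S) (l : A -> seq B) :
  cpt (fun p => f p.1.1 p.1.2 p.2) -> cpt i -> cpt l ->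
  cpt (fun x => foldl (f x) (i x) (l x)).
Proof.
move=> [pf Hf] [pi Hi] [pl Hl].
pose hd := Prim PHead; pose tl := Prim PTail.
pose body := Fork hd (Fork
   (Seq (Fork (Fork hd (Seq tl hd)) (Seq tl (Seq tl hd))) pf)
   (Seq tl (Seq tl tl))).
exists (Seq (Seq (Fork (Prim PId) (Fork pi pl)) (While (Seq tl tl) body))
            (Seq tl hd)) => a.
have loop s l0 : eval (While (Seq tl tl) body) (encode (a, (s, l0)))
                   (encode (a, (foldl (f a) s l0, [::] : seq B))).
  elim: l0 s => [|y l0 IH] s /=.
    apply: (@EvWhileFalse _ _ _ _ (encode ([::] : seq B))) => //.
    by apply: EvSeq; apply: EvPrim.
  apply: (@EvWhileTrue _ _ _ _ (encode (y :: l0)) (encode (a, (f a s y, l0))))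
    => //; first by apply: EvSeq; apply: EvPrim.
  apply: EvFork; first exact: EvPrim.
  apply: EvFork; last by run_prims.
  apply: (@EvSeq _ _ _ _ (encode ((a, s), y))); last exact: (Hf ((a, s), y)).
  apply: EvFork; last by run_prims.
  apply: EvFork; first exact: EvPrim.
  by apply: EvSeq; apply: EvPrim.
apply: (@EvSeq _ _ _ _
  (encode (a, (foldl (f a) (i a) (l a), [::] : seq B)))); last by run_prims.
apply: (EvSeq (x := encode (a, (i a, l a)))); last exact: loop.
by apply: EvFork; [apply: EvPrim | apply: EvFork].
Qed.

(** A counter is increased until [b] holds. No bound on the search is computed: halting on the
    inputs in [P] rests on the bare existence of a witness. *)
Lemma cpt_search A (EA : Enc K A) (b : A -> nat -> bool) (P : A -> Prop) :
  cpt (fun p => b p.1 p.2) -> (forall a, P a -> exists n, b a n) ->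
  exists g, forall a, P a -> exists2 n, b a n & eval g (encode a) (encode (a, n)).
Proof.
move=> [pb Hb] ex.
pose nb := If pb (Prim PNil) (Fork (Prim PNil) (Prim PNil)).
have nbE a n : eval nb (encode (a, n)) (encode (~~ b a n)).
  have := Hb (a, n); rewrite /=; case: (b a n) => H.
    by apply: (EvIfTrue _ H) => //; apply: EvPrim.
  by apply: (EvIfFalse _ H) => //; apply: EvFork; apply: EvPrim.
pose inc := Fork (Prim PHead) (Fork (Prim PNil) (Prim PTail)).
exists (Seq (Fork (Prim PId) (Prim PNil)) (While nb inc)) => a Pa.
pose st n := @encode K _ (Enc_prod EA (Enc_nat K)) (a, n).
suff [n bn Hn] : exists2 n, b a n & eval (While nb inc) (st 0%N) (st n).
  exists n => //; apply: EvSeq Hn; apply: EvFork; apply: EvPrim.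
case: (ex a Pa) => m bm.
(* Induction on the distance from the counter to a known witness; an earlier witness may stop the
   loop. *)
have : exists k, b a (0 + k) by exists m.
move=> [k]; elim: k 0%N => [|k IH] n0 Hk.
  rewrite addn0 in Hk; exists n0 => //.
  by apply: (@EvWhileFalse K nb inc _ _ (nbE a n0)); rewrite is_pair_bool Hk.
case E: (b a n0).
  exists n0 => //.
  by apply: (@EvWhileFalse K nb inc _ _ (nbE a n0)); rewrite is_pair_bool E.
case: (IH n0.+1); first by rewrite addSnnS.
move=> n bn Hn; exists n => //.
apply: (@EvWhileTrue K nb inc _ _ (st n0.+1) _ (nbE a n0)) => //.
  by rewrite is_pair_bool E.
by apply: EvFork; [apply: EvPrim | apply: EvFork; apply: EvPrim].
Qed.

Lemma cpt_true A (EA : Enc K A) : cpt (fun _ : A => true).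
Proof.
by exists (Fork (Prim PNil) (Prim PNil)) => a; apply: EvFork; apply: EvPrim.
Qed.

Lemma cpt_false A (EA : Enc K A) : cpt (fun _ : A => false).
Proof. by exists (Prim PNil) => a; apply: EvPrim. Qed.

Lemma cpt_0 A (EA : Enc K A) : cpt (fun _ : A => 0%N).
Proof. by exists (Prim PNil) => a; apply: EvPrim. Qed.

#[global] Instance cpt_S : @cpt K _ _ _ _ S.
Proof.
exists (Fork (Prim PNil) (Prim PId)) => a; apply: EvFork; apply: EvPrim.
Qed.

Lemma cpt_nat A (EA : Enc K A) (n : nat) : cpt (fun _ : A => n).
Proof.
elim: n => [|n IH]; first exact: cpt_0.
exact: (cpt_comp (h := S)).
Qed.

Lemma enc_nseq n : encode (nseq n tt) = encode n :> value K.
Proof. by elim: n => //= n IH; congr VPair. Qed.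

#[global] Instance cpt_units : @cpt K _ _ _ _ units.
Proof. by exists (Prim PId) => n; rewrite enc_nseq; apply: EvPrim. Qed.

Lemma cpt_iter A S (EA : Enc K A) (ES : Enc K S) (f : A -> S -> S)
    (i : A -> S) (n : A -> nat) :
  cpt (fun p => f p.1 p.2) -> cpt i -> cpt n ->
  cpt (fun x => iter (n x) (f x) (i x)).
Proof.
move=> Hf Hi Hn.
apply: (@cpt_ext _ _ _ _
  (fun x => foldl (fun s (_ : unit) => f x s) (i x) (units (n x)))).
  move=> x; elim: (n x) (i x) => //= m IH s.
  by rewrite IH -iterSr.
apply: (cpt_foldl (f := fun x s _ => f x s)) => //.
  by apply: (cpt_comp2 (h := f)) => //; apply: cpt_comp; exact _.
exact: (cpt_comp (h := units)).
Qed.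

#[global] Instance cpt_addr : cpt (fun p : K * K => (p.1 + p.2)%R).
Proof. by exists (Prim PAdd) => -[a b]; apply: EvPrim. Qed.

#[global] Instance cpt_mulr : cpt (fun p : K * K => (p.1 * p.2)%R).
Proof. by exists (Prim PMul) => -[a b]; apply: EvPrim. Qed.

#[global] Instance cpt_oppr : cpt (fun x : K => (- x)%R).
Proof. by exists (Prim POpp) => a; apply: EvPrim. Qed.

#[global] Instance cpt_invr : cpt (fun x : K => (x^-1)%R).
Proof. by exists (Prim PInv) => a; apply: EvPrim. Qed.

Lemma cpt_zero A (EA : Enc K A) : cpt (fun _ : A => 0%R : K).
Proof. by exists (Prim PZero) => a; apply: EvPrim. Qed.

Lemma cpt_one A (EA : Enc K A) : cpt (fun _ : A => 1%R : K).
Proof. by exists (Prim POne) => a; apply: EvPrim. Qed.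

#[global] Instance cpt_eqscal : cpt (fun p : K * K => p.1 == p.2).
Proof. by exists (Prim PEq) => -[a b]; apply: EvPrim. Qed.

End Combinators.

Ltac cpt_step :=
  cbv beta;
  lazymatch goal with
  | |- cpt (fun x => x) => apply cpt_id
  | |- cpt (fun _ => @nil _) => apply cpt_nil
  | |- cpt (fun _ => true) => apply cpt_true
  | |- cpt (fun _ => false) => apply cpt_false
  | |- cpt (fun _ => 0%R) => apply cpt_zero
  | |- cpt (fun _ => 1%R) => apply cpt_one
  | |- @cpt _ _ nat _ _ (fun _ => ?n) => apply cpt_nat
  | |- cpt (fun x => lcase (@?l x) (@?f x) (@?g x)) =>
      apply (@cpt_case _ _ _ _ _ _ _ l f g)
  | |- cpt (fun x => foldl (@?f x) (@?i x) (@?l x)) =>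
      apply (@cpt_foldl _ _ _ _ _ _ _ f i l)
  | |- cpt (fun x => iter (@?n x) (@?f x) (@?i x)) =>
      apply (@cpt_iter _ _ _ _ _ f i n)
  | _ => fail
  end.

Ltac cpt_app :=
  first
  [ solve [exact _]
  | match goal with |- cpt (fun x => ?h (@?f x)) =>
      apply (@cpt_comp _ _ _ _ _ _ _ h f); [exact _ |] end
  | match goal with |- cpt (fun x => ?h (@?f x) (@?g x)) =>
      apply (@cpt_comp2 _ _ _ _ _ _ _ _ _ h f g); [exact _ | |] end
  | match goal with |- cpt (fun x => ?h (@?f x) (@?g x) (@?k x)) =>
      apply (@cpt_comp3 _ _ _ _ _ _ _ _ _ _ _ h f g k); [exact _ | | |] end
  | match goal with |- cpt (fun x => ?h (@?f x) (@?g x) (@?k x) (@?l x)) =>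
      apply (@cpt_comp4 _ _ _ _ _ _ _ _ _ _ _ _ _ h f g k l);
      [exact _ | | | |] end
  | match goal with |- cpt (fun _ => ?n) => apply (@cpt_nat _ _ _ n) end ].

(** Descends through the body of a function. Operators with bound variables ([foldl], [iter],
    [lcase]) have rules of their own; other applications are split by composition until an instance
    applies. The later redefinitions add list operators and membership. *)
Ltac cp := repeat first [cpt_step | cpt_app | eapply cpt_if].

(** * Booleans, lists and arithmetic *)

Section Library.
Variable K : fieldType.

#[global] Instance cpt_negb : @cpt K _ _ _ _ negb.
Proof.
apply: (@cpt_ext _ _ _ _ _ (fun b : bool => if b then false else true)).
  by case.
by cp.
Qed.

#[global] Instance cpt_andb : @cpt K _ _ _ _ (fun p => p.1 && p.2).
Proof.
apply: (@cpt_ext _ _ _ _ _ (fun p : bool * bool => if p.1 then p.2 else false)).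
  by case.
by cp.
Qed.

#[global] Instance cpt_orb : @cpt K _ _ _ _ (fun p => p.1 || p.2).
Proof.
apply: (@cpt_ext _ _ _ _ _ (fun p : bool * bool => if p.1 then true else p.2)).
  by case.
by cp.
Qed.

#[global] Instance cpt_implb : @cpt K _ _ _ _ (fun p => p.1 ==> p.2).
Proof.
apply: (@cpt_ext _ _ _ _ _ (fun p : bool * bool => if p.1 then p.2 else true)).
  by case.
by cp.
Qed.

#[global] Instance cpt_catrev A (EA : Enc K A) :
  @cpt K _ _ _ _ (fun p => @catrev A p.1 p.2).
Proof.
apply: (@cpt_ext _ _ _ _ _
  (fun p : seq A * seq A => foldl (fun t x => x :: t) p.2 p.1)).
  by move=> [s t] /=; elim: s t => //= x s IH t; rewrite IH.
by cp.
Qed.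

#[global] Instance cpt_rev A (EA : Enc K A) : @cpt K _ _ _ _ (@rev A).
Proof. by rewrite /rev; cp. Qed.

#[global] Instance cpt_cat A (EA : Enc K A) : @cpt K _ _ _ _ (fun p => @cat A p.1 p.2).
Proof.
apply: (@cpt_ext _ _ _ _ _ (fun p : seq A * seq A => catrev (rev p.1) p.2)).
  by move=> [s t]; rewrite catrevE revK.
by cp.
Qed.

Lemma cpt_map X A B (EA : Enc K A) (EB : Enc K B) (EX : Enc K X) (f : X -> A -> B) (l : X -> seq A) :
  cpt (fun p => f p.1 p.2) -> cpt l -> cpt (fun x => map (f x) (l x)).
Proof.
move=> Hf Hl; apply: (@cpt_ext _ _ _ _ _
  (fun x => rev (foldl (fun t y => f x y :: t) [::] (l x)))).
  move=> x; rewrite -[RHS]/(rev [::] ++ map (f x) (l x)).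
  elim: (l x) [::] => [|y s IH] t /=; first by rewrite cats0.
  by rewrite IH rev_cons cat_rcons.
by cp.
Qed.

Lemma cpt_filter X A (EA : Enc K A) (EX : Enc K X) (f : X -> A -> bool)
    (l : X -> seq A) :
  cpt (fun p => f p.1 p.2) -> cpt l -> cpt (fun x => filter (f x) (l x)).
Proof.
move=> Hf Hl; apply: (@cpt_ext _ _ _ _ _
  (fun x => rev (foldl (fun t y => if f x y then y :: t else t) [::] (l x)))).
  move=> x; rewrite -[RHS]/(rev [::] ++ filter (f x) (l x)).
  elim: (l x) [::] => [|y s IH] t /=; first by rewrite cats0.
  by rewrite IH; case: (f x y) => //; rewrite rev_cons cat_rcons.
by cp.
Qed.

Lemma cpt_all X A (EA : Enc K A) (EX : Enc K X) (f : X -> A -> bool)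
    (l : X -> seq A) :
  cpt (fun p => f p.1 p.2) -> cpt l -> cpt (fun x => all (f x) (l x)).
Proof.
move=> Hf Hl; apply: (@cpt_ext _ _ _ _ _
  (fun x => foldl (fun t y => t && f x y) true (l x))).
  move=> x; rewrite -[RHS]andTb.
  elim: (l x) true => [|y s IH] t /=; first by rewrite andbT.
  by rewrite IH andbA.
by cp.
Qed.

Lemma cpt_has X A (EA : Enc K A) (EX : Enc K X) (f : X -> A -> bool)
    (l : X -> seq A) :
  cpt (fun p => f p.1 p.2) -> cpt l -> cpt (fun x => has (f x) (l x)).
Proof.
move=> Hf Hl; apply: (@cpt_ext _ _ _ _ _
  (fun x => foldl (fun t y => t || f x y) false (l x))).
  move=> x; rewrite -[RHS]orFb.
  elim: (l x) false => [|y s IH] t /=; first by rewrite orbF.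
  by rewrite IH orbA.
by cp.
Qed.

#[global] Instance cpt_flatten A (EA : Enc K A) : @cpt K _ _ _ _ (@flatten A).
Proof.
apply: (@cpt_ext _ _ _ _ _ (fun s => foldl (fun t x => t ++ x) [::] s)).
  move=> s; rewrite -[RHS]cat0s.
  by elim: s [::] => /= [|x s IH] t; rewrite ?cats0 // IH catA.
by cp.
Qed.

#[global] Instance cpt_size A (EA : Enc K A) : @cpt K _ _ _ _ (@size A).
Proof.
apply: (@cpt_ext _ _ _ _ _ (fun s : seq A => foldl (fun n _ => n.+1) 0 s)).
  by move=> s; rewrite -[RHS]add0n; elim: s 0 => /= [|x s IH] n;
    rewrite ?addn0 // IH addnS.
by cp.
Qed.

#[global] Instance cpt_rcons A (EA : Enc K A) : @cpt K _ _ _ _ (fun p => @rcons A p.1 p.2).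
Proof.
apply: (@cpt_ext _ _ _ _ _ (fun p : seq A * A => p.1 ++ [:: p.2])).
  by move=> p; rewrite cats1.
by cp.
Qed.

#[global] Instance cpt_behead A (EA : Enc K A) : @cpt K _ _ _ _ (@behead A).
Proof.
apply: (@cpt_ext _ _ _ _ _ (fun s : seq A => lcase s [::] (fun _ t => t))).
  by case.
by cp.
Qed.

#[global] Instance cpt_drop A (EA : Enc K A) : @cpt K _ _ _ _ (fun p => @drop A p.1 p.2).
Proof.
apply: (@cpt_ext _ _ _ _ _ (fun p : nat * seq A => iter p.1 (@behead A) p.2)).
  move=> [n s] /=; elim: n s => [|n IH] s; first by rewrite drop0.
  by rewrite iterSr IH; case: s.
by cp.
Qed.

(** A prefix is obtained by dropping from the reversed list as many entries as [drop] would
    leave. *)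
#[global] Instance cpt_take A (EA : Enc K A) : @cpt K _ _ _ _ (fun p => @take A p.1 p.2).
Proof.
apply: (@cpt_ext _ _ _ _ _ (fun p : nat * seq A =>
  rev (drop (size (drop p.1 p.2)) (rev p.2)))).
  move=> [n s] /=; rewrite drop_rev revK size_drop.
  by case: (leqP n (size s)) => H; [rewrite subKn | rewrite (eqP (ltnW H)) subn0 take_size take_oversize // ltnW].
by cp.
Qed.

#[global] Instance cpt_nth A (EA : Enc K A) : @cpt K _ _ _ _ (fun p => @nth A p.1.1 p.1.2 p.2).
Proof.
apply: (@cpt_ext _ _ _ _ _ (fun p : A * seq A * nat =>
  lcase (drop p.2 p.1.2) p.1.1 (fun y _ => y))).
  move=> [[d s] n] /=.
  by elim: s n => [|x s IH] [|n] //=; rewrite -?IH ?drop0.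
by cp.
Qed.

(** The fold runs over the first list and carries the unread rest of the second; once that rest is
    empty, the state no longer changes. *)
#[global] Instance cpt_zip A B (EA : Enc K A) (EB : Enc K B) : @cpt K _ _ _ _ (fun p => @zip A B p.1 p.2).
Proof.
apply: (@cpt_ext _ _ _ _ _ (fun p : seq A * seq B =>
  rev (foldl (fun (st : seq (A * B) * seq B) x =>
         lcase st.2 st (fun y t => ((x, y) :: st.1, t))) ([::], p.2) p.1).1)).
  move=> [s t] /=; rewrite -[RHS]/(rev [::] ++ zip s t).
  elim: s t [::] => [|x s IH] [|y t] r /=; rewrite ?cats0 //.
    by rewrite /lcase IH; clear IH; case: s => [|? ?] /=; rewrite cats0.
  by rewrite IH rev_cons cat_rcons.
by cp.
Qed.


#[global] Instance cpt_predn : @cpt K _ _ _ _ predn.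
Proof.
apply: (@cpt_ext _ _ _ _ _ (fun n => size (behead (units n)))).
  by case=> //= n; rewrite size_nseq.
by cp.
Qed.

#[global] Instance cpt_addn : @cpt K _ _ _ _ (fun p => p.1 + p.2)%N.
Proof.
apply: (@cpt_ext _ _ _ _ _ (fun p : nat * nat => iter p.1 S p.2)).
  by move=> [m n] /=; elim: m => //= m ->.
by cp.
Qed.

#[global] Instance cpt_subn : @cpt K _ _ _ _ (fun p => p.1 - p.2)%N.
Proof.
apply: (@cpt_ext _ _ _ _ _ (fun p : nat * nat => iter p.2 predn p.1)).
  by move=> [m n] /=; elim: n => [|n IH] /=; rewrite ?subn0 // IH subnS.
by cp.
Qed.

#[global] Instance cpt_leq : @cpt K _ _ _ _ (fun p => p.1 <= p.2)%N.
Proof.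
apply: (@cpt_ext _ _ _ _ _ (fun p : nat * nat =>
  lcase (units (p.1 - p.2)) true (fun _ _ => false))).
  by move=> [m n] /=; rewrite /leq; case: (m - n)%N.
by cp.
Qed.

#[global] Instance cpt_eqn : @cpt K _ _ _ _ (fun p : nat * nat => p.1 == p.2).
Proof.
apply: (@cpt_ext _ _ _ _ _ (fun p : nat * nat =>
  (p.1 <= p.2)%N && (p.2 <= p.1)%N)).
  by move=> [m n]; rewrite eqn_leq.
by cp.
Qed.

#[global] Instance cpt_iota : @cpt K _ _ _ _ (fun p => iota p.1 p.2).
Proof.
apply: (@cpt_ext _ _ _ _ _ (fun p : nat * nat =>
  iter p.2 (fun s => rcons s (p.1 + size s)%N) [::])).
  move=> [m n] /=; elim: n => //= n ->.
  by rewrite size_iota -cats1 -[(m + n)%N :: _]/(iota (m + n) 1) -iotaD addn1.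
by cp.
Qed.

End Library.

Ltac cpt_step2 :=
  lazymatch goal with
  | |- cpt (fun x => map (@?f x) (@?l x)) => apply (@cpt_map _ _ _ _ _ _ _ f l)
  | |- cpt (fun x => filter (@?f x) (@?l x)) =>
      apply (@cpt_filter _ _ _ _ _ f l)
  | |- cpt (fun x => all (@?f x) (@?l x)) => apply (@cpt_all _ _ _ _ _ f l)
  | |- cpt (fun x => has (@?f x) (@?l x)) => apply (@cpt_has _ _ _ _ _ f l)
  | _ => fail
  end.

Ltac cp ::= repeat first [cpt_step | cpt_step2 | cpt_app | eapply cpt_if].

Section EqLibrary.
Variable K : fieldType.
Variables (A B : eqType) (EA : Enc K A) (EB : Enc K B).
Hypothesis cptA : cpt (fun p : A * A => p.1 == p.2).
Hypothesis cptB : cpt (fun p : B * B => p.1 == p.2).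

Lemma cpt_eq_prod : cpt (fun p : (A * B) * (A * B) => p.1 == p.2).
Proof.
apply: (@cpt_ext _ _ _ _ _ (fun p : (A * B) * (A * B) =>
  (p.1.1 == p.2.1) && (p.1.2 == p.2.2))).
  by move=> [[a b] [a' b']]; rewrite xpair_eqE.
by cp.
Qed.

Lemma cpt_eq_seq : cpt (fun p : seq A * seq A => p.1 == p.2).
Proof.
apply: (@cpt_ext _ _ _ _ _ (fun p : seq A * seq A =>
  (size p.1 == size p.2) && all (fun q => q.1 == q.2) (zip p.1 p.2))).
  move=> [s t] /=; elim: s t => [|x s IH] [|y t] //=.
  by rewrite eqSS eqseq_cons -IH andbCA.
by cp.
Qed.

Lemma cpt_mem : cpt (fun p : A * seq A => p.1 \in p.2).
Proof.
apply: (@cpt_ext _ _ _ _ _ (fun p : A * seq A =>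
  has (fun y => p.1 == y) p.2)).
  by move=> [x s] /=; elim: s => //= y s ->; rewrite inE.
by cp.
Qed.

Lemma cpt_index : cpt (fun p : A * seq A => index p.1 p.2).
Proof.
apply: (@cpt_ext _ _ _ _ _ (fun p : A * seq A =>
  foldl (fun n y => if p.1 == y then 0 else n.+1) 0 (rev p.2))%N).
  move=> [x s] /=; rewrite foldl_rev; elim: s => //= y s ->.
  by rewrite eq_sym.
by cp.
Qed.

End EqLibrary.
#[global] Existing Instance cpt_eq_prod.
#[global] Existing Instance cpt_eq_seq.
#[global] Existing Instance cpt_index.

Ltac cpt_step3 :=
  lazymatch goal with
  | |- cpt (fun x => in_mem (@?a x) (mem (@?s x))) =>
      apply (@cpt_comp2 _ _ _ _ _ _ _ _ _ (fun u v => u \in v) a s);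
      [apply cpt_mem; exact _ | |]
  | _ => fail
  end.

Ltac cp ::= repeat first
  [cpt_step | cpt_step2 | cpt_step3 | cpt_app | eapply cpt_if].

Section MoreLibrary.
Variable K : fieldType.

#[global] Instance cpt_uniq : @cpt K _ _ _ _ (fun s : seq nat => uniq s).
Proof.
apply: (@cpt_ext _ _ _ _ _ (fun s : seq nat =>
  (foldl (fun (st : bool * seq nat) x => (st.1 && (x \notin st.2), x :: st.2))
     (true, [::]) (rev s)).1)).
  move=> s; have -> : foldl (fun (st : bool * seq nat) x => (st.1 && (x \notin st.2), x :: st.2))
    (true, [::]) (rev s) = (uniq s, s); last by [].
  by rewrite foldl_rev; elim: s => //= x s -> /=; rewrite andbC.
by cp.
Qed.

#[global] Instance cpt_sorted : @cpt K _ _ _ _ (fun s : seq nat => sorted ltn s).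
Proof.
apply: (@cpt_ext _ _ _ _ _ (fun s : seq nat =>
  all (fun q => q.1 < q.2)%N (zip s (behead s)))).
  by case=> //= x s; elim: s x => //= y s IH x; rewrite -IH.
by cp.
Qed.

End MoreLibrary.

(** * Monomials of free modules *)

(* [(a, (i, rho))] stands for the basis element x^a e_(rho, i) of a free module
   in some width n: [a] is the c x n matrix of exponents and [rho] the list of
   values of an injection into [n]. *)
Notation mat := (seq (seq nat)).
Notation mon := (mat * (nat * seq nat))%type.
Notation vec K := (seq (GRing.Field.sort K * mon)).

(** The default value 0 outside the matrix encodes the absence of a variable, so a lookup may point
    past the last column. *)
Definition ent (a : mat) x q : nat := nth 0 (nth [::] a x) q.

(* Off the image of [pi], [index q pi] is [size pi], where [nth 0 r] vanishes. *)
Definition actrow (b pi r : seq nat) : seq nat :=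
  [seq nth 0 b q + nth 0 r (index q pi) | q <- iota 0 (size b)].

Definition actmat (b : mat) (pi : seq nat) (a : mat) : mat :=
  [seq actrow x.1 pi x.2 | x <- zip b a].

(* x^b pi_*, applied to a monomial. *)
Definition act (b : mat) (pi : seq nat) (w : mon) : mon :=
  (actmat b pi w.1, (w.2.1, [seq nth 0 pi j | j <- w.2.2])).

Definition wfinj (n d : nat) (pi : seq nat) :=
  [&& size pi == d, uniq pi & all (fun j => j < n) pi].

Section Monomials.
Variable c : nat.

Definition wfmat (n : nat) (a : mat) :=
  (size a == c) && all (fun r => size r == n) a.

Definition wfmon (ds : seq nat) (n : nat) (w : mon) :=
  [&& wfmat n w.1, w.2.1 < size ds & wfinj n (nth 0 ds w.2.1) w.2.2].

Lemma wfmat_row n a x : wfmat n a -> x < c -> size (nth [::] a x) = n.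
Proof. by case/andP=> /eqP sa /allP H xc; apply/eqP/H/mem_nth; rewrite sa. Qed.

Lemma ent_default n a x q : wfmat n a -> (c <= x) || (n <= q) -> ent a x q = 0.
Proof.
move=> wa; case: (ltnP x c) => [xc /= nq|cx _].
  by rewrite /ent nth_default // (wfmat_row wa).
by case/andP: wa => /eqP sa _; rewrite /ent (nth_default _ (n := x)) ?sa // nth_nil.
Qed.

Lemma mat_ext n a a' : wfmat n a -> wfmat n a' ->
  (forall x q, x < c -> q < n -> ent a x q = ent a' x q) -> a = a'.
Proof.
move=> wa wa' H; case/andP: (wa) => /eqP sa _; case/andP: (wa') => /eqP sa' _.
apply: (@eq_from_nth _ [::]) => [|x]; first by rewrite sa.
rewrite sa => xc; apply: (@eq_from_nth _ 0).
  by rewrite (wfmat_row wa) // (wfmat_row wa').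
by move=> q; rewrite (wfmat_row wa) // => qn; apply: H.
Qed.

Lemma index_default n d pi q : wfinj n d pi -> n <= q -> index q pi = d.
Proof.
case/and3P=> /eqP <- _ /allP lt nq; apply: memNindex; apply/negP => /lt /=.
by rewrite ltnNge nq.
Qed.

Lemma nth_inj_lt n d pi p : wfinj n d pi -> p < d -> nth 0 pi p < n.
Proof. by case/and3P=> /eqP <- _ /allP lt pd; apply/lt/mem_nth. Qed.

Lemma index_nth n d pi p : wfinj n d pi -> p < d -> index (nth 0 pi p) pi = p.
Proof. by case/and3P=> /eqP <- u _ pd; apply: index_uniq. Qed.

Lemma wf_actmat n m b pi a :
  wfmat n b -> wfmat m a -> wfmat n (actmat b pi a).
Proof.
case/andP=> /eqP sb /allP rb /andP [/eqP sa /allP ra].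
rewrite /wfmat size_map size_zip sb sa minnn eqxx; apply/allP => r.
case/mapP=> x /(nthP ([::], [::])) [i].
rewrite size_zip sb sa minnn => ic; rewrite nth_zip ?sb ?sa // => <- ->.
by rewrite size_map size_iota; apply/rb/mem_nth; rewrite sb.
Qed.

Lemma nth_actmat b pi a x : size b = c -> size a = c ->
  nth [::] (actmat b pi a) x = actrow (nth [::] b x) pi (nth [::] a x).
Proof.
move=> sb sa; case: (ltnP x c) => xc.
  rewrite (nth_map ([::], [::])) ?nth_zip ?sb ?sa //.
  by rewrite size_zip sb sa minnn.
by rewrite !nth_default // ?sb ?sa // size_map size_zip sb sa minnn.
Qed.

(** Off the image of [pi], [index q pi] is [m], one past the last column of [a], where the entry is
    0. This default is what makes the formula hold at all positions. *)
Lemma ent_actmat n m b pi a x q :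
  wfmat n b -> wfinj n m pi -> wfmat m a ->
  ent (actmat b pi a) x q = ent b x q + ent a x (index q pi).
Proof.
move=> wb wpi wa; case/andP: (wb) => /eqP sb _; case/andP: (wa) => /eqP sa _.
have wba := wf_actmat pi wb wa.
case: (ltnP x c) => xc; last by rewrite (ent_default wba) ?(ent_default wb)
  ?(ent_default wa) ?xc.
case: (ltnP q n) => qn; last first.
  rewrite (ent_default wba) ?qn ?orbT // (ent_default wb) ?qn ?orbT //.
  by rewrite (index_default wpi) // (ent_default wa) // leqnn orbT.
by rewrite /ent nth_actmat // (nth_map 0) ?nth_iota ?size_iota // (wfmat_row wb).
Qed.

Lemma wfinj_comp n m l pi rho :
  wfinj n m pi -> wfinj m l rho -> wfinj n l [seq nth 0 pi j | j <- rho].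
Proof.
move=> wpi /and3P [/eqP sr ur /allP lr]; apply/and3P; split.
- by rewrite size_map sr.
- rewrite map_inj_in_uniq // => i j /lr im /lr jm /(congr1 (index^~ pi)).
  by rewrite !(index_nth wpi).
- by apply/allP => _ /mapP [j /lr jm ->]; apply: nth_inj_lt wpi jm.
Qed.

Lemma wf_act ds n m b pi w : wfmat n b -> wfinj n m pi -> wfmon ds m w ->
  wfmon ds n (act b pi w).
Proof.
move=> wb wpi /and3P [wa wi wr]; apply/and3P; split => //.
  exact: wf_actmat wb wa.
exact: wfinj_comp wpi wr.
Qed.


(** The preimage of a position under a composite injection can be searched for in two steps. Off the
    image of [pi] the first search yields [m], which is not a value of [rho], so both sides end at
    the default entry. *)
Lemma act_comp ds n m l b pi a rho w :
  wfmat n b -> wfinj n m pi -> wfmat m a -> wfinj m l rho -> wfmon ds l w ->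
  act b pi (act a rho w) =
  act (actmat b pi a) [seq nth 0 pi j | j <- rho] w.
Proof.
move=> wb wpi wa wr /and3P [ww _ wv]; have wpr := wfinj_comp wpi wr.
congr (_, (_, _)).
  apply: (@mat_ext n) => [||x q xc qn].
  - by apply: wf_actmat wb _; apply: wf_actmat wa ww.
  - by apply: wf_actmat (wf_actmat _ wb wa) ww.
  have wba := wf_actmat pi wb wa; have waw := wf_actmat rho wa ww.
  rewrite (ent_actmat _ _ wb wpi waw) (ent_actmat _ _ wa wr ww).
  rewrite (ent_actmat _ _ wba wpr ww) (ent_actmat _ _ wb wpi wa) addnA.
  congr (_ + ent _ _ _).
  case/and3P: (wr) => /eqP sr _ /allP lr; case/and3P: (wpi) => /eqP spi _ _.
  case: (boolP (q \in pi)) => qpi; last first.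
    rewrite (memNindex qpi) spi memNindex; last first.
      by apply/negP => /lr /=; rewrite ltnn.
    rewrite memNindex ?size_map //; apply: contra qpi.
    by case/mapP=> j /lr jm ->; apply: mem_nth; rewrite spi.
  have im : index q pi < m by rewrite -spi index_mem.
  rewrite -[in RHS](nth_index 0 qpi).
  elim: (rho) lr => //= j r IH lr; rewrite IH => [|i ir]; last first.
    by apply: lr; rewrite inE ir orbT.
  congr (if _ then _ else _); apply/eqP/eqP => [->//|].
  move/(congr1 (index^~ pi)); rewrite !(index_nth wpi) //.
  by apply: lr; rewrite inE eqxx.
rewrite /= -map_comp; apply/eq_in_map => j jw /=.
rewrite (nth_map 0) //; case/and3P: (wv) => _ _ /allP /(_ _ jw).
by case/and3P: wr => /eqP ->.
Qed.

Lemma act_inj ds n m b pi u w : wfmat n b -> wfinj n m pi ->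
  wfmon ds m u -> wfmon ds m w -> act b pi u = act b pi w -> u = w.
Proof.
move=> wb wpi; case: u w => [a [i r]] [a' [i' r']] /and3P [/= wa wi wr].
move=> /and3P [/= wa' wi' wr'] [ea ei er]; subst i'; congr (_, (_, _)).
  apply: (mat_ext wa wa') => x p xc pm.
  have := congr1 (fun a => ent a x (nth 0 pi p)) ea.
  rewrite (ent_actmat _ _ wb wpi wa) (ent_actmat _ _ wb wpi wa').
  by rewrite (index_nth wpi pm) => /addnI.
case/and3P: wr wr' => _ _ lr /and3P [_ _ lr'].
elim: r r' er lr lr' {ea} => [|j r IH] [|j' r'] //= [ej er].
case/andP=> lj lr /andP [lj' lr']; congr (_ :: _); last exact: IH.
by move/(congr1 (index^~ pi)): ej; rewrite !(index_nth wpi).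
Qed.

(** * A monomial order for increasing maps *)

Fixpoint ltl (s t : seq nat) : bool :=
  match s, t with
  | _, [::] => false
  | [::], _ => true
  | x :: s, y :: t => (x < y) || (x == y) && ltl s t
  end.

Lemma ltl_irr s : ltl s s = false.
Proof. by elim: s => //= x s ->; rewrite ltnn andbF. Qed.

Lemma ltl_trans t s u : ltl s t -> ltl t u -> ltl s u.
Proof.
elim: s t u => [|x s IH] [|y t] [|z u] //= /orP [xy|/andP [/eqP <- st]].
  by case/orP=> [yz|/andP [/eqP <- _]]; rewrite ?xy // (ltn_trans xy yz).
by case/orP=> [->//|/andP [-> /(IH _ _ st) ->]]; rewrite orbT.
Qed.

Lemma ltl_total s t : [|| ltl s t, s == t | ltl t s].
Proof.
elim: s t => [|x s IH] [|y t] //=; rewrite eqseq_cons.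
by case: (ltngtP x y) => //= _; apply: IH.
Qed.

Lemma ltl_cat s1 s2 t1 t2 : size s1 = size t1 ->
  ltl (s1 ++ s2) (t1 ++ t2) = ltl s1 t1 || (s1 == t1) && ltl s2 t2.
Proof.
elim: s1 t1 => [|x s IH] [|y t] //= [/IH ->].
by rewrite eqseq_cons; case: (ltngtP x y).
Qed.

Lemma ltlP s t : size s = size t ->
  reflect (exists p, [/\ p < size s, nth 0 s p < nth 0 t p &
             forall q, q < p -> nth 0 s q = nth 0 t q]) (ltl s t).
Proof.
elim: s t => [|x s IH] [|y t] // => [_|[/IH {}IH]].
  by apply: (iffP idP) => // -[p []].
apply: (iffP idP) => /= [/orP [xy|/andP [/eqP <- /IH [p [ps lt eq]]]]|].
- by exists 0; split.
- by exists p.+1; split=> // -[|q] //= /eq.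
case=> -[|p] [ps /= lt eq]; first by rewrite lt.
have /= -> := eq 0 isT; rewrite eqxx /=; apply/orP; right; apply/IH; exists p; split=> //.
by move=> q qp; apply: (eq q.+1).
Qed.

Lemma ltl_map m f s t : (forall x y, x < y -> y < m -> f x < f y) ->
  all (fun j => j < m) s -> all (fun j => j < m) t -> size s = size t ->
  ltl s t -> ltl (map f s) (map f t).
Proof.
move=> mf; elim: s t => [|x s IH] [|y t] //= /andP [xm sm] /andP [ym tm] [st].
case/orP=> [xy|/andP [/eqP <- H]]; first by rewrite mf.
by rewrite eqxx IH ?orbT.
Qed.

(* An increasing injection maps the values of [rho] monotonically and inserts
   the same zero columns into all exponent matrices, so the lexicographic order
   on keys is compatible with it, as well as with multiplication. *)
Definition key (w : mon) : seq nat := w.2.1 :: w.2.2 ++ flatten w.1.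
Definition ltmon (u w : mon) := ltl (key u) (key w).

Lemma sorted_nth_lt n d pi p q : wfinj n d pi -> sorted ltn pi ->
  p < q -> q < d -> nth 0 pi p < nth 0 pi q.
Proof.
case/and3P=> /eqP spi _ _ so pq qd.
by apply: (sorted_ltn_nth ltn_trans 0 so) => //; rewrite inE spi // (ltn_trans pq).
Qed.

(** The first difference moves from [p] to its image under [pi]. Columns to the left of that image
    come from columns before [p], because [pi] is increasing, or from outside the image, where
    nothing is added to [b]. *)
Lemma ltl_actrow n m b pi r r' : size b = n -> size r = m -> size r' = m ->
  wfinj n m pi -> sorted ltn pi -> ltl r r' ->
  ltl (actrow b pi r) (actrow b pi r').
Proof.
move=> sb sr sr' wpi so; case/(ltlP (etrans sr (esym sr'))) => p [pr lt eq].
rewrite sr in pr; have pin := nth_inj_lt wpi pr.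
apply/ltlP; first by rewrite !size_map.
exists (nth 0 pi p); rewrite size_map size_iota sb; split=> //.
  rewrite !(nth_map 0) ?size_iota ?nth_iota ?sb // add0n.
  by rewrite (index_nth wpi) // ltn_add2l.
move=> q qp; have qn := ltn_trans qp pin.
rewrite !(nth_map 0) ?size_iota ?nth_iota ?sb // add0n; congr (_ + _).
case/and3P: (wpi) => /eqP spi _ _.
case: (boolP (q \in pi)) => [qpi|/memNindex ->]; last first.
  by rewrite !nth_default ?sr ?sr' ?spi.
apply: eq; rewrite ltnNge; apply/negP => ple.
have iq : index q pi < m by rewrite -spi index_mem.
have : nth 0 pi p <= nth 0 pi (index q pi).
  move: ple; rewrite leq_eqVlt => /orP [/eqP ->//|lt'].
  by apply: ltnW; apply: sorted_nth_lt wpi so lt' iq.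
by rewrite nth_index // leqNgt qp.
Qed.

Lemma actrow_inj n m b pi r r' : size b = n -> size r = m -> size r' = m ->
  wfinj n m pi -> (actrow b pi r == actrow b pi r') = (r == r').
Proof.
move=> sb sr sr' wpi; apply/eqP/eqP => [e|->//].
apply: (@eq_from_nth _ 0) => [|p]; first by rewrite sr.
rewrite sr => pm; have pin := nth_inj_lt wpi pm.
have := congr1 (nth 0 ^~ (nth 0 pi p)) e.
rewrite !(nth_map 0) ?size_iota ?nth_iota ?sb // add0n.
by rewrite (index_nth wpi) // => /addnI.
Qed.

Lemma ltl_actmat n m b pi a a' : wfmat n b -> wfmat m a -> wfmat m a' ->
  wfinj n m pi -> sorted ltn pi -> ltl (flatten a) (flatten a') ->
  ltl (flatten (actmat b pi a)) (flatten (actmat b pi a')).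
Proof.
move=> wb wa wa' wpi so.
case/andP: wb => /eqP; case/andP: wa => /eqP; case/andP: wa' => /eqP.
move: (c) => k; elim: k b a a' => [|k IH] [|r b] [|u a] [|u' a'] //=.
move=> [sa'] /andP [/eqP su' ra'] [sa] /andP [/eqP su ra].
move=> [sb] /andP [/eqP sr rb].
rewrite !ltl_cat ?size_map ?su ?su' // (actrow_inj sr su su' wpi).
case/orP=> [/(ltl_actrow sr su su' wpi so) ->//|/andP [/eqP -> lt]].
by rewrite eqxx IH ?orbT.
Qed.

Lemma size_flatten_mat n a : wfmat n a -> size (flatten a) = c * n.
Proof.
case/andP=> /eqP <-; elim: a => //= r a IH /andP [/eqP sr /IH sa].
by rewrite size_cat sr sa mulSn.
Qed.

Lemma ltmon_act ds n m b pi u w : wfmat n b -> wfinj n m pi -> sorted ltn pi ->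
  wfmon ds m u -> wfmon ds m w -> ltmon u w -> ltmon (act b pi u) (act b pi w).
Proof.
move=> wb wpi so; case: u w => [a [i r]] [a' [i' r']] /and3P [/= wa wi wr].
move=> /and3P [/= wa' wi' wr']; rewrite /ltmon /=.
case: (ltngtP i i') => //= ii'; subst i'.
case/and3P: wr wr' => /eqP sr ur lr /and3P [/eqP sr' ur' lr'].
have srr' : size r = size r' by rewrite sr.
rewrite !ltl_cat ?size_map //.
case/orP=> [lt|/andP [/eqP -> lt]].
  rewrite (@ltl_map m _ _ _ _ lr lr') // => x y xy ym.
  exact: sorted_nth_lt wpi so xy ym.
by rewrite eqxx (ltl_actmat wb wa wa' wpi so lt) orbT.
Qed.

Lemma flatten_mat_inj n a a' : wfmat n a -> wfmat n a' ->
  flatten a = flatten a' -> a = a'.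
Proof.
case/andP=> /eqP sa ra /andP [/eqP sa' ra'].
have : size a = size a' by rewrite sa.
elim: a a' ra ra' {sa sa'} => [|r a IH] [|r' a'] //=.
case/andP=> /eqP sr ra /andP [/eqP sr' ra'] [s].
move/eqP; rewrite eqseq_cat ?sr // => /andP [/eqP -> /eqP e].
by rewrite (IH a').
Qed.

Lemma key_inj ds n u w : wfmon ds n u -> wfmon ds n w -> key u = key w -> u = w.
Proof.
case: u w => [a [i r]] [a' [i' r']] /and3P [/= wa wi wr].
move=> /and3P [/= wa' wi' wr'] [ii]; subst i'.
move/eqP; rewrite eqseq_cat; last first.
  by case/and3P: wr wr' => /eqP -> _ _ /and3P [/eqP -> _ _].
by case/andP=> /eqP -> /eqP /(flatten_mat_inj wa wa') ->.
Qed.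

Lemma ltmon_total ds n u w : wfmon ds n u -> wfmon ds n w ->
  [|| ltmon u w, u == w | ltmon w u].
Proof.
move=> wu ww; rewrite /ltmon.
case/or3P: (ltl_total (key u) (key w)) => [->//|/eqP|->]; last by rewrite !orbT.
by move/(key_inj wu ww) => ->; rewrite eqxx orbT.
Qed.

Lemma ltmon_irr w : ltmon w w = false.
Proof. exact: ltl_irr. Qed.

Lemma ltmon_trans v u w : ltmon u v -> ltmon v w -> ltmon u w.
Proof. exact: ltl_trans. Qed.

(** Induction on the length, then on the first entry. The length is fixed because lists of arbitrary
    length have infinite descending chains: prepending zeros to [[:: 1]] makes it smaller and
    smaller. *)
Lemma ltl_ind L (P : seq nat -> Prop) :
  (forall s, size s = L -> (forall t, size t = L -> ltl t s -> P t) -> P s) ->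
  forall s, size s = L -> P s.
Proof.
elim: L P => [|L IH] P HP s.
  by move/size0nil->; apply: HP => // t /size0nil ->.
suff H x : forall t, size t = L -> P (x :: t).
  by case: s => // x s [/H].
elim/ltn_ind: x => x IHx; apply: IH => t st IHt.
apply: HP => [|[|y u] //= [su]]; first by rewrite /= st.
by case/orP=> [yx|/andP [/eqP -> /IHt]]; [apply: IHx | apply].
Qed.

(** At width [n], all keys of one component [i] have the same length, so [ltl_ind] applies. The
    component stands first in the key and is handled by an outer induction. *)
Lemma ltmon_ind ds n (P : mon -> Prop) :
  (forall w, wfmon ds n w -> (forall u, wfmon ds n u -> ltmon u w -> P u) ->
     P w) -> forall w, wfmon ds n w -> P w.
Proof.
move=> HP w ww; move: {2}(w.2.1) (erefl w.2.1) => i.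
elim/ltn_ind: i w ww => i IHi w ww wi.
pose Q s := forall u, wfmon ds n u -> key u = i :: s -> P u.
suff : Q (behead (key w)) by apply => //=; rewrite -wi.
have skey u : wfmon ds n u -> size (behead (key u)) = nth 0 ds u.2.1 + c * n.
  case/and3P=> wa _ /and3P [/eqP sr _ _].
  by rewrite /= size_cat sr (size_flatten_mat wa).
apply: (@ltl_ind (nth 0 ds i + c * n)); last by rewrite skey ?wi.
move=> s _ IHs u wu ku; apply: HP => // v wv; rewrite /ltmon ku.
have := skey v wv; have := erefl (key v); case: {2 3 4}(key v) => [|j t] // kv /=.
have vj : v.2.1 = j by case: kv.
rewrite vj => st; case/orP=> [ji|/andP [/eqP ej lt]]; first exact: (IHi j).
by apply: (IHs t) => //; rewrite -ej.
Qed.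

Lemma max_mon ds n (s : seq mon) : s != [::] -> all (wfmon ds n) s ->
  exists2 w, w \in s & forall u, u \in s -> (u == w) || ltmon u w.
Proof.
elim: s => // x [|y s] IH _ /andP [wx ws].
  by exists x; rewrite ?inE // => u; rewrite inE => ->.
have [//|//|w ws' H] := IH.
have /allP wfs : all (wfmon ds n) (y :: s) by [].
have ww := wfs _ ws'.
case/or3P: (ltmon_total wx ww) => [lt|/eqP e|lt].
- exists w; first by rewrite inE ws' orbT.
  by move=> u; rewrite inE => /orP [/eqP ->|/H //]; rewrite lt orbT.
- exists w; first by rewrite inE ws' orbT.
  by move=> u; rewrite inE => /orP [/eqP ->|/H //]; rewrite e eqxx.
exists x; first by rewrite inE eqxx.
move=> u; rewrite inE => /orP [->//|/H /orP [/eqP ->|lt']].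
  by rewrite lt orbT.
by rewrite (ltmon_trans lt' lt) orbT.
Qed.

End Monomials.

(** * Formal sums of monomials *)

Notation dmon := ([::], (0, [::])).

Section Vectors.
Variables (K : fieldType).

(** Formal sums may repeat monomials and contain zero coefficients. Pointwise equality of [cf] is
    the equality of the elements they stand for. *)
Definition cf (v : vec K) (w : mon) : K := (\sum_(t <- v | t.2 == w) t.1)%R.

Definition scalev (k : K) (v : vec K) : vec K :=
  [seq ((k * t.1)%R, t.2) | t <- v].

Definition acts b pi (v : vec K) : vec K :=
  [seq (t.1, act b pi t.2) | t <- v].

(* [phi1 G] and [phi G] represent the map from the free module on [G] that
   sends the i-th generator to the i-th entry (width, element) of [G]. *)
Definition phi1 (G : seq (nat * vec K)) (t : mon) : vec K :=
  acts t.1 t.2.2 (nth (0, [::]) G t.2.1).2.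

Definition phi (G : seq (nat * vec K)) (z : vec K) : vec K :=
  flatten [seq scalev t.1 (phi1 G t.2) | t <- z].

Definition widths (G : seq (nat * vec K)) := [seq g.1 | g <- G].

Lemma cf_nil w : cf [::] w = 0%R.
Proof. by rewrite /cf big_nil. Qed.

Lemma cf_cons t v w : cf (t :: v) w = ((if t.2 == w then t.1 else 0) + cf v w)%R.
Proof. by rewrite /cf big_cons; case: eqP; rewrite ?add0r. Qed.

Lemma cf_cat v1 v2 w : cf (v1 ++ v2) w = (cf v1 w + cf v2 w)%R.
Proof. by rewrite /cf big_cat. Qed.

Lemma cf_scale k v w : cf (scalev k v) w = (k * cf v w)%R.
Proof. by rewrite /cf big_map mulr_sumr. Qed.

Lemma cf_notin v w : w \notin [seq t.2 | t <- v] -> cf v w = 0%R.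
Proof.
move=> H; rewrite /cf big_seq_cond big1 // => t /andP [tv /eqP e].
by case/mapP: H; exists t.
Qed.

(** Both sums are regrouped over [r], which lists every occurring monomial once. This is the common
    reason why [acts], [phi] and later [sem] respect equality of coefficients. *)
Lemma lin_ext (V : zmodType) (F : mon -> K -> V) v v' :
  (forall w, F w 0%R = 0%R) -> (forall w a b, F w (a + b)%R = (F w a + F w b)%R) ->
  cf v =1 cf v' -> (\sum_(t <- v) F t.2 t.1 = \sum_(t <- v') F t.2 t.1)%R.
Proof.
move=> F0 FD e.
pose r := undup [seq t.2 | t <- v ++ v'].
have H u : {subset u <= v ++ v'} ->
    (\sum_(t <- u) F t.2 t.1 = \sum_(w <- r) F w (cf u w))%R.
  elim: u => [|t u IH] su.
    by rewrite big_nil big1 // => w _; rewrite cf_nil.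
  rewrite big_cons IH => [|x xu]; last by apply: su; rewrite inE xu orbT.
  under [RHS]eq_bigr => w _ do rewrite cf_cons FD.
  rewrite big_split /=; congr (_ + _)%R.
  have tr : t.2 \in r.
    by rewrite mem_undup; apply: map_f; apply: su; rewrite inE eqxx.
  rewrite (bigD1_seq t.2) ?undup_uniq //= eqxx big1 ?addr0 // => w.
  by rewrite eq_sym => /negPf ->.
rewrite H => [|x xv]; last by rewrite mem_cat xv.
rewrite [RHS]H => [|x xv]; last by rewrite mem_cat xv orbT.
by apply: eq_bigr => w _; rewrite e.
Qed.

Lemma cf_acts b pi v w :
  (cf (acts b pi v) w = \sum_(t <- v) t.1 * (act b pi t.2 == w)%:R)%R.
Proof.
rewrite /cf big_map big_mkcond /=; apply: eq_bigr => t _.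
by case: eqP; rewrite ?mulr1 ?mulr0.
Qed.

Lemma acts_ext b pi v v' : cf v =1 cf v' -> cf (acts b pi v) =1 cf (acts b pi v').
Proof.
move=> e w; rewrite !cf_acts.
apply: (@lin_ext _ (fun u k => (k * (act b pi u == w)%:R)%R)) => //.
  by move=> u; rewrite mul0r.
by move=> u x y; rewrite mulrDl.
Qed.

Lemma cf_phi G z w : (cf (phi G z) w = \sum_(t <- z) t.1 * cf (phi1 G t.2) w)%R.
Proof.
elim: z => [|t z IH]; first by rewrite big_nil cf_nil.
by rewrite /phi /= cf_cat cf_scale big_cons -/(phi _ _) IH.
Qed.

Lemma phi_ext G z z' : cf z =1 cf z' -> cf (phi G z) =1 cf (phi G z').
Proof.
move=> e w; rewrite !cf_phi.
apply: (@lin_ext _ (fun u k => (k * cf (phi1 G u) w)%R)) => //.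
  by move=> u; rewrite mul0r.
by move=> u x y; rewrite mulrDl.
Qed.

Lemma phi_cat G z z' : phi G (z ++ z') = phi G z ++ phi G z'.
Proof. by rewrite /phi map_cat flatten_cat. Qed.

Lemma cf_phi_scale G k z w : cf (phi G (scalev k z)) w = (k * cf (phi G z) w)%R.
Proof.
by rewrite !cf_phi big_map mulr_sumr; apply: eq_bigr => t _; rewrite mulrA.
Qed.

Lemma cf_phi_cons G t z w :
  cf (phi G (t :: z)) w = (t.1 * cf (phi1 G t.2) w + cf (phi G z) w)%R.
Proof. by rewrite !cf_phi big_cons. Qed.

Section Wf.
Variable c : nat.

Definition wfvec ds n (v : vec K) := all (fun t => wfmon c ds n t.2) v.
Definition wfgens ds (G : seq (nat * vec K)) := all (fun g => wfvec ds g.1 g.2) G.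

Lemma wf_acts ds n m b pi v : wfmat c n b -> wfinj n m pi ->
  wfvec ds m v -> wfvec ds n (acts b pi v).
Proof.
move=> wb wpi wv; rewrite /wfvec all_map; apply: sub_all wv => t /=.
exact: wf_act wb wpi.
Qed.

Lemma wf_scalev ds n k v : wfvec ds n (scalev k v) = wfvec ds n v.
Proof. by rewrite /wfvec all_map. Qed.

Lemma wfvec_cat ds n v v' : wfvec ds n (v ++ v') = wfvec ds n v && wfvec ds n v'.
Proof. exact: all_cat. Qed.

Lemma wf_nth_gen ds G i : wfgens ds G -> i < size G ->
  wfvec ds (nth 0 (widths G) i) (nth (0, [::]) G i).2.
Proof.
move=> /allP H iG; rewrite (nth_map (0, [::])) //.
exact: (H _ (mem_nth _ iG)).
Qed.

Lemma wf_phi1 ds G n t : wfgens ds G -> wfmon c (widths G) n t ->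
  wfvec ds n (phi1 G t).
Proof.
move=> wG /and3P [wa wi wr]; apply: wf_acts wa wr _.
by apply: wf_nth_gen => //; rewrite -(size_map fst).
Qed.

Lemma wf_phi ds G n z : wfgens ds G -> wfvec (widths G) n z -> wfvec ds n (phi G z).
Proof.
move=> wG; elim: z => //= t z IH /andP [wt wz].
by rewrite /phi /= wfvec_cat wf_scalev (wf_phi1 wG wt) IH.
Qed.

Lemma phi1_act ds G n m b pi t : wfgens ds G -> wfmat c n b -> wfinj n m pi ->
  wfmon c (widths G) m t -> phi1 G (act b pi t) = acts b pi (phi1 G t).
Proof.
move=> wG wb wpi /and3P [wa wi wr]; rewrite /phi1 /acts -map_comp /=.
apply/eq_in_map => u ug /=; congr (_, _); apply/esym.
apply: (act_comp wb wpi wa wr (ds := ds)).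
have iG : t.2.1 < size G by rewrite -(size_map fst).
exact: (allP (wf_nth_gen wG iG)).
Qed.

Lemma phi_act ds G n m b pi z : wfgens ds G -> wfmat c n b -> wfinj n m pi ->
  wfvec (widths G) m z -> phi G (acts b pi z) = acts b pi (phi G z).
Proof.
move=> wG wb wpi; elim: z => //= t z IH /andP [wt wz].
rewrite /phi /= -!/(phi _ _) IH // (phi1_act wG wb wpi wt).
rewrite /acts map_cat; congr (_ ++ _).
by rewrite /scalev -!map_comp.
Qed.

End Wf.

Lemma cf_lower w v : all (fun u => ltmon u.2 w) v -> cf v w = 0%R.
Proof.
move=> /allP H; apply: cf_notin; apply/mapP => -[t /H lt e].
by rewrite -e ltmon_irr in lt.
Qed.

End Vectors.

(** * Certificates *)

Fixpoint lists A n (L : seq A) : seq (seq A) :=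
  if n is n'.+1 then flatten [seq [seq x :: s | s <- lists n' L] | x <- L]
  else [:: [::]].

Definition listsle A n (L : seq A) : seq (seq A) :=
  flatten [seq lists j L | j <- iota 0 n.+1].

Definition prod_seq A B (s : seq A) (t : seq B) : seq (A * B) :=
  flatten [seq [seq (x, y) | y <- t] | x <- s].

Lemma mem_prod_seq (A B : eqType) (s : seq A) (t : seq B) x y :
  ((x, y) \in prod_seq s t) = (x \in s) && (y \in t).
Proof.
apply/flatten_mapP/andP => [[x' xs] /mapP [y' yt [-> ->]]|[xs yt]]; first by [].
by exists x => //; apply: map_f.
Qed.

Lemma mem_lists (A : eqType) n (L : seq A) s :
  (s \in lists n L) = (size s == n) && all (fun x => x \in L) s.
Proof.
elim: n s => [|n IH] [|x s] //=.
  by apply/negP => /flatten_mapP [x _ /mapP [] ].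
apply/flatten_mapP/idP => [[x' xL /mapP [s' Hs [-> ->]]]|].
  by move: Hs; rewrite IH => /andP [/eqP -> ->]; rewrite xL eqxx.
rewrite eqSS => /and3P [ss xL sL]; exists x => //; apply: map_f.
by rewrite IH ss.
Qed.

Lemma mem_listsle (A : eqType) n (L : seq A) s :
  (s \in listsle n L) = (size s <= n) && all (fun x => x \in L) s.
Proof.
apply/flatten_mapP/andP => [[j]|[sn sL]].
  by rewrite mem_iota mem_lists add0n ltnS => jn /andP [/eqP ->].
by exists (size s); rewrite ?mem_iota ?add0n ?ltnS // mem_lists eqxx.
Qed.

Section Certificates.
Variables (K : fieldType) (c : nat).

Definition allterms (ds : seq nat) k N : seq mon :=
  [seq w <- prod_seq (lists c (listsle N (iota 0 N.+1)))
              (prod_seq (iota 0 (size ds)) (listsle N (iota 0 N.+1)))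
  | wfmon c ds k w].

Definition small N (a : mat) := all (fun r => all (fun e => e <= N) r) a.

(** Rows have length [k], and a duplicate-free list of values below [k] has length at most [k];
    hence lists of length at most [N] with entries at most [N] suffice. *)
Lemma mem_allterms ds k N w : wfmon c ds k w -> k <= N -> small N w.1 ->
  w \in allterms ds k N.
Proof.
move=> ww kN /allP sw; rewrite mem_filter ww andTb.
have memL e : (e \in iota 0 N.+1) = (e <= N) by rewrite mem_iota add0n ltnS.
move: (iota 0 N.+1) memL => L memL.
case: w ww sw => a [i r] /and3P [/= /andP [sa /allP ra] wi] /and3P [sr ur /allP lr] sw.
rewrite !mem_prod_seq mem_lists mem_listsle mem_iota sa wi !andTb.
apply/and3P; split.
- apply/allP => x xa; rewrite mem_listsle (eqP (ra _ xa)) kN andTb.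
  by apply/allP => e ex; rewrite memL; apply: (allP (sw _ xa)).
- rewrite (leq_trans _ kN) // -[k](size_iota 0).
  by apply: uniq_leq_size => // j /lr; rewrite mem_iota.
- apply/allP => j /lr jk; rewrite memL.
  exact: leq_trans (ltnW jk) kN.
Qed.

(** For good terms this is the leading monomial: the elements of [ext] are monic with their leading
    term in front, and increasing maps keep it in front. *)
Definition lmt (G : seq (nat * vec K)) (t : mon) : mon :=
  (nth (0%R, dmon) (phi1 G t) 0).2.

(* For a list [G = B ++ ext] with [nB = size B], the good terms are the OI
   multiples of the elements of the Groebner basis [ext]. *)
Definition good nB (t : mon) := (nB <= t.2.1) && sorted ltn t.2.2.

Definition monic (v : vec K) :=
  lcase v false (fun t r => (t.1 == 1%R) && all (fun u => ltmon u.2 t.2) r).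

(* [isA]: the relation [s] rewrites [t] in terms of good terms. [isM]: it
   rewrites [t] in terms of [B]. [isB]: it is the syzygy of an S-pair, with
   lower good terms as remainder. *)
Definition isA nB (t : mon) (s : vec K) :=
  lcase s false (fun u z => (u == (1%R, t)) && all (fun x => good nB x.2) z).

Definition isM nB (t : mon) (s : vec K) :=
  lcase s false (fun u z => (u == (1%R, t)) && all (fun x => x.2.2.1 < nB) z).

Definition isB G nB (t t' : mon) (s : vec K) :=
  (take 2 s == [:: (1%R, t); ((-1)%R, t')]) &&
  all (fun u => good nB u.2 && ltmon (lmt G u.2) (lmt G t)) (drop 2 s).

(** A coefficient can be nonzero only at a monomial that occurs, so vanishing is decided by finitely
    many tests. *)
Definition isnull (v : vec K) := all (fun t => cf v t.2 == 0%R) v.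

Lemma isnullP v : reflect (forall w, cf v w = 0%R) (isnull v).
Proof.
apply: (iffP allP) => [H w|H t _]; last by rewrite H.
case: (boolP (w \in [seq t.2 | t <- v])) => [/mapP [t tv ->]|].
  exact/eqP/H.
exact: cf_notin.
Qed.

Definition check_terms G nB (S : seq (nat * vec K)) N k (t : mon) :=
  [&& has (fun s => (s.1 == k) && isA nB t s.2) S,
      has (fun s => (s.1 == k) && isM nB t s.2) S &
      all (fun t' => [&& good nB t, good nB t' & lmt G t == lmt G t'] ==>
             has (fun s => (s.1 == k) && isB G nB t t' s.2) S)
        (allterms (widths G) k N)].

(* [(ext, S, N)] certifies that [ext] is a Groebner basis of the OI-module
   underlying <B> and that [S] generates the relations of [B ++ ext]. Testing
   the terms of width at most [N] suffices: two injections of the widths of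
   elements of [B ++ ext] factor through the union of their images. *)
Definition check ds (B ext S : seq (nat * vec K)) N :=
  [&& wfgens c ds ext,
      all (fun g => monic g.2) ext,
      all (fun g => g.1 + g.1 <= N) (B ++ ext),
      all (fun g => all (fun t => small N t.2.1) g.2) ext,
      all (fun s => wfvec c (widths (B ++ ext)) s.1 s.2 &&
                    isnull (phi (B ++ ext) s.2)) S &
      all (fun k => all (check_terms (B ++ ext) (size B) S N k)
                        (allterms (widths (B ++ ext)) k N)) (iota 0 N.+1)].

End Certificates.

(** * Soundness of certificates *)

(** The entries of [sigma] are positions in [rho], and positions in an increasing list inherit the
    order of the entries. It is applied with [rho] the sorted image of one injection or the union of
    the images of two. *)
Lemma factor_inj n d tau rho : wfinj n d tau -> uniq rho ->
  {subset tau <= rho} ->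
  let sigma := [seq index x rho | x <- tau] in
  [/\ wfinj (size rho) d sigma, [seq nth 0 rho j | j <- sigma] = tau &
      sorted ltn rho -> sorted ltn tau -> sorted ltn sigma].
Proof.
case/and3P=> /eqP st ut lt ur sub /=; split.
- apply/and3P; split; first by rewrite size_map st.
    rewrite map_inj_in_uniq // => x y /sub xr /sub yr.
    by move/(congr1 (nth 0 rho)); rewrite !nth_index.
  by apply/allP => _ /mapP [x /sub xr ->]; rewrite index_mem.
- rewrite -map_comp -[RHS]map_id; apply/eq_in_map => x /sub xr /=.
  by rewrite nth_index.
- move=> sr stau; apply: (homo_sorted_in (P := mem rho) (e := ltn)) => //.
    move=> x y xr yr; rewrite /ltn /= => xy; rewrite ltnNge leq_eqVlt; apply/negP => /orP [/eqP e|].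
      by have := congr1 (nth 0 rho) e; rewrite !nth_index // => yx;
        rewrite yx ltnn in xy.
    by move/(sorted_ltn_index ltn_trans sr _ _ yr xr); rewrite ltnNge (ltnW xy).
  by apply/allP => x /sub.
Qed.

Lemma sorted_map_nth n m pi rho : wfinj n m pi -> sorted ltn pi ->
  all (fun j => j < m) rho -> sorted ltn rho ->
  sorted ltn [seq nth 0 pi j | j <- rho].
Proof.
move=> wpi spi lr; apply: (homo_sorted_in (P := fun j => j < m) (e := ltn)) => //.
by move=> i j im jm ij; apply: sorted_nth_lt wpi spi ij jm.
Qed.

Definition mkmat c n (f : nat -> nat -> nat) : mat :=
  [seq [seq f x p | p <- iota 0 n] | x <- iota 0 c].

Lemma wf_mkmat c n f : wfmat c n (mkmat c n f).
Proof.
rewrite /wfmat size_map size_iota eqxx; apply/allP => _ /mapP [x _ ->].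
by rewrite size_map size_iota.
Qed.

Lemma ent_mkmat c n f x p : x < c -> p < n -> ent (mkmat c n f) x p = f x p.
Proof.
move=> xc pn; rewrite /ent (nth_map 0) ?size_iota // (nth_map 0) ?size_iota //.
by rewrite !nth_iota.
Qed.

Lemma small_mkmat c n f N : (forall x p, x < c -> p < n -> f x p <= N) ->
  small N (mkmat c n f).
Proof.
move=> H; apply/allP => _ /mapP [x + ->]; rewrite mem_iota => /= xc.
by apply/allP => _ /mapP [p + ->]; rewrite mem_iota => /= pn; apply: H.
Qed.

Lemma small_ent N a x q : small N a -> ent a x q <= N.
Proof.
move=> /allP H; rewrite /ent.
case: (ltnP x (size a)) => xa; last by rewrite (nth_default _ xa) nth_nil.
case: (ltnP q (size (nth [::] a x))) => qa; last by rewrite nth_default.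
by apply: (allP (H _ (mem_nth _ xa))); apply: mem_nth.
Qed.

(** Origin of the bound [g.1 + g.1 <= N] in [check]: the images of two injections together have at
    most [m + m'] elements. *)
Lemma half_sum m m' N : m + m <= N -> m' + m' <= N -> m + m' <= N.
Proof. lia. Qed.

(** Exponents of one variable: [e] and [e'] are those of two generators' leading monomials, [a] and
    [a'] those of their cofactors, and [maxn e e'] that of the least common multiple. The
    subtraction on the left is the exponent of a cofactor shared by both products. *)
Lemma sub_lcm a a' e e' : a + e = a' + e' ->
  a - (maxn e e' - e) + (maxn e e' - e) = a.
Proof. lia. Qed.

Lemma sub_lcm' a a' e e' : a + e = a' + e' ->
  a - (maxn e e' - e) + (maxn e e' - e') = a'.
Proof. lia. Qed.

(** Along an increasing injection [act] is strictly monotone, so the first term remains the largest,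
    with coefficient 1. *)
Lemma phi1_monic (K : fieldType) c ds (G : seq (nat * vec K)) n t :
  wfgens c ds G -> wfmon c (widths G) n t -> sorted ltn t.2.2 ->
  monic (nth (0, [::]) G t.2.1).2 -> wfmon c ds n (lmt G t) /\
  exists2 r, phi1 G t = (1%R, lmt G t) :: r &
             all (fun u => ltmon u.2 (lmt G t)) r.
Proof.
move=> wG wt so; case/and3P: (wt) => wa; rewrite size_map => lt wpi.
have := wf_nth_gen wG lt; rewrite /lmt /phi1.
case: (nth _ G _).2 => //= -[k w] r /andP [ww wr] /andP [/eqP /= -> lr].
split; first exact: wf_act wa wpi ww.
eexists; first by [].
rewrite all_map; apply/allP => u ur /=.
by apply: (ltmon_act wa wpi so _ ww); [apply: (allP wr) | apply: (allP lr)].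
Qed.

Lemma mem_nth_cat (T : eqType) x0 (s t : seq T) i :
  size s <= i -> i < size (s ++ t) -> nth x0 (s ++ t) i \in t.
Proof.
rewrite size_cat nth_cat leqNgt => /negPf si; rewrite si => lt.
by apply: mem_nth; rewrite ltn_subLR // leqNgt si.
Qed.

Section Soundness.
Variables (K : fieldType) (c : nat) (ds : seq nat).
Variables (B ext S : seq (nat * vec K)) (N : nat).
Let G := B ++ ext.
Let nB := size B.
Hypothesis wfB : wfgens c ds B.
Hypothesis chk : check c ds B ext S N.

Lemma check_wf : wfgens c ds G.
Proof. by case/and5P: chk => wfe _ _ _ _; rewrite /wfgens all_cat; apply/andP. Qed.

Lemma check_rels s : s \in S ->
  wfvec c (widths G) s.1 s.2 /\ cf (phi G s.2) =1 (fun=> 0%R).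
Proof.
by case/and5P: chk => _ _ _ _ /andP [/allP H _] /H /andP [? /isnullP].
Qed.

Lemma check_term k t : wfmon c (widths G) k t -> k <= N -> small N t.1 ->
  check_terms c G nB S N k t.
Proof.
case/and5P: chk => _ _ _ _ /andP [_ /allP H] wt kN sm.
have /allP : all (check_terms c G nB S N k) (allterms c (widths G) k N).
  by apply: H; rewrite mem_iota add0n ltnS.
by apply; apply: mem_allterms.
Qed.

Lemma check_width i : i < size G -> nth 0 (widths G) i + nth 0 (widths G) i <= N.
Proof.
case/and5P: chk => _ _ /allP H _ _ iG; rewrite (nth_map (0, [::])) //.
exact: (H _ (mem_nth _ iG)).
Qed.

Lemma good_lt n t : good nB t -> wfmon c (widths G) n t ->
  nB <= t.2.1 < size G.
Proof. by case/andP=> -> _ /and3P [_]; rewrite size_map. Qed.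

Lemma gen_monic n t : good nB t -> wfmon c (widths G) n t ->
  exists w r, [/\ (nth (0, [::]) G t.2.1).2 = (1%R, w) :: r,
    all (fun u => ltmon u.2 w) r, small N w.1,
    wfmon c ds (nth 0 (widths G) t.2.1) w &
    wfvec c ds (nth 0 (widths G) t.2.1) r].
Proof.
move=> gt wt; case/andP: (good_lt gt wt) => ge lt.
have := wf_nth_gen check_wf lt; have ie := mem_nth_cat (0, [::]) ge lt.
case/and5P: chk => _ /allP /(_ _ ie) /= mo _ /allP /(_ _ ie) /= + _.
case: (nth _ G _).2 mo => //= -[k w] r /andP [/eqP /= -> lr] /andP [sw _] /andP [ww wr].
by exists w, r.
Qed.

Lemma phi1_good n t : good nB t -> wfmon c (widths G) n t ->
  wfmon c ds n (lmt G t) /\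
  exists2 r, phi1 G t = (1%R, lmt G t) :: r &
             all (fun u => ltmon u.2 (lmt G t)) r.
Proof.
move=> gt wt; apply: (phi1_monic check_wf wt); first by case/andP: gt.
by have [w [r [-> lr _ _ _]]] := gen_monic gt wt; rewrite /= eqxx.
Qed.

Lemma lmt_act n m b pi t : good nB t -> wfmat c n b -> wfinj n m pi ->
  wfmon c (widths G) m t -> lmt G (act b pi t) = act b pi (lmt G t).
Proof.
move=> gt wb wpi wt; rewrite {1}/lmt (phi1_act check_wf wb wpi wt).
by have [_ [r -> _]] := phi1_good gt wt.
Qed.

Lemma good_act ds' n m b pi t : good nB t -> wfinj n m pi -> sorted ltn pi ->
  wfmon c ds' m t -> good nB (act b pi t).
Proof.
case/andP=> ge so wpi spi /and3P [_ _ /and3P [_ _ lr]].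
by rewrite /good ge; apply: sorted_map_nth wpi spi lr so.
Qed.

Definition goods (z : vec K) := all (fun t => good nB t.2) z.

Lemma goods_acts ds' n m b pi z : goods z -> wfinj n m pi -> sorted ltn pi ->
  wfvec c ds' m z -> goods (acts b pi z).
Proof.
move=> /allP gz wpi spi /allP wz; rewrite /goods all_map; apply/allP => t tz /=.
exact: good_act (gz _ tz) wpi spi (wz _ tz).
Qed.

(** Stands for any family of relations that contains [S] and is closed under the operations of an
    FI-module. Keeping it abstract lets the argument run on formal sums; [Next] makes it independent
    of the presentation. *)
Variable Nn : nat -> vec K -> Prop.
Hypothesis N0 : forall n, Nn n [::].
Hypothesis ND : forall n z z', Nn n z -> Nn n z' -> Nn n (z ++ z').
Hypothesis NZ : forall n k z, Nn n z -> Nn n (scalev k z).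
Hypothesis Next : forall n z z', cf z =1 cf z' -> Nn n z -> Nn n z'.
Hypothesis Nact : forall n m b pi z, wfmat c n b -> wfinj n m pi ->
  wfvec c (widths G) m z -> Nn m z -> Nn n (acts b pi z).
Hypothesis NS : forall s, s \in S -> Nn s.1 s.2.
Hypothesis Nker : forall n z, Nn n z -> cf (phi G z) =1 (fun=> 0%R).

(* Factor the injection of [t] into a permutation and an increasing map. *)
Lemma term_good n t : wfmon c (widths G) n t -> exists z,
  [/\ wfvec c (widths G) n z, goods z & Nn n ((1%R, t) :: z)].
Proof.
move=> wt; case: (wt) => /and3P [wa wi wpi].
move: wi; rewrite size_map => wi.
have [st ut lt] := and3P wpi.
set m := nth 0 _ _ in wpi st; pose tau := sort leq t.2.2.
have stau : size tau = m by rewrite size_sort (eqP st).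
have utau : uniq tau by rewrite sort_uniq.
have wtau : wfinj n m tau.
  by apply/and3P; rewrite stau eqxx utau; split=> //; rewrite all_sort.
have sotau : sorted ltn tau.
  by rewrite ltn_sorted_uniq_leq utau sort_sorted //; apply: leq_total.
have sub : {subset t.2.2 <= tau} by move=> x; rewrite mem_sort.
have [ws es _] := factor_inj wpi utau sub; rewrite stau in ws.
(* [e] is the generator moved by a permutation of its own width. The exponents and the increasing
   injection [tau] act from outside, so a single certified relation for [e] yields one for [t]. *)
pose e : mon := (mkmat c m (fun _ _ => 0),
                 (t.2.1, [seq index x tau | x <- t.2.2])).
have we : wfmon c (widths G) m e.
  by apply/and3P; split; rewrite ?wf_mkmat ?size_map.
have te : act t.1 tau e = t.
  rewrite /act /= es -surjective_pairing [RHS]surjective_pairing.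
  congr (_, _); have w0 := wf_mkmat c m (fun _ _ => 0).
  apply: (mat_ext (wf_actmat _ wa w0) wa) => x q xc qn.
  rewrite (ent_actmat _ _ wa wtau w0).
  case: (ltnP (index q tau) m) => im; first by rewrite ent_mkmat // addn0.
  by rewrite (ent_default w0) ?im ?orbT // addn0.
have mN : m <= N by apply: leq_trans (check_width wi); apply: leq_addr.
have /and3P [/hasP [s sS /andP [/eqP sm]]] :=
  check_term we mN (small_mkmat (fun _ _ _ _ => leq0n N)).
rewrite /isA; have := NS sS; have [+ _] := check_rels sS; rewrite sm.
case: s.2 => //= u z wz Nz /andP [/eqP eu gz] _ _; subst u.
case/andP: wz => _ wz.
exists (acts t.1 tau z); split.
- exact: wf_acts wa wtau wz.
- exact: (goods_acts _ gz wtau sotau wz).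
have -> : (1%R, t) :: acts t.1 tau z = acts t.1 tau ((1%R, e) :: z).
  by rewrite /acts map_cons te.
by apply: Nact wa wtau _ Nz; rewrite /wfvec /= we.
Qed.

(* With [rho] enumerating the union of the images of [t] and [t'], the pair is a
   multiple along [rho] of a pair whose exponents are cut down to those of the
   least common multiple of the two leading monomials. *)
Lemma pair_good n t t' : wfmon c (widths G) n t -> wfmon c (widths G) n t' ->
  good nB t -> good nB t' -> lmt G t = lmt G t' -> exists z,
  [/\ wfvec c (widths G) n z, goods z,
      all (fun u => ltmon (lmt G u.2) (lmt G t)) z &
      Nn n ((1%R, t) :: ((-1)%R, t') :: z)].
Proof.
move=> wt wt' gt gt' elm.
have [w [r [ew _ sw ww _]]] := gen_monic gt wt.
have [w' [r' [ew' _ sw' ww' _]]] := gen_monic gt' wt'.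
have [wa wi wpi] := and3P wt; have [wa' wi' wpi'] := and3P wt'.
have so : sorted ltn t.2.2 by case/andP: gt.
have so' : sorted ltn t'.2.2 by case/andP: gt'.
move: wi wi'; rewrite !size_map => wi wi'.
set m := nth 0 _ _ in wpi ww; set m' := nth 0 _ _ in wpi' ww'.
have lmE : lmt G t = act t.1 t.2.2 w by rewrite /lmt /phi1 ew.
have lmE' : lmt G t' = act t'.1 t'.2.2 w' by rewrite /lmt /phi1 ew'.
have [wu _ _] := and3P ww; have [wu' _ _] := and3P ww'.
(* [E] and [E'] are the exponents of the generators' leading monomials after moving them to width
   [n]. [EE] compares the two factorizations of the common leading monomial. *)
pose E x q := ent w.1 x (index q t.2.2).
pose E' x q := ent w'.1 x (index q t'.2.2).
have EE x q : ent t.1 x q + E x q = ent t'.1 x q + E' x q.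
  rewrite -(ent_actmat _ _ wa wpi wu) -(ent_actmat _ _ wa' wpi' wu').
  by move: elm; rewrite lmE lmE' => -[->].
pose rho := sort leq (undup (t.2.2 ++ t'.2.2)).
have urho : uniq rho by rewrite sort_uniq undup_uniq.
have sorho : sorted ltn rho.
  by rewrite ltn_sorted_uniq_leq urho sort_sorted //; apply: leq_total.
have mrho x : (x \in rho) = (x \in t.2.2) || (x \in t'.2.2).
  by rewrite mem_sort mem_undup mem_cat.
pose k := size rho.
have kN : k <= N.
  have := check_width wi; have := check_width wi'; rewrite -/m -/m'.
  move=> h' h; apply: leq_trans (half_sum h h').
  rewrite /k size_sort (leq_trans (size_undup _)) // size_cat.
  by case/and3P: wpi => /eqP -> _ _; case/and3P: wpi' => /eqP -> _ _.
have wrho : wfinj n k rho.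
  apply/and3P; split=> //; apply/allP => x; rewrite mrho.
  by case/and3P: wpi wpi' => _ _ /allP H /and3P [_ _ /allP H'] /orP [/H|/H'].
have sub : {subset t.2.2 <= rho} by move=> x; rewrite mrho => ->.
have sub' : {subset t'.2.2 <= rho} by move=> x; rewrite mrho orbC => ->.
have [ws es sos] := factor_inj wpi urho sub.
have [ws' es' sos'] := factor_inj wpi' urho sub'.
(* Cofactors of the two generators in their least common multiple, restricted to the columns in
   [rho]. *)
pose f x p := maxn (E x (nth 0 rho p)) (E' x (nth 0 rho p)) - E x (nth 0 rho p).
pose f' x p := maxn (E x (nth 0 rho p)) (E' x (nth 0 rho p)) - E' x (nth 0 rho p).
pose u : mon := (mkmat c k f, (t.2.1, [seq index x rho | x <- t.2.2])).
pose u' : mon := (mkmat c k f', (t'.2.1, [seq index x rho | x <- t'.2.2])).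
have wfu : wfmon c (widths G) k u.
  by apply/and3P; split; rewrite ?wf_mkmat ?size_map.
have wfu' : wfmon c (widths G) k u'.
  by apply/and3P; split; rewrite ?wf_mkmat ?size_map.
have EN x q : E x q <= N by apply: small_ent.
have EN' x q : E' x q <= N by apply: small_ent.
have smu : small N u.1.
  apply: small_mkmat => x p _ _.
  by rewrite (leq_trans (leq_subr _ _)) // geq_max EN EN'.
have smu' : small N u'.1.
  apply: small_mkmat => x p _ _.
  by rewrite (leq_trans (leq_subr _ _)) // geq_max EN EN'.
have gu : good nB u.
  by rewrite /good; case/andP: (good_lt gt wt) => -> _; apply: sos.
have gu' : good nB u'.
  by rewrite /good; case/andP: (good_lt gt' wt') => -> _; apply: sos'.
pose a0 := mkmat c k f; pose a0' := mkmat c k f'.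
(* What remains of the exponents of [t] beyond the least common multiple. By [sub_lcm'] the same [b]
   carries [u'] to [t']. *)
pose b := mkmat c n (fun x q => ent t.1 x q - ent a0 x (index q rho)).
have wb : wfmat c n b := wf_mkmat _ _ _.
have bE x q : x < c -> q < n -> ent b x q = ent t.1 x q - ent a0 x (index q rho).
  by move=> xc qn; rewrite ent_mkmat.
have wf : wfmat c k a0 := wf_mkmat c k f.
have wf' : wfmat c k a0' := wf_mkmat c k f'.
have inrho x q : q \in rho -> x < c ->
    ent a0 x (index q rho) = maxn (E x q) (E' x q) - E x q /\
    ent a0' x (index q rho) = maxn (E x q) (E' x q) - E' x q.
  move=> qr xc; rewrite !ent_mkmat ?index_mem //.
  by rewrite /f /f' nth_index.
have outrho x q : q \notin rho ->
    [/\ ent a0 x (index q rho) = 0, ent a0' x (index q rho) = 0,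
        E x q = 0 & E' x q = 0].
  move=> qr; have := qr; rewrite mrho negb_or => /andP [qt qt'].
  rewrite (memNindex qr) (ent_default wf) ?leqnn ?orbT //.
  rewrite (ent_default wf') ?leqnn ?orbT //.
  rewrite /E /E' (memNindex qt) (memNindex qt').
  case/and3P: wpi => /eqP -> _ _; case/and3P: wpi' => /eqP -> _ _.
  by rewrite (ent_default wu) ?(ent_default wu') ?leqnn ?orbT.
have bt : act b rho u = t.
  rewrite /act /= es -surjective_pairing [RHS]surjective_pairing.
  congr (_, _); apply: (mat_ext (wf_actmat _ wb wf) wa) => x q xc qn.
  rewrite (ent_actmat _ _ wb wrho wf) bE //.
  have := EE x q; case: (boolP (q \in rho)) => qr.
    by have [-> _] := inrho x q qr xc; apply: sub_lcm.
  by have [-> _ _ _] := outrho x q qr; rewrite subn0 addn0.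
have bt' : act b rho u' = t'.
  rewrite /act /= es' -surjective_pairing [RHS]surjective_pairing.
  congr (_, _); apply: (mat_ext (wf_actmat _ wb wf') wa') => x q xc qn.
  rewrite (ent_actmat _ _ wb wrho wf') bE //.
  have := EE x q; case: (boolP (q \in rho)) => qr.
    by have [-> ->] := inrho x q qr xc; apply: sub_lcm'.
  by have [-> -> -> ->] := outrho x q qr; rewrite !addn0 subn0.
(* The leading monomials agree already in width [k], because the injective [act b rho] can be
   cancelled. *)
have elu : lmt G u = lmt G u'.
  have [wlu _] := phi1_good gu wfu; have [wlu' _] := phi1_good gu' wfu'.
  apply: (act_inj wb wrho wlu wlu').
  by rewrite -(lmt_act gu wb wrho wfu) -(lmt_act gu' wb wrho wfu') bt bt'.
have /and3P [_ _ /allP /(_ u' (mem_allterms wfu' kN smu'))] := check_term wfu kN smu.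
rewrite gu gu' elu eqxx /= => /hasP [s sS].
case/andP=> /eqP sk /andP [/eqP s2 /allP lz].
have eS : s.2 = [:: (1%R, u); ((-1)%R, u')] ++ drop 2 s.2.
  by rewrite -s2 cat_take_drop.
have Nz := NS sS; have [wz _] := check_rels sS; rewrite sk eS in Nz wz.
move: (wz); rewrite wfvec_cat => /andP [_ {}wz].
exists (acts b rho (drop 2 s.2)); split.
- exact: wf_acts wb wrho wz.
- apply: (goods_acts _ _ wrho sorho wz); apply/allP => x /lz.
  by case/andP.
- rewrite all_map; apply/allP => x xz /=.
  have wx : wfmon c (widths G) k x.2 := allP wz x xz.
  have /andP [gx lx] := lz x xz.
  have [wl _] := phi1_good gu wfu; have [wx' _] := phi1_good gx wx.
  rewrite -bt (lmt_act gx wb wrho wx) (lmt_act gu wb wrho wfu).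
  exact: (ltmon_act wb wrho sorho wx' wl lx).
suff : Nn n (acts b rho ([:: (1%R, u); ((-1)%R, u')] ++ drop 2 s.2)).
  by rewrite /acts map_cat !map_cons bt bt'.
by apply: Nact wb wrho _ Nz; rewrite /wfvec all_cat /= wfu wfu'.
Qed.

(** [z'] represents the negative of a good normal form of [z], since the relation provided by
    [term_good] adds its remainder to the term. *)
Lemma reduce_goods n z : wfvec c (widths G) n z -> exists z',
  [/\ wfvec c (widths G) n z', goods z' & Nn n (z ++ z')].
Proof.
elim: z => [|[k t] z IH] => [_|/andP [wt wz]]; first by exists [::].
have [z' [wz' gz' Nz]] := IH wz; have [zt [wzt gzt Nt]] := term_good wt.
exists (scalev k zt ++ z'); split.
- by rewrite wfvec_cat wf_scalev wzt.
- by rewrite /goods all_cat all_map; apply/andP.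
apply: Next (ND (NZ k Nt) Nz) => w.
by rewrite /= !(cf_cons, cf_cat) /=; case: eqP => _; ring.
Qed.

Lemma cf_phi_lower n w z : wfvec c (widths G) n z -> goods z ->
  all (fun u => ltmon (lmt G u.2) w) z -> cf (phi G z) w = 0%R.
Proof.
elim: z => [|t z IH] /=; first by rewrite cf_nil.
case/andP=> wt wz /andP [gt gz] /andP [lt lz].
rewrite cf_phi_cons IH // addr0; have [_ [r -> lr]] := phi1_good gt wt.
rewrite cf_lower ?mulr0 //= lt; apply: sub_all lr => u lu.
exact: ltmon_trans lu lt.
Qed.

(** Each term with the leading monomial of [t0] is traded for [t0] by the relation of the pair, at
    the cost of lower good terms. Afterwards only one term can contribute at that monomial, which
    excludes cancellation there. *)
Lemma collapse n t0 z : wfmon c (widths G) n t0 -> good nB t0 ->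
  wfvec c (widths G) n z -> goods z ->
  all (fun u => (lmt G u.2 == lmt G t0) || ltmon (lmt G u.2) (lmt G t0)) z ->
  exists k z', [/\ wfvec c (widths G) n z', goods z',
    all (fun u => ltmon (lmt G u.2) (lmt G t0)) z' &
    Nn n (z ++ (k, t0) :: z')].
Proof.
move=> wt0 gt0; elim: z => [|[k t] z IH].
  move=> _ _ _; exists 0%R, [::]; split=> //; apply: Next (N0 n) => w.
  by rewrite cf_cons cf_nil addr0 /=; case: eqP.
move=> /andP [wt wz] /andP [gt gz] /andP [/= lt lz].
have [k' [z' [wz' gz' lz' Nz]]] := IH wz gz lz.
case/orP: lt => [/eqP e|lt].
  have [zt [wzt gzt lzt Nt]] := pair_good wt wt0 gt gt0 e.
  rewrite e in lzt.
  exists (k' - k)%R, (scalev k zt ++ z'); split.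
  - by rewrite wfvec_cat wf_scalev wzt.
  - by rewrite /goods all_cat all_map; apply/andP.
  - by rewrite all_cat all_map; apply/andP.
  apply: Next (ND (NZ k Nt) Nz) => w.
  by rewrite /= !(cf_cons, cf_cat) /=; do 2 case: eqP => _; ring.
(* A lower term is left alone: its negative joins the remainder and cancels it. *)
exists k', (((- k)%R, t) :: z'); split.
- by rewrite /wfvec /= wt.
- by rewrite /goods /= gt.
- by rewrite /= lt.
apply: Next Nz => w; rewrite /= !(cf_cons, cf_cat) /=.
by do 2 case: eqP => _; ring.
Qed.

(** Induction on the largest leading monomial [w]. After [collapse], the image of the sum has
    coefficient [k] at [w]; as the image is zero, [k] is zero and the rest lies strictly below
    [w]. *)
Lemma goods_kernel n z : wfvec c (widths G) n z -> goods z ->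
  cf (phi G z) =1 (fun=> 0%R) -> Nn n z.
Proof.
move=> wz gz pz.
(* A strict bound [w] is replaced by the largest leading monomial attained, to which the induction
   hypothesis applies. *)
have lower w : (forall u, wfmon c ds n u -> ltmon u w ->
    forall z, wfvec c (widths G) n z -> goods z ->
    all (fun x => (lmt G x.2 == u) || ltmon (lmt G x.2) u) z ->
    cf (phi G z) =1 (fun=> 0%R) -> Nn n z) ->
    forall z, wfvec c (widths G) n z -> goods z ->
    all (fun x => ltmon (lmt G x.2) w) z ->
    cf (phi G z) =1 (fun=> 0%R) -> Nn n z.
  move=> H [|x {wz gz pz}z] // wz gz lz pz.
  have wl : all (wfmon c ds n) [seq lmt G y.2 | y <- x :: z].
    rewrite all_map; apply/allP => y yz /=.
    by have [] := phi1_good (allP gz _ yz) (allP wz _ yz).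
  have [u /mapP [y yz ->] mx] := max_mon (s := [seq lmt G y.2 | y <- x :: z]) isT wl.
  apply: (H (lmt G y.2)) => //.
  - by have [] := phi1_good (allP gz _ yz) (allP wz _ yz).
  - exact: (allP lz).
  by apply/allP => v vz; apply: mx; apply/mapP; exists v.
have main w : wfmon c ds n w -> forall z, wfvec c (widths G) n z -> goods z ->
    all (fun x => (lmt G x.2 == w) || ltmon (lmt G x.2) w) z ->
    cf (phi G z) =1 (fun=> 0%R) -> Nn n z.
  move: w; apply: ltmon_ind => w ww IH {wz gz pz}z wz gz lz pz.
  case: (boolP (has (fun x => lmt G x.2 == w) z)) => [/hasP [[k0 t0] tz /eqP /= e]|].
    have gt0 := allP gz _ tz; have wt0 := allP wz _ tz.
    rewrite -e in lz.
    have [k [z' [wz' gz' lz' Nz]]] := collapse wt0 gt0 wz gz lz.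
    have H u : (k * cf (phi1 G t0) u + cf (phi G z') u = 0)%R.
      have := Nker Nz u.
      by rewrite phi_cat cf_cat pz add0r cf_phi_cons.
    have k0' : k = 0%R.
      have := H w; rewrite (cf_phi_lower wz' gz') -?e // addr0.
      have [_ [r -> lr]] := phi1_good gt0 wt0.
      by rewrite cf_cons cf_lower //= eqxx addr0 mulr1.
    have Nz' : Nn n z'.
      apply: (lower w) => //; first by rewrite -e.
      by move=> u; have := H u; rewrite k0' mul0r add0r.
    apply: Next (ND Nz (NZ (-1) Nz')) => u.
    rewrite !(cf_cat, cf_cons, cf_scale) k0' /= mulN1r.
    by rewrite (_ : (if _ then _ else _) = 0%R) ?add0r ?addrK //; case: ifP.
  move=> nh; apply: (lower w) => //; apply/allP => x xz.
  case/orP: (allP lz _ xz) => // e; case/hasP: nh; by exists x.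
case: z wz gz pz => [|x z] // wz gz pz.
have wl : all (wfmon c ds n) [seq lmt G y.2 | y <- x :: z].
  rewrite all_map; apply/allP => y yz /=.
  by have [] := phi1_good (allP gz _ yz) (allP wz _ yz).
have [u /mapP [y yz ->] mx] := max_mon (s := [seq lmt G y.2 | y <- x :: z]) isT wl.
apply: (main (lmt G y.2)) => //.
  by have [] := phi1_good (allP gz _ yz) (allP wz _ yz).
by apply/allP => v vz; apply: mx; apply/mapP; exists v.
Qed.

Lemma kernel_relations n z : wfvec c (widths G) n z ->
  cf (phi G z) =1 (fun=> 0%R) -> Nn n z.
Proof.
move=> wz pz; have [z' [wz' gz' Nz]] := reduce_goods wz.
have Nz' : Nn n z'.
  apply: goods_kernel => // u; have := Nker Nz u.
  by rewrite phi_cat cf_cat pz add0r.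
apply: Next (ND Nz (NZ (-1) Nz')) => u.
by rewrite !(cf_cat, cf_scale) mulN1r addrK.
Qed.

End Soundness.

(** * Well-quasi-orders and Higman's lemma *)

Definition wqo A (P : A -> Prop) (R : A -> A -> Prop) :=
  forall f : nat -> A, (forall i, P (f i)) ->
  exists i j, i < j /\ R (f i) (f j).

Definition rtrans A (R : A -> A -> Prop) :=
  forall x y z, R x y -> R y z -> R x z.

Lemma homo_step (g : nat -> nat) : (forall n, g n < g n.+1) ->
  forall i j, i < j -> g i < g j.
Proof. by move=> H i j ij; apply: (homo_ltn ltn_trans H). Qed.

(** Beyond some [N] every term has a later term above it, since otherwise the exceptions would form
    a sequence without a good pair. From [N] on, successors are chosen greedily and transitivity
    compares any two of them. *)
Lemma wqo_subseq A (P : A -> Prop) R : wqo P R -> rtrans R ->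
  forall f : nat -> A, (forall i, P (f i)) ->
  exists g : nat -> nat, (forall i j, i < j -> g i < g j) /\
    forall i j, i < j -> R (f (g i)) (f (g j)).
Proof.
move=> W TR f Pf.
have [N HN] : exists N, forall i, N <= i -> exists j, i < j /\ R (f i) (f j).
  apply: contrapT => /forallNP H.
  have {}H N : exists i, N <= i /\ forall j, i < j -> ~ R (f i) (f j).
    move: (H N) => /existsNP [i /not_implyP [Ni /forallNP Hi]].
    by exists i; split=> // j ij Rij; apply: (Hi j).
  case: (choice H) => h Hh.
  pose g := fix g n := if n is n'.+1 then h (g n').+1 else h 0.
  have gS n : g n < g n.+1 by have [] := Hh (g n).+1.
  have [i [j [ij Rij]]] := W (f \o g) (fun i => Pf _).
  have gij := homo_step gS ij.
  suff bad : forall k, g i < k -> ~ R (f (g i)) (f k) by apply: (bad _ gij).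
  by case: (i) => [|n]; [case: (Hh 0) | case: (Hh (g n).+1)].
(* Below [N] the value 0 is a placeholder that makes the choice function total. *)
have H i : exists j, N <= i -> i < j /\ R (f i) (f j).
  case: (leqP N i) => [/HN [j Hj]|_]; last by exists 0.
  by exists j.
case: (choice H) => h Hh.
pose g n := iter n h N.
have gN n : N <= g n.
  by elim: n => //= n IH; have [lt _] := Hh _ IH; apply: ltnW (leq_ltn_trans IH lt).
exists g; split.
  by apply: homo_step => n; have [] := Hh _ (gN n).
move=> i j; elim: j => // j IH; rewrite ltnS leq_eqVlt => /orP [/eqP ->|/IH Rij].
  by have [] := Hh _ (gN j).
by apply: TR Rij _; have [] := Hh _ (gN j).
Qed.

Lemma wqo_prod A B (P : A -> Prop) (Q : B -> Prop) R1 R2 :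
  wqo P R1 -> rtrans R1 -> wqo Q R2 ->
  wqo (fun x : A * B => P x.1 /\ Q x.2)
      (fun x y => R1 x.1 y.1 /\ R2 x.2 y.2).
Proof.
move=> W1 T1 W2 f Pf.
have [g [gm gR]] := wqo_subseq W1 T1 (fun i => (Pf i).1).
have [i [j [ij Rij]]] := W2 (fun i => (f (g i)).2) (fun i => (Pf (g i)).2).
by exists (g i), (g j); split; [apply: gm | split => //; apply: gR].
Qed.

Lemma wqo_preim A B (h : B -> A) (P : A -> Prop) R (Q : B -> Prop) R' :
  wqo P R -> (forall x, Q x -> P (h x)) ->
  (forall x y, Q x -> Q y -> R (h x) (h y) -> R' x y) -> wqo Q R'.
Proof.
move=> W QP RR f Qf.
have [i [j [ij Rij]]] := W (h \o f) (fun i => QP _ (Qf i)).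
by exists i, j; split=> //; apply: RR.
Qed.

Lemma wqo_leq : wqo (fun _ => True) (fun m n : nat => m <= n).
Proof.
move=> f _; suff H n : forall k, f k <= n -> exists i j, i < j /\ f i <= f j.
  exact: (H (f 0) 0).
elim: n => [|n IH] k fk.
  by exists k, k.+1; split=> //; move: fk; rewrite leqn0 => /eqP ->.
case: (leqP (f k) (f k.+1)) => [le|lt]; first by exists k, k.+1.
by apply: (IH k.+1); rewrite -ltnS; apply: leq_trans lt fk.
Qed.

Lemma wqo_eq n : wqo (fun m => m < n) (fun m k : nat => m = k).
Proof.
move=> f fn.
have /(uniqPn 0) [i [j [ij]]] : ~~ uniq [seq f i | i <- iota 0 n.+1].
  apply/negP => u; suff : n.+1 <= n by rewrite ltnn.
  rewrite -{1}(size_iota 0 n.+1) -(size_map f) -{2}(size_iota 0 n).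
  by apply: uniq_leq_size u _ => _ /mapP [i _ ->]; rewrite mem_iota add0n; apply: fn.
rewrite size_map size_iota => jn.
rewrite !(nth_map 0) ?size_iota ?nth_iota ?(ltn_trans ij) //.
by exists i, j.
Qed.

Definition leqs (s t : seq nat) := forall x, nth 0 s x <= nth 0 t x.

Lemma leqs_trans : rtrans leqs.
Proof. by move=> s t u st tu x; apply: leq_trans (st x) (tu x). Qed.

(** Dickson's lemma, by splitting off the first entry. *)
Lemma wqo_leqs c : wqo (fun s => size s = c) leqs.
Proof.
elim: c => [|c IH].
  by move=> f f0; exists 0, 1; split=> // x; rewrite (size0nil (f0 0)) nth_nil.
have W := wqo_prod wqo_leq (fun y x z => @leq_trans x y z) IH.
apply: (wqo_preim (h := fun s => (head 0 s, behead s)) W).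
  by case=> // x s /= [<-].
move=> [|x s] // [|y t] //= _ _ [xy st] [|p] //=; exact: st.
Qed.

Inductive emb A (R : A -> A -> Prop) : seq A -> seq A -> Prop :=
  | emb_nil t : emb R [::] t
  | emb_skip y s t : emb R s t -> emb R s (y :: t)
  | emb_keep x y s t : R x y -> emb R s t -> emb R (x :: s) (y :: t).

Lemma emb_positions A (R : A -> A -> Prop) d s t : emb R s t ->
  exists tau, [/\ size tau = size s, sorted ltn tau,
    all (fun q => q < size t) tau &
    forall p, p < size s -> R (nth d s p) (nth d t (nth 0 tau p))].
Proof.
elim=> {s t} [t|y s t _ [tau [st so lt H]]|x y s t Rxy _ [tau [st so lt H]]].
- by exists [::].
- exists (map S tau); rewrite size_map st sorted_map all_map; split=> //.
  by move=> p ps; rewrite (nth_map 0) ?st //=; apply: H.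
exists (0 :: map S tau); rewrite /= size_map st all_map; split=> //.
  rewrite path_sortedE; last by move=> ? ? ?; apply: ltn_trans.
  by rewrite sorted_map so andbT all_map; apply/allP.
by case=> // p ps; rewrite /= (nth_map 0) ?st //=; apply: H.
Qed.

Lemma ex_min_size A (P : seq A -> Prop) : (exists s, P s) ->
  exists2 s, P s & forall t, P t -> size s <= size t.
Proof.
move=> [s Ps]; move: {2}(size s) (leqnn (size s)) => n.
elim: n s Ps => [|n IH] s Ps sn.
  by exists s => // t _; apply: leq_trans sn _.
case: (EM (exists t, P t /\ size t <= n)) => [[t [Pt tn]]|H]; first exact: IH Pt tn.
exists s => // t Pt; apply: (leq_trans sn); rewrite ltnNge; apply/negP => tn.
by apply: H; exists t.
Qed.

Section Higman.
Variables (A : eqType) (P : A -> Prop) (R : A -> A -> Prop).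
Hypothesis WR : wqo P R.
Hypothesis TR : rtrans R.

Let Pl (s : seq A) := forall x, x \in s -> P x.
Let bad (f : nat -> seq A) :=
  (forall i, Pl (f i)) /\ forall i j, i < j -> ~ emb R (f i) (f j).
Let extendable (p : seq (seq A)) :=
  exists f, bad f /\ forall i, i < size p -> f i = nth [::] p i.

(* Nash-Williams' minimal bad sequence. *)
Theorem higman : wqo Pl (emb R).
Proof.
move=> f0 Pf0; apply: contrapT => nog.
have bad0 : extendable [::].
  exists f0; split=> //; split=> // i j ij e.
  by apply: nog; exists i, j.
(* [x] is a shortest word among those with which the prefix still extends to a bad sequence. The
   empty word is a placeholder for the other prefixes. *)
have step p : exists x, extendable p -> extendable (rcons p x) /\
    forall y, extendable (rcons p y) -> size x <= size y.
  case: (EM (extendable p)) => [ep|nep]; last by exists [::].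
  have [|x ex mx] := @ex_min_size A (fun x => extendable (rcons p x)).
    have [f [bf fp]] := ep; exists (f (size p)), f; split=> // i.
    rewrite size_rcons ltnS leq_eqVlt nth_rcons => /orP [/eqP ->|lt].
      by rewrite ltnn eqxx.
    by rewrite lt fp.
  by exists x.
case: (choice step) => nx Hnx.
pose Pr n := iter n (fun p => rcons p (nx p)) [::].
pose g n := nx (Pr n).
have sP n : size (Pr n) = n by elim: n => //= n IH; rewrite size_rcons IH.
have eP n : extendable (Pr n) by elim: n => //= n IH; have [] := Hnx _ IH.
have nP n i : i < n -> nth [::] (Pr n) i = g i.
  elim: n => //= n IH; rewrite ltnS leq_eqVlt nth_rcons sP => /orP [/eqP ->|lt].
    by rewrite ltnn eqxx.
  by rewrite lt IH.
have Pg i : Pl (g i).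
  have [f [[Pf _] fe]] := eP i.+1.
  by rewrite -(nP i.+1) // -fe ?sP.
have bg i j : i < j -> ~ emb R (g i) (g j).
  move=> ij; have [f [[_ bf] fe]] := eP j.+1.
  rewrite -(nP j.+1 i) ?(ltn_trans ij) // -(nP j.+1 j) //.
  by rewrite -!fe ?sP ?(ltn_trans ij) //; apply: bf.
have ming n f : bad f -> (forall i, i < n -> f i = g i) -> size (g n) <= size (f n).
  move=> bf fg; have [_] := Hnx _ (eP n); apply; exists f; split=> // i.
  rewrite size_rcons sP ltnS leq_eqVlt nth_rcons sP => /orP [/eqP ->|lt].
    by rewrite ltnn eqxx.
  by rewrite lt fg // nP.
(* A default letter for [head], taken from the first word, which is nonempty because the empty word
   embeds into every word. *)
have d : A.
  case E: (g 0) => [|x s] //; exfalso; apply: (bg 0 1 isT); rewrite E.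
  exact: emb_nil.
pose a n := head d (g n); pose w n := behead (g n).
have ge n : g n = a n :: w n.
  rewrite /a /w; case E: (g n) => [|x s] //.
  by case: (bg n n.+1 (ltnSn n)); rewrite E; apply: emb_nil.
have Pa n : P (a n) by apply: (Pg n); rewrite ge inE eqxx.
have [k [km kR]] := wqo_subseq WR TR Pa.
(* The competing sequence: [g] before [k 0], then the tails of the words whose first letters ascend
   along [k]. An embedding between two of its words would give one in [g], so it is bad; but its
   word at [k 0] is shorter than that of [g]. *)
pose f i := if i < k 0 then g i else w (k (i - k 0)).
have kle i : k 0 <= k i by case: i => // i; apply/ltnW/km.
have badf : bad f.
  split=> [i|i j ij].
    rewrite /f; case: ifP => _ //; move=> x xw.
    by apply: (Pg (k (i - k 0))); rewrite ge inE xw orbT.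
  rewrite /f; case: (ltnP j (k 0)) => jk.
    by rewrite (ltn_trans ij jk); apply: bg.
  case: (ltnP i (k 0)) => ik.
    move=> e; apply: (bg i (k (j - k 0))); first exact: leq_trans ik (kle _).
    by rewrite [g (k _)]ge; apply: emb_skip.
  move=> e; have lt : i - k 0 < j - k 0 by rewrite ltn_sub2r // (leq_ltn_trans ik).
  apply: (bg _ _ (km _ _ lt)); rewrite !ge; apply: emb_keep e.
  exact: kR.
have := ming (k 0) f badf; rewrite /f ltnn subnn => /(_ _).
rewrite {1}ge /= ltnn => H; suff : false by []; apply: H => i ->.
by [].
Qed.

End Higman.

(** If no finite basis exists, one can keep choosing elements of [X] that lie above none of the
    earlier ones, and the resulting sequence has no good pair. *)
Lemma finite_basis (A : eqType) (P : A -> Prop) R (X : A -> Prop) :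
  wqo P R -> (forall x, X x -> P x) ->
  exists s : seq A, (forall y, y \in s -> X y) /\
    forall x, X x -> exists2 y, y \in s & R y x.
Proof.
move=> W XP; apply: contrapT => /forallNP H.
have {}H (s : seq A) : exists x, (forall y, y \in s -> X y) ->
    X x /\ forall y, y \in s -> ~ R y x.
  (* When [s] is not contained in [X], any element serves as value, and one exists because [s] is
     then nonempty. *)
  case: (EM (forall y, y \in s -> X y)) => sX; last first.
    case: (EM (exists x : A, True)) => [[x _]|nA]; first by exists x.
    by case: sX => y; case: nA; exists y.
  have /not_andP [//|/existsNP [x /not_implyP [Xx nx]]] := H s.
  exists x => _; split=> // y ys Ryx; apply: nx; by exists y.
case: (choice H) => nx Hnx.
pose Pr n := iter n (fun p => rcons p (nx p)) [::].
have XPr n : forall y, y \in Pr n -> X y.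
  elim: n => //= n IH y; rewrite mem_rcons inE => /orP [/eqP ->|/IH //].
  by have [] := Hnx _ IH.
have in_Pr i j : i < j -> nx (Pr i) \in Pr j.
  elim: j => //= j IH; rewrite ltnS leq_eqVlt mem_rcons inE.
  by case/orP=> [/eqP ->|/IH ->]; rewrite ?eqxx ?orbT.
have [i [j [ij Rij]]] := W (nx \o Pr) (fun i => XP _ (Hnx _ (XPr i)).1).
by have [_ /(_ _ (in_Pr _ _ ij))] := Hnx _ (XPr j).
Qed.

Definition dvdmon c (u w : nat * mon) := exists b tau,
  [/\ wfmat c w.1 b, wfinj w.1 u.1 tau, sorted ltn tau & act b tau u.2 = w.2].

(* A monomial of width n is a word of length n whose letters consist of a column
   of exponents and the preimage of the position, if any; divisibility along an
   increasing map is then Higman's embedding of words. *)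
Lemma wqo_mon c ds : wqo (fun u => wfmon c ds u.1 u.2) (dvdmon c).
Proof.
(* The mark of a letter is at most [d_i], hence at most [L]; on finitely many marks equality is a
   well-quasi-order. *)
pose L := foldr maxn 0 ds.
have LE i : nth 0 ds i <= L.
  rewrite /L; elim: (ds) i => [|d s IH] [|i] //=; first exact: leq_maxl.
  exact: leq_trans (IH i) (leq_maxr _ _).
have WL := wqo_prod (@wqo_eq L.+1) (fun x y z (e : x = y) => etrans e) (@wqo_leqs c).
have TL : rtrans (fun x y : nat * seq nat => x.1 = y.1 /\ leqs x.2 y.2).
  by move=> x y z [-> xy] [-> yz]; split=> //; apply: leqs_trans xy yz.
have W := wqo_prod (@wqo_eq (size ds)) (fun x y z (e : x = y) => etrans e)
  (higman WL TL).
(* Off the image of the injection the mark is [d_i], which no position in the image carries. *)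
pose letter (w : mon) p := (index p w.2.2, [seq nth 0 r p | r <- w.1]).
pose word (u : nat * mon) := (u.2.2.1, [seq letter u.2 p | p <- iota 0 u.1]).
apply: (wqo_preim (h := word) W) => [[n [a [i r]]] /and3P [/= wa wi wr]|].
  split=> //= _ /mapP [p _ ->] /=; split.
    rewrite ltnS; apply: leq_trans (LE i); case/and3P: wr => /eqP <- _ _.
    exact: index_size.
  by rewrite size_map; case/andP: wa => /eqP.
move=> [m [a [i r]]] [n [a' [i' r']]] /and3P [/= wa wi wr] /and3P [/= wa' wi' wr'].
case=> /= ei /(emb_positions (0, [::])) [tau]; subst i'.
rewrite !size_map !size_iota => -[st so lt H].
have cola (b : mat) x q : nth 0 [seq nth 0 s q | s <- b] x = ent b x q.
  rewrite /ent; case: (ltnP x (size b)) => xb; first by rewrite (nth_map [::]).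
  by rewrite nth_default ?size_map // (nth_default _ xb) nth_nil.
have lab p : p < m -> index p r = index (nth 0 tau p) r' /\
    forall x, ent a x p <= ent a' x (nth 0 tau p).
  move=> pm; have tn : nth 0 tau p < n by apply: (allP lt); apply: mem_nth; rewrite st.
  have := H p pm; rewrite !(nth_map 0) ?size_iota // !nth_iota // !add0n.
  by case=> /= -> le; split=> // x; have := le x; rewrite !cola.
have wtau : wfinj n m tau.
  by apply/and3P; split; rewrite ?st //; have := so; rewrite ltn_sorted_uniq_leq => /andP [].
pose b := mkmat c n (fun x q => ent a' x q - ent a x (index q tau)).
have wb : wfmat c n b := wf_mkmat _ _ _.
exists b, tau; split=> //=; congr (_, (_, _)).
  apply: (mat_ext (wf_actmat _ wb wa) wa') => x q xc qn.
  rewrite (ent_actmat _ _ wb wtau wa) ent_mkmat //.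
  case: (boolP (q \in tau)) => qt; last first.
    by rewrite (memNindex qt) st (ent_default wa) ?leqnn ?orbT // subn0 addn0.
  have im : index q tau < m by rewrite -st index_mem.
  by have [_ /(_ x)] := lab _ im; rewrite nth_index // => /subnK.
have [/eqP sr ur lr] := and3P wr; have [/eqP sr' ur' lr'] := and3P wr'.
apply: (@eq_from_nth _ 0) => [|j]; first by rewrite size_map sr.
rewrite size_map => jr; rewrite (nth_map 0) //.
have pm : nth 0 r j < m by apply: (allP lr); apply: mem_nth.
have [e _] := lab _ pm; rewrite index_uniq // in e.
by rewrite [in RHS]e nth_index // -index_mem -e sr' -sr.
Qed.

(** * Existence of certificates *)

(** Demands that persist when [S] grows can be met one at a time; the union of the finite answers
    meets them all. *)
Lemma collect_mono (A T : eqType) (Q : T -> Prop) (C : A -> seq T -> Prop)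
    (l : seq A) :
  (forall x S S', {subset S <= S'} -> C x S -> C x S') ->
  (forall x, x \in l -> exists S : seq T, (forall s, s \in S -> Q s) /\ C x S) ->
  exists S : seq T, (forall s, s \in S -> Q s) /\ forall x, x \in l -> C x S.
Proof.
move=> mono; elim: l => [|x l IH] H; first by exists [::].
have [|S [QS CS]] := IH; first by move=> y yl; apply: H; rewrite inE yl orbT.
have [|S' [QS' CS']] := H x; first by rewrite inE eqxx.
exists (S' ++ S); split=> [s|y].
  by rewrite mem_cat => /orP [/QS'|/QS].
rewrite inE => /orP [/eqP ->|/CS Cy].
  by apply: mono CS' => s ss; rewrite mem_cat ss.
by apply: mono Cy => s ss; rewrite mem_cat ss orbT.
Qed.

Lemma has_sub_seq (T : eqType) (p : pred T) (S S' : seq T) :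
  {subset S <= S'} -> has p S -> has p S'.
Proof. by move=> sub /hasP [x /sub xS px]; apply/hasP; exists x. Qed.

Lemma ex_bound A (p : nat -> A -> bool) (s : seq A) :
  (forall m n x, m <= n -> p m x -> p n x) -> (forall x, exists n, p n x) ->
  exists n, all (p n) s.
Proof.
move=> mono ex; elim: s => [|x s [n Hn]]; first by exists 0.
have [m Hm] := ex x; exists (m + n); rewrite /= (mono m) ?leq_addr //=.
by apply: sub_all Hn => y; apply: mono; apply: leq_addl.
Qed.

Lemma small_mono m n a : m <= n -> small m a -> small n a.
Proof.
move=> mn; apply: sub_all => r; apply: sub_all => e em.
exact: leq_trans em mn.
Qed.

Lemma ex_small a : exists n, small n a.
Proof.
apply: ex_bound => [m n r mn|r].
  by apply: sub_all => e em; apply: leq_trans em mn.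
by apply: ex_bound => [m n e mn em|e]; [apply: leq_trans mn | exists e].
Qed.

(* The search reaches only scalars of the subfield generated by the input, so
   certificates have to be found over such a subfield [k0]. *)
Section Completeness.
Variables (K : fieldType) (c : nat) (k0 : K -> Prop).
Hypothesis k0_1 : k0 1%R.
Hypothesis k0_add : forall x y, k0 x -> k0 y -> k0 (x + y)%R.
Hypothesis k0_mul : forall x y, k0 x -> k0 y -> k0 (x * y)%R.
Hypothesis k0_opp : forall x, k0 x -> k0 (- x)%R.
Hypothesis k0_inv : forall x, k0 x -> k0 (x^-1)%R.

Definition over (v : vec K) := forall t, t \in v -> k0 t.1.

Lemma over_cons t v : k0 t.1 -> over v -> over (t :: v).
Proof. by move=> kt kv u; rewrite inE => /orP [/eqP ->|/kv]. Qed.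

Lemma over_cat v v' : over v -> over v' -> over (v ++ v').
Proof. by move=> kv kv' u; rewrite mem_cat => /orP [/kv|/kv']. Qed.

Lemma over_scale k v : k0 k -> over v -> over (scalev k v).
Proof. by move=> kk kv _ /mapP [t /kv kt ->]; apply: k0_mul. Qed.

Lemma over_acts b pi v : over v -> over (acts b pi v).
Proof. by move=> kv _ /mapP [t /kv kt ->]. Qed.

Lemma k0_0 : k0 0%R.
Proof. by rewrite -(addrN 1%R); apply/k0_add/k0_opp. Qed.

Lemma k0_cf v w : over v -> k0 (cf v w).
Proof.
elim: v => [|t v IH] kv; first by rewrite cf_nil; apply: k0_0.
rewrite cf_cons; apply: k0_add.
  by case: ifP => _; [apply: kv; rewrite inE eqxx | apply: k0_0].
by apply: IH => u uv; apply: kv; rewrite inE uv orbT.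
Qed.

Variables (ds : seq nat) (B : seq (nat * vec K)).
Hypothesis wfB : wfgens c ds B.
Hypothesis overB : forall b, b \in B -> over b.2.
Let nB := size B.

(** The coefficients that express [f] through [B] are required to lie in [k0]. Working with this
    notion throughout avoids comparing spans over [k0] with spans over [K]. *)
Definition Memb n (f : vec K) :=
  exists z, [/\ wfvec c (widths B) n z, over z & cf f =1 cf (phi B z)].

Lemma Memb_ext n f f' : cf f =1 cf f' -> Memb n f -> Memb n f'.
Proof. by move=> e [z [wz oz ez]]; exists z; split=> // w; rewrite -e. Qed.

Lemma Memb_cat n f f' : Memb n f -> Memb n f' -> Memb n (f ++ f').
Proof.
move=> [z [wz oz ez]] [z' [wz' oz' ez']]; exists (z ++ z'); split.
- by rewrite wfvec_cat wz.
- exact: over_cat.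
- by move=> w; rewrite phi_cat !cf_cat ez ez'.
Qed.

Lemma Memb_scale n k f : k0 k -> Memb n f -> Memb n (scalev k f).
Proof.
move=> kk [z [wz oz ez]]; exists (scalev k z); split.
- by rewrite wf_scalev.
- exact: over_scale.
- by move=> w; rewrite cf_phi_scale cf_scale ez.
Qed.

Lemma Memb_act n m b pi f : wfmat c n b -> wfinj n m pi ->
  Memb m f -> Memb n (acts b pi f).
Proof.
move=> wb wpi [z [wz oz ez]]; exists (acts b pi z); split.
- exact: wf_acts wb wpi wz.
- exact: over_acts.
- by rewrite (phi_act wfB wb wpi wz); apply: acts_ext.
Qed.

(** * Groebner bases and division over the subfield *)

Definition lead (v : vec K) : mon := (nth (0%R, dmon) v 0).2.

Definition monic_member (g : nat * vec K) :=
  [/\ wfvec c ds g.1 g.2, over g.2, monic g.2 & Memb g.1 g.2].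

(** The basis is extracted from the leading monomials of all monic members at once, by [wqo_mon]. No
    S-pair reduction is performed, and the choice is not effective. *)
Lemma groebner_basis : exists ext : seq (nat * vec K),
  (forall g, g \in ext -> monic_member g) /\
  forall g, monic_member g -> exists2 g', g' \in ext &
    dvdmon c (g'.1, lead g'.2) (g.1, lead g.2).
Proof.
pose R (g' g : nat * vec K) := dvdmon c (g'.1, lead g'.2) (g.1, lead g.2).
have W : wqo (fun g : nat * vec K => wfmon c ds g.1 (lead g.2)) R.
  by apply: (wqo_preim (h := fun g : nat * vec K => (g.1, lead g.2)) (@wqo_mon c ds)).
apply: (finite_basis W) => -[n v] [/=].
by case: v => //= t v /andP [].
Qed.

Variable ext : seq (nat * vec K).
Hypothesis extP : forall g, g \in ext -> monic_member g.
Hypothesis ext_basis : forall g, monic_member g -> exists2 g', g' \in ext &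
    dvdmon c (g'.1, lead g'.2) (g.1, lead g.2).
Let G := B ++ ext.

Lemma wf_ext : wfgens c ds ext.
Proof. by apply/allP => g /extP []. Qed.

Lemma wf_basis : wfgens c ds G.
Proof. by rewrite /wfgens all_cat; apply/andP; split => //; apply: wf_ext. Qed.

Lemma good_phi1 n t : good nB t -> wfmon c (widths G) n t ->
  wfmon c ds n (lmt G t) /\
  exists2 r, phi1 G t = (1%R, lmt G t) :: r &
             all (fun u => ltmon u.2 (lmt G t)) r.
Proof.
case/andP=> ge so wt; apply: (phi1_monic wf_basis wt so).
have lt : t.2.1 < size G by case/and3P: wt => _; rewrite size_map.
by have [] := extP (mem_nth_cat (0, [::]) ge lt).
Qed.

Lemma phi1_B t : t.2.1 < nB -> phi1 G t = phi1 B t.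
Proof. by move=> lt; rewrite /phi1 /G nth_cat (lt : t.2.1 < size B). Qed.

Lemma wf_term_B n t : wfmon c (widths B) n t ->
  t.2.1 < nB /\ wfmon c (widths G) n t.
Proof.
case/and3P=> wa; rewrite size_map => lt wr; split=> //.
have lt' : t.2.1 < size (widths B) by rewrite size_map.
apply/and3P; split=> //.
  by rewrite size_map size_cat ltn_addr.
by rewrite /widths map_cat nth_cat lt'.
Qed.

Lemma wf_vec_B n z : wfvec c (widths B) n z ->
  [/\ wfvec c (widths G) n z, all (fun x => x.2.2.1 < nB) z & phi G z = phi B z].
Proof.
elim: z => //= t z IH /andP [wt wz]; have [-> wt'] := wf_term_B wt.
have [-> -> e] := IH wz; split; rewrite ?wt' //.
by rewrite /phi /= -!/(phi _ _) e phi1_B //; have [] := wf_term_B wt.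
Qed.

Lemma Memb_term n t : wfmon c (widths G) n t ->
  over (phi1 G t) /\ Memb n (phi1 G t).
Proof.
move=> wt; case/and3P: (wt) => wa; rewrite size_map => lt wpi.
case: (ltnP t.2.1 nB) => [ltB|ge].
  have eG : nth (0, [::]) G t.2.1 = nth (0, [::]) B t.2.1.
    by rewrite /G nth_cat (ltB : t.2.1 < size B).
  split; first by apply: over_acts; rewrite eG; apply/overB/mem_nth.
  exists [:: (1%R, t)]; split.
  - rewrite /wfvec /= andbT; apply/and3P; split; rewrite ?size_map //.
    by move: wpi; rewrite /widths map_cat nth_cat size_map (ltB : _ < size B).
  - exact: over_cons.
  - by move=> w; rewrite cf_phi_cons cf_phi big_nil addr0 mul1r phi1_B.
have [wg og _ Mg] := extP (mem_nth_cat (0, [::]) ge lt).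
split; first exact: over_acts.
apply: Memb_act wa _ Mg; move: wpi; rewrite (nth_map (0, [::])) //.
Qed.

(** Induction on the bound [w]. If its coefficient [k] in [f] is nonzero, then [f] divided by [k] is
    itself a monic member, so the leading monomial of some element of [ext] divides [w], and
    subtracting [k] times the corresponding good term removes [w]. *)
Lemma division n w : wfmon c ds n w -> forall f, Memb n f -> wfvec c ds n f ->
  over f -> all (fun u => (u.2 == w) || ltmon u.2 w) f ->
  exists z, [/\ wfvec c (widths G) n z, over z, goods B z,
    all (fun u => (lmt G u.2 == w) || ltmon (lmt G u.2) w) z &
    cf f =1 cf (phi G z)].
Proof.
move: w; apply: ltmon_ind => w ww IH f Mf wf of_ lf.
have lower h : Memb n h -> wfvec c ds n h -> over h ->
    all (fun u => ltmon u.2 w) h ->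
    exists z, [/\ wfvec c (widths G) n z, over z, goods B z,
      all (fun u => (lmt G u.2 == w) || ltmon (lmt G u.2) w) z &
      cf h =1 cf (phi G z)].
  case: h => [|x h] Mh wh oh lh.
    by exists [::]; split.
  have wl : all (wfmon c ds n) [seq y.2 | y <- x :: h] by rewrite all_map.
  have [u /mapP [y yh ->] mx] := max_mon (s := [seq y.2 | y <- x :: h]) isT wl.
  have lty : ltmon y.2 w := allP lh y yh.
  have [||z [wz oz gz lz ez]] := IH y.2 _ lty (x :: h) Mh wh oh.
  - exact: (allP wh y yh).
  - by apply/allP => v vh; apply: mx; apply/mapP; exists v.
  exists z; split=> //; apply: sub_all lz => v /orP [/eqP ->|lt].
    by rewrite lty orbT.
  by rewrite (ltmon_trans lt lty) orbT.
(* All occurrences of [w] are gathered into a single term [(k, w)] in front. *)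
pose f1 := [seq u <- f | u.2 != w]; pose k := cf f w.
have ef : cf f =1 cf ((k, w) :: f1).
  move=> u; rewrite /k /f1 /cf big_cons big_filter_cond /=.
  case: (eqVneq w u) => [->|ne].
    by rewrite [X in (_ + X)%R]big1 ?addr0 // => t /andP [/negPf ->].
  by apply: eq_bigl => t; case: (eqVneq t.2 u) => [->|]; rewrite ?andbF // andbT eq_sym.
have lf1 : all (fun u => ltmon u.2 w) f1.
  by apply/allP => u; rewrite mem_filter => /andP [/negPf ne /(allP lf)]; rewrite ne.
have wf1 : wfvec c ds n f1.
  by apply/allP => u; rewrite mem_filter => /andP [_ /(allP wf)].
have of1 : over f1 by move=> u; rewrite mem_filter => /andP [_ /of_].
have kk : k0 k by apply: k0_cf.
have [k_0|kn0] := eqVneq k 0%R.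
  have [|z [wz oz gz lz ez]] := lower f1 _ wf1 of1 lf1.
    apply: Memb_ext Mf => u; rewrite ef k_0 cf_cons /=.
    by case: ifP; rewrite add0r.
  exists z; split=> // u; rewrite ef k_0 cf_cons -ez /=.
  by case: ifP; rewrite add0r.
have [[n' g] gext [b [tau [/= wb wtau sotau eact]]]] :
    exists2 g', g' \in ext & dvdmon c (g'.1, lead g'.2) (n, w).
  have [|g' ? ?] := @ext_basis (n, (1%R, w) :: scalev k^-1 f1); last by exists g'.
  split=> /=.
  - by rewrite /wfvec /= ww; rewrite -/(wfvec c ds n (scalev k^-1 f1)) wf_scalev.
  - by apply: over_cons => //; apply: over_scale; [apply: k0_inv|].
  - by rewrite /lcase eqxx all_map.
  - apply: Memb_ext (Memb_scale (k0_inv kk) Mf) => u.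
    rewrite cf_scale ef !cf_cons cf_scale /= mulrDr; congr (_ + _)%R.
    by case: ifP; rewrite ?mulr0 ?mulVf.
(* In [G] the elements of [ext] come after those of [B]; the shift by [nB], together with [sotau],
   makes [t] good. *)
pose t : mon := (b, (nB + index (n', g) ext, tau)).
have ti : nth (0, [::]) G (nB + index (n', g) ext) = (n', g).
  by rewrite /G nth_cat ltnNge leq_addr /= addKn nth_index.
have tlt : nB + index (n', g) ext < size G.
  by rewrite size_cat ltn_add2l index_mem.
have wt : wfmon c (widths G) n t.
  by apply/and3P; split; rewrite ?size_map //= (nth_map (0, [::])) // ti.
have gt : good nB t by rewrite /good leq_addr.
have lt : lmt G t = w.
  by rewrite -eact /lmt /phi1 ti /= /lead; have [_ _] := extP gext; case: (g).
have [_ [r er lr]] := good_phi1 gt wt; rewrite lt in er lr.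
have [ot Mt] := Memb_term wt.
have wr : wfvec c ds n r by have := wf_phi1 wf_basis wt; rewrite er => /andP [].
have or : over r by move=> u ur; apply: ot; rewrite er inE ur orbT.
have [||||z [wz oz gz lz ez]] := lower (f1 ++ scalev (- k)%R r).
- apply: Memb_ext (Memb_cat Mf (Memb_scale (k0_opp kk) Mt)) => u.
  rewrite !cf_cat !cf_scale er ef !cf_cons /=.
  by case: ifP => _; ring.
- by rewrite wfvec_cat wf1 wf_scalev.
- by apply: over_cat => //; apply: over_scale => //; apply: k0_opp.
- by rewrite all_cat lf1 all_map.
exists ((k, t) :: z); split.
- by rewrite /wfvec /= wt.
- exact: over_cons.
- by rewrite /goods /= gt.
- by rewrite /= lt eqxx.
move=> u; rewrite cf_phi_cons -ez er ef cf_cat cf_scale !cf_cons /=.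
by case: ifP => _; ring.
Qed.

Lemma division_lower n w f : Memb n f -> wfvec c ds n f -> over f ->
  all (fun u => ltmon u.2 w) f ->
  exists z, [/\ wfvec c (widths G) n z, over z, goods B z,
    all (fun u => ltmon (lmt G u.2) w) z & cf f =1 cf (phi G z)].
Proof.
case: f => [|x h] Mh wh oh lh.
  by exists [::]; split.
have wl : all (wfmon c ds n) [seq y.2 | y <- x :: h] by rewrite all_map.
have [u /mapP [y yh ->] mx] := max_mon (s := [seq y.2 | y <- x :: h]) isT wl.
have lty : ltmon y.2 w := allP lh y yh.
have [||z [wz oz gz lz ez]] := division (w := y.2) _ Mh wh oh.
- exact: (allP wh y yh).
- by apply/allP => v vh; apply: mx; apply/mapP; exists v.
exists z; split=> //; apply: sub_all lz => v /orP [/eqP ->//|lt].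
exact: ltmon_trans lt lty.
Qed.

Lemma division_all n f : Memb n f -> wfvec c ds n f -> over f ->
  exists z, [/\ wfvec c (widths G) n z, over z, goods B z & cf f =1 cf (phi G z)].
Proof.
case: f => [|x h] Mh wh oh.
  by exists [::]; split.
have wl : all (wfmon c ds n) [seq y.2 | y <- x :: h] by rewrite all_map.
have [u /mapP [y yh ->] mx] := max_mon (s := [seq y.2 | y <- x :: h]) isT wl.
have [||z [wz oz gz lz ez]] := division (w := y.2) _ Mh wh oh; last by exists z.
- exact: (allP wh y yh).
- by apply/allP => v vh; apply: mx; apply/mapP; exists v.
Qed.

Definition relation (s : nat * vec K) :=
  [/\ wfvec c (widths G) s.1 s.2, over s.2 & cf (phi G s.2) =1 (fun=> 0%R)].

Lemma exists_isA n t : wfmon c (widths G) n t ->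
  exists s, relation (n, s) /\ isA nB t s.
Proof.
move=> wt; have [ot Mt] := Memb_term wt.
have [z [wz oz gz ez]] := division_all Mt (wf_phi1 wf_basis wt) ot.
exists ((1%R, t) :: scalev (-1) z); split; last first.
  by rewrite /isA /= eqxx all_map.
split=> /=.
- by rewrite /wfvec /= wt -/(wfvec c (widths G) n (scalev (-1) z)) wf_scalev.
- by apply: over_cons => //; apply: over_scale => //; apply: k0_opp.
- by move=> w; rewrite cf_phi_cons cf_phi_scale /= ez; ring.
Qed.

Lemma exists_isM n t : wfmon c (widths G) n t ->
  exists s, relation (n, s) /\ isM nB t s.
Proof.
move=> wt; have [ot [z [wz oz ez]]] := Memb_term wt.
have [wz' lz pz] := wf_vec_B wz.
exists ((1%R, t) :: scalev (-1) z); split; last first.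
  by rewrite /isM /= eqxx all_map.
split=> /=.
- by rewrite /wfvec /= wt -/(wfvec c (widths G) n (scalev (-1) z)) wf_scalev.
- by apply: over_cons => //; apply: over_scale => //; apply: k0_opp.
- by move=> w; rewrite cf_phi_cons cf_phi_scale /= ez pz; ring.
Qed.

(** The two leading terms cancel, so the difference of the images involves smaller monomials only,
    and division keeps the remainder terms below them. *)
Lemma exists_isB n t t' : wfmon c (widths G) n t -> wfmon c (widths G) n t' ->
  good nB t -> good nB t' -> lmt G t = lmt G t' ->
  exists s, relation (n, s) /\ isB G nB t t' s.
Proof.
move=> wt wt' gt gt' e.
have [ot Mt] := Memb_term wt; have [ot' Mt'] := Memb_term wt'.
have [_ [r er lr]] := good_phi1 gt wt; have [_ [r' er' lr']] := good_phi1 gt' wt'.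
have := wf_phi1 wf_basis wt; have := wf_phi1 wf_basis wt'.
rewrite er er' => /andP [_ wr'] /andP [_ wr].
have or : over r by move=> u ur; apply: ot; rewrite er inE ur orbT.
have or' : over r' by move=> u ur; apply: ot'; rewrite er' inE ur orbT.
have kN1 : k0 (-1)%R by apply: k0_opp.
have [||||z [wz oz gz lz ez]] := @division_lower n (lmt G t) (r ++ scalev (-1) r').
- apply: Memb_ext (Memb_cat Mt (Memb_scale kN1 Mt')) => u.
  rewrite !cf_cat !cf_scale er er' !cf_cons e /=.
  by case: ifP => _; ring.
- by rewrite wfvec_cat wf_scalev; apply/andP.
- by apply: over_cat => //; apply: over_scale.
- by rewrite all_cat lr all_map e.
exists [:: (1%R, t), ((-1)%R, t') & scalev (-1) z]; split; last first.
  rewrite /isB /= take0 drop0 eqxx all_map /=; apply/allP => u uz /=.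
  by rewrite (allP gz u uz) (allP lz u uz).
split=> /=.
- by rewrite /wfvec /= wt wt' -/(wfvec c (widths G) n (scalev (-1) z)) wf_scalev.
- by do 2 (apply: over_cons => //); apply: over_scale.
- move=> w; rewrite !cf_phi_cons cf_phi_scale /= -ez er er' cf_cat cf_scale !cf_cons e /=.
  by case: ifP => _; ring.
Qed.

Lemma exists_check : exists S N, check c ds B ext S N /\
  forall s, s \in S -> over s.2.
Proof.
have [N1 HN1] := @ex_bound _ (fun n (g : nat * vec K) => g.1 + g.1 <= n) G
  (fun m n g mn gm => leq_trans gm mn) (fun g => ex_intro (fun n => is_true (g.1 + g.1 <= n)) _ (leqnn _)).
have [N2 HN2] : exists N, all (fun g => all (fun t => small N t.2.1) g.2) ext.
  apply: ex_bound => [m n g mn|g]; first by apply: sub_all => t; apply: small_mono.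
  by apply: ex_bound => [m n t|t]; [apply: small_mono | apply: ex_small].
(* [N1] bounds twice the widths and [N2] the exponents in [ext]; both conditions persist for larger
   bounds. *)
pose N := N1 + N2.
suff [S [QS CS]] : exists S, (forall s, s \in S -> relation s) /\
    forall k, k \in iota 0 N.+1 ->
      all (check_terms c G nB S N k) (allterms c (widths G) k N).
  exists S, N; split; last by move=> s /QS [].
  apply/and5P; split.
  - exact: wf_ext.
  - by apply/allP => g /extP [].
  - by apply: sub_all HN1 => g H; apply: leq_trans H (leq_addr _ _).
  - apply: sub_all HN2 => g; apply: sub_all => t; apply: small_mono.
    exact: leq_addl.
  apply/andP; split; last exact/allP.
  apply/allP => s /QS [-> _ /isnullP ns]; exact: ns.
have mono k S S' : {subset S <= S'} -> forall t,
    check_terms c G nB S N k t -> check_terms c G nB S' N k t.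
  move=> sub t /and3P [hA hM /allP hB]; apply/and3P; split.
  - exact: has_sub_seq hA.
  - exact: has_sub_seq hM.
  apply/allP => t' /hB; case: (X in X ==> _) => //=; exact: has_sub_seq.
apply: collect_mono => [k S S' sub|k _].
  by apply: sub_all => t; apply: mono.
suff [S [QS CS]] : exists S, (forall s, s \in S -> relation s) /\
    forall t, t \in allterms c (widths G) k N -> check_terms c G nB S N k t.
  by exists S; split=> //; apply/allP.
apply: collect_mono => [t S S' sub|t]; first exact: mono.
rewrite mem_filter => /andP [wt _].
have [sA [rA iA]] := exists_isA wt; have [sM [rM iM]] := exists_isM wt.
have [S [QS CS]] : exists S, (forall s, s \in S -> relation s) /\
    forall t', t' \in allterms c (widths G) k N ->
      [&& good nB t, good nB t' & lmt G t == lmt G t'] ==>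
             has (fun s => (s.1 == k) && isB G nB t t' s.2) S.
  apply: collect_mono => [t' S S' sub|t'].
    by case: (X in X ==> _) => //=; apply: has_sub_seq.
  rewrite mem_filter => /andP [wt' _].
  case E: [&& _, _ & _]; last by exists [::].
  case/and3P: E => gt gt' /eqP e.
  have [s [rs is_]] := exists_isB wt wt' gt gt' e.
  exists [:: (k, s)]; split; first by move=> x; rewrite inE => /eqP ->.
  by rewrite /= eqxx is_.
exists [:: (k, sA), (k, sM) & S]; split.
  by move=> s; rewrite !inE => /or3P [/eqP ->|/eqP ->|/QS].
apply/and3P; split.
- by rewrite /= eqxx iA.
- by rewrite /= eqxx iM !orbT.
apply/allP => t' /CS; case: (X in X ==> _) => //= h.
by rewrite h !orbT.
Qed.

End Completeness.

(** * Semantics of formal sums *)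

Definition vals ds n (t : fbasis ds n) : nat * seq nat :=
  (tag t : nat, [seq (tagged t j : nat) | j <- enum 'I_(nth 0%N ds (tag t))]).

Definition rows c n (m : 'X_{1..#|{: 'I_c * 'I_n}|}) : mat :=
  [seq [seq m (enum_rank (i, j)) | j <- enum 'I_n] | i <- enum 'I_c].

Definition smon c ds n m (t : fbasis ds n) : mon := (@rows c n m, vals t).

Lemma ent_rows c n m (i : 'I_c) (j : 'I_n) :
  ent (rows m) i j = m (enum_rank (i, j)).
Proof.
rewrite /ent (nth_map i) ?size_enum_ord // (nth_map j) ?size_enum_ord //.
by rewrite !nth_ord_enum.
Qed.

Lemma wf_rows c n m : wfmat c n (@rows c n m).
Proof.
rewrite /wfmat size_map size_enum_ord eqxx; apply/allP => _ /mapP [i _ ->].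
by rewrite size_map size_enum_ord.
Qed.

Lemma rows_inj c n : injective (@rows c n).
Proof.
move=> m m' e; apply/mnmP => k; rewrite -(enum_valK k).
by case: (enum_val k) => i j; rewrite -!ent_rows e.
Qed.

Definition ord_vals d n (s : fi_hom d n) : seq nat :=
  [seq (s j : nat) | j <- enum 'I_d].

Lemma wf_ord_vals d n (s : fi_hom d n) : wfinj n d (ord_vals s).
Proof.
apply/and3P; split.
- by rewrite size_map size_enum_ord.
- rewrite map_inj_uniq ?enum_uniq // => i j /val_inj.
  by move/(injectiveP _ (fi_injb s)).
- by apply/allP => _ /mapP [j _ ->].
Qed.

Lemma nth_ord_vals d n (s : fi_hom d n) (j : 'I_d) : nth 0 (ord_vals s) j = s j.
Proof. by rewrite (nth_map j) ?size_enum_ord // nth_ord_enum. Qed.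

Lemma ord_vals_inj d n : injective (@ord_vals d n).
Proof.
move=> s s' e; apply/val_inj/ffunP => j; apply: val_inj.
by rewrite /= -!nth_ord_vals e.
Qed.

Lemma ex_ord_vals d n pi : wfinj n d pi -> exists s : fi_hom d n, ord_vals s = pi.
Proof.
move=> wpi; have lt (j : 'I_d) : nth 0 pi j < n by apply: nth_inj_lt wpi _.
have inj : injectiveb [ffun j : 'I_d => Ordinal (lt j)].
  apply/injectiveP => i j; rewrite !ffunE => /(congr1 val) /= e.
  by apply: val_inj; rewrite /= -(index_nth wpi (ltn_ord i)) e (index_nth wpi).
have [/eqP sp _ _] := and3P wpi.
exists (FIHom inj); apply: (@eq_from_nth _ 0).
  by rewrite size_map size_enum_ord.
move=> j; rewrite size_map size_enum_ord => jd.
by rewrite -[j]/(val (Ordinal jd)) nth_ord_vals ffunE.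
Qed.

Lemma vals_inj ds n : injective (@vals ds n).
Proof.
case=> [i s] [i' s'] []; rewrite /= => /val_inj ei; subst i'.
by move/ord_vals_inj ->.
Qed.

Lemma wf_smon c ds n m (t : fbasis ds n) : wfmon c ds n (smon (c := c) m t).
Proof. by apply/and3P; split; [apply: wf_rows | apply: ltn_ord | apply: wf_ord_vals]. Qed.

Definition decm c n (a : mat) : 'X_{1..#|{: 'I_c * 'I_n}|} :=
  [multinom (let ij : 'I_c * 'I_n := enum_val k in ent a ij.1 ij.2) | k < _].

Lemma rows_decm c n a : wfmat c n a -> rows (decm c n a) = a.
Proof.
move=> wa; apply: (mat_ext (wf_rows _) wa) => x q xc qn.
by rewrite -[x]/(val (Ordinal xc)) -[q]/(val (Ordinal qn)) ent_rows mnmE enum_rankK.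
Qed.

Lemma ex_smon c ds n w : wfmon c ds n w ->
  exists m (t : fbasis ds n), w = smon (c := c) m t.
Proof.
case: w => [a [i pi]] /and3P [/= wa wi wpi].
have [s es] := ex_ord_vals (wpi : wfinj n (nth 0 ds (Ordinal wi)) pi).
exists (decm c n a), (Tagged (fun i : 'I_(size ds) => fi_hom (nth 0%N ds i) n) s).
by rewrite /smon rows_decm // /vals /= -/(ord_vals s) es.
Qed.

Lemma smon_inj c ds n m m' (t t' : fbasis ds n) :
  smon (c := c) m t = smon m' t' -> m = m' /\ t = t'.
Proof.
move=> e; have /= /rows_inj -> := congr1 fst e.
by have /= /vals_inj -> := congr1 snd e.
Qed.

Section Semantics.
Variables (K : fieldType) (c : nat).

(** A monomial whose second component is no basis element of width [n] is sent to 0, so that [sem]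
    is defined on all formal sums. *)
Definition semmon ds n (w : mon) : free_fi_module K c ds n :=
  if [pick t : fbasis ds n | vals t == w.2] is Some t
  then ('X_[decm c n w.1] : PFI K c n)%R *: fe K c t else 0%R.

Definition sem ds n (v : vec K) : free_fi_module K c ds n :=
  (\sum_(t <- v) (t.1%:MP : PFI K c n) *: semmon ds n t.2)%R.

Lemma semmon_smon ds n m (t : fbasis ds n) :
  semmon ds n (smon m t) = ('X_[m] *: fe K c t)%R.
Proof.
rewrite /semmon; case: pickP => [t' /eqP /vals_inj ->|/(_ t)]; last by rewrite eqxx.
by congr (_ *: _)%R; congr 'X_[_]; apply: rows_inj; rewrite rows_decm // wf_rows.
Qed.

Lemma sem_nil ds n : sem ds n [::] = 0%R.
Proof. by rewrite /sem big_nil. Qed.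

Lemma sem_cons ds n t v :
  sem ds n (t :: v) = (t.1%:MP *: semmon ds n t.2 + sem ds n v)%R.
Proof. by rewrite /sem big_cons. Qed.

Lemma sem_cat ds n v v' : sem ds n (v ++ v') = (sem ds n v + sem ds n v')%R.
Proof. by rewrite /sem big_cat. Qed.

Lemma sem_scale ds n k v : sem ds n (scalev k v) = (k%:MP *: sem ds n v)%R.
Proof.
rewrite /sem big_map scaler_sumr; apply: eq_bigr => t _.
by rewrite scalerA mpolyCM.
Qed.

Lemma sem_ext ds n v v' : cf v =1 cf v' -> sem ds n v = sem ds n v'.
Proof.
move=> e; apply: (lin_ext (F := fun w k => k%:MP *: semmon ds n w)%R) => //.
  by move=> w; rewrite mpolyC0 scale0r.
by move=> w a b; rewrite mpolyCD scalerDl.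
Qed.

(** Distinct well-formed monomials correspond to distinct pairs of a monomial and a basis element.
    Hence nothing is lost in passing from formal sums up to [cf] to elements of the free module. *)
Lemma coef_sem ds n v m (t : fbasis ds n) : wfvec c ds n v ->
  mcoeff m ((sem ds n v : free_obj K c ds n) t) = cf v (smon m t).
Proof.
elim: v => [|[k w] v IH] /= wv.
  by rewrite cf_nil sem_nil ffunE mcoeff0.
case/andP: wv => ww wv; rewrite sem_cons cf_cons ffunE mcoeffD IH //=.
congr (_ + _)%R; have [m' [t' ->]] := ex_smon ww; rewrite semmon_smon.
rewrite !ffunE /= mcoeffCM.
have -> : (('X_[m'] : PFI K c n) *: ((t == t')%:R : (PFI K c n)^o) =
           'X_[m'] * (t == t')%:R)%R by [].
case: (t =P t') => [et|ne].
  subst t'; rewrite mulr1 mcoeffX; case: (m' =P m) => [->|nm].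
    by rewrite eqxx mulr1.
  by rewrite mulr0; case: eqP => // /smon_inj [/nm].
by rewrite mulr0 mcoeff0 mulr0; case: eqP => // /smon_inj [_ /esym/ne].
Qed.

Lemma sem_eq0 ds n v : wfvec c ds n v -> sem ds n v = 0%R -> cf v =1 (fun=> 0%R).
Proof.
move=> wv e w; case: (boolP (w \in [seq t.2 | t <- v])) => [/mapP [t tv ->]|].
  have [m [u ->]] := ex_smon (allP wv t tv).
  by rewrite -coef_sem // e ffunE mcoeff0.
exact: cf_notin.
Qed.

Lemma sem_cf0 ds n v : cf v =1 (fun=> 0%R) -> sem ds n v = 0%R.
Proof. by move=> e; rewrite -(sem_nil ds n); apply: sem_ext => w; rewrite e cf_nil. Qed.

(** Forgets the dependent types without changing the encoding, so that programs are analysed on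
    simply typed lists. *)
Definition simple_elt ds n (q : elt_repr K c ds n) :
    seq (seq (K * mat) * (nat * seq nat)) :=
  [seq ([seq (u.1, rows u.2) | u <- t.1], vals t.2) | t <- q].

Definition flat (e : seq (seq (K * mat) * (nat * seq nat))) : vec K :=
  flatten [seq [seq (u.1, (u.2, t.2)) | u <- t.1] | t <- e].

(** Output format with one monomial per coefficient; this is allowed because presentations may
    repeat basis elements. *)
Definition unflat (v : vec K) : seq (seq (K * mat) * (nat * seq nat)) :=
  [seq ([:: (t.1, t.2.1)], t.2.2) | t <- v].

Lemma flat_simple ds n (q : elt_repr K c ds n) :
  wfvec c ds n (flat (simple_elt q)) /\ sem ds n (flat (simple_elt q)) = elt_of q.
Proof.
elim: q => [|[f t] q [IHw IHs]]; first by rewrite /elt_of sem_nil big_nil.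
rewrite /flat /= -/(flat (simple_elt q)) wfvec_cat IHw sem_cat IHs andbT.
rewrite /elt_of big_cons /=; split.
  by rewrite /wfvec !all_map; apply/allP => u _; apply: wf_smon.
congr (_ + _)%R; rewrite /sem !big_map /poly_of scaler_suml; apply: eq_bigr => u _.
by rewrite /= -/(smon u.2 t) semmon_smon scalerA mul_mpolyC.
Qed.

Lemma unflat_simple ds n v : wfvec c ds n v -> exists q : elt_repr K c ds n,
  simple_elt q = unflat v /\ elt_of q = sem ds n v.
Proof.
elim: v => [|[k w] v IH] /= wv.
  by exists [::]; rewrite /elt_of big_nil sem_nil.
case/andP: wv => ww /IH [q [eq1 eq2]]; have [m [t ew]] := ex_smon ww.
exists (([:: (k, m)], t) :: q); rewrite /simple_elt /= -/(simple_elt q) eq1 ew.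
split=> //; rewrite /elt_of big_cons /= -/(elt_of q) eq2 sem_cons /poly_of big_seq1.
by rewrite semmon_smon scalerA mul_mpolyC.
Qed.

Lemma ex_sem ds n (x : free_fi_module K c ds n) :
  exists2 v, wfvec c ds n v & sem ds n v = x.
Proof.
have [q <-] : exists q : elt_repr K c ds n, elt_of q = x.
  exists [seq ([seq (mcoeff m ((x : free_obj K c ds n) t), m) | m <- msupp ((x : free_obj K c ds n) t)], t)
         | t <- index_enum (fbasis ds n)].
  rewrite [RHS](free_decomp (x : free_obj K c ds n)) /elt_of big_map.
  apply: eq_bigr => t _; congr (_ *: _)%R.
  by rewrite [RHS]mpolyE /poly_of big_map.
by have [w e] := flat_simple q; exists (flat (simple_elt q)).
Qed.

End Semantics.

(** * The FI action on monomials and morphisms out of free modules *)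

Definition mpush c m n (s : fi_hom m n) (a : 'X_{1..#|{: 'I_c * 'I_m}|}) :
    'X_{1..#|{: 'I_c * 'I_n}|} :=
  (\sum_k U_(let ij := enum_val k in enum_rank (ij.1, s ij.2)) *+ a k)%MM.

Lemma pfi_map_mpush (K : fieldType) c m n (s : fi_hom m n)
    (a : 'X_{1..#|{: 'I_c * 'I_m}|}) :
  pfi_map s ('X_[a] : PFI K c m)%R = 'X_[mpush s a]%R.
Proof.
rewrite [in LHS]mpolyXE_id rmorph_prod -mprodXE; apply: eq_bigr => k _.
rewrite rmorphXn -mpolyXn; congr (_ ^+ _)%R.
by rewrite -{1}(enum_valK k); case: (enum_val k) => i j; rewrite /= pfi_mapX.
Qed.

Lemma ent_mpush c m n (s : fi_hom m n) (a : 'X_{1..#|{: 'I_c * 'I_m}|})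
    (i : 'I_c) q : q < n ->
  ent (rows (mpush s a)) i q = ent (rows a) i (index q (ord_vals s)).
Proof.
move=> qn; rewrite -[q]/(val (Ordinal qn)); move: (Ordinal qn) => {qn}q.
have ws := wf_ord_vals s.
rewrite ent_rows mnm_sumE; case: (boolP (val q \in ord_vals s)) => [|nq].
  case/mapP=> p _ /val_inj ->.
  have -> : index (val (s p)) (ord_vals s) = p.
    by rewrite -[val _]/(nat_of_ord (s p)) -(nth_ord_vals s p) (index_nth ws).
  rewrite ent_rows.
  rewrite (bigD1 (enum_rank (i, p))) //= big1 ?addn0 => [|k ne].
    by rewrite mulmnE mnm1E enum_rankK /= eqxx mul1n.
  rewrite mulmnE mnm1E; case: eqP => // /enum_rank_inj.
  case E: (enum_val k) => [i' p'] /= [ei /(injectiveP _ (fi_injb s)) ep].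
  by case/eqP: ne; rewrite -(enum_valK k) E ei ep.
rewrite big1 => [|k _].
  case/and3P: ws => /eqP sz _ _.
  by rewrite (memNindex nq) sz (ent_default (wf_rows _)) ?leqnn ?orbT.
rewrite mulmnE mnm1E; case: eqP => // /enum_rank_inj [_ e].
by case/negP: nq; rewrite -e; apply: map_f; rewrite mem_enum.
Qed.

(** Identifies [act] on lists with multiplication by a monomial after the FI map [s]. The
    combinatorial results on terms pass to the modules through this equation. *)
Lemma smon_act c ds m n (s : fi_hom m n) b a (t : fbasis ds m) :
  smon (c := c) (b + mpush s a)%MM (fbasis_map s t) =
  act (rows b) (ord_vals s) (smon a t).
Proof.
congr (_, (_, _)); last first.
  by rewrite /= -map_comp; apply: eq_map => j; rewrite /= nth_ord_vals ffunE.
have ws := wf_ord_vals s.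
apply: (mat_ext (wf_rows _) (wf_actmat _ (wf_rows _) (wf_rows _))) => x q xc qn.
rewrite (ent_actmat _ _ (wf_rows b) ws (wf_rows a)).
rewrite -[x]/(val (Ordinal xc)) -ent_mpush // -[q]/(val (Ordinal qn)).
by rewrite !ent_rows mnmDE.
Qed.

Section Lift.
Variables (K : fieldType) (c : nat).

Lemma sem_act ds m n (b : 'X_{1..#|{: 'I_c * 'I_n}|})
    (s : fi_hom m n) (v : vec K) : wfvec c ds m v ->
  sem c ds n (acts (rows b) (ord_vals s) v) =
  (('X_[b] : PFI K c n) *: free_map s (sem c ds m v : free_obj K c ds m))%R.
Proof.
elim: v => [|[k w] v IH] /=.
  move=> _; rewrite !sem_nil -(scale0r (0 : free_obj K c ds m))%R.
  by rewrite free_mapZ raddf0 scale0r scaler0.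
case/andP=> ww wv; rewrite !sem_cons IH // free_mapD scalerDr; congr (_ + _)%R.
have [a [t ->]] := ex_smon ww; rewrite /= -smon_act !semmon_smon.
rewrite !free_mapZ free_map_fe pfi_map_mpush mpolyXD !scalerA.
have -> : pfi_map s k%:MP%R = k%:MP%R :> PFI K c n by exact: comp_mpolyC.
by rewrite mulrCA mulrA.
Qed.

Lemma submodule_sum (M : fi_module K c) (T : forall n, M n -> Prop)
    (HT : is_fi_submodule T) n (I : Type) (r : seq I) (F : I -> M n) :
  (forall i, T n (F i)) -> T n (\sum_(i <- r) F i)%R.
Proof.
move=> H; elim: r => [|i r IH]; first by rewrite big_nil; apply: fs0.
by rewrite big_cons; apply: fsD.
Qed.

Variables (ds : seq nat) (N : fi_module K c).
Variable x : forall j : 'I_(size ds), N (nth 0%N ds j).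

Definition lift_fun n (y : free_fi_module K c ds n) : N n :=
  (\sum_(t : fbasis ds n) (y : free_obj K c ds n) t *: fm_map (tagged t) (x (tag t)))%R.

Lemma lift_is_linear n : linear (@lift_fun n).
Proof.
move=> a y z; rewrite /lift_fun scaler_sumr -big_split; apply: eq_bigr => t _.
by rewrite !ffunE scalerDl scalerA.
Qed.

HB.instance Definition _ n :=
  GRing.isLinear.Build (PFI K c n) (free_fi_module K c ds n) (N n) _
    (@lift_fun n) (@lift_is_linear n).

Lemma lift_fe n (t : fbasis ds n) : lift_fun (fe K c t) = fm_map (tagged t) (x (tag t)).
Proof.
rewrite /lift_fun (bigD1 t) //= big1 ?addr0; first by rewrite ffunE eqxx scale1r.
by move=> u ne; rewrite ffunE (negPf ne) scale0r.
Qed.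

Lemma lift_natural m n (s : fi_hom m n) (y : free_fi_module K c ds m) :
  lift_fun (fm_map s y) = fm_map s (lift_fun y).
Proof.
have map0 : fm_map s (0 : N m) = 0%R by rewrite -(scale0r 0%R) fm_mapZ raddf0 scale0r.
rewrite {2}/lift_fun (big_morph _ (@fm_mapD K c N m n s) map0).
rewrite [fm_map s y]/(free_map s y) /free_map linear_sum; apply: eq_bigr => t _.
by rewrite linearZ /= lift_fe /= fm_mapZ fm_map_comp.
Qed.

Definition lift : fi_morphism (free_fi_module K c ds) N :=
  FIMorphism (fh_fun := fun n => @lift_fun n : {linear _ -> _}) lift_natural.

Lemma lift_fgen j : lift _ (fgen K c j) = x j.
Proof. by rewrite /= lift_fe fm_map_id. Qed.

Lemma lift_submodule (T : forall n, N n -> Prop) : is_fi_submodule T ->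
  (forall j, T _ (x j)) -> forall n y, T n (lift n y).
Proof.
move=> HT Tx n y; apply: (submodule_sum HT) => t.
by apply: (fsZ HT); apply: (fs_map HT).
Qed.

Lemma image_submodule : is_fi_submodule (fun n z => exists y, lift n y = z).
Proof.
split=> [n|n _ _ [y <-] [y' <-]|n a _ [y <-]|m n s _ [y <-]].
- by exists 0%R; rewrite linear0.
- by exists (y + y')%R; rewrite linearD.
- by exists (a *: y)%R; rewrite linearZ.
- by exists (fm_map s y); rewrite fh_natural.
Qed.

End Lift.

Lemma kernel_submodule (K : fieldType) c (M N : fi_module K c) (f : fi_morphism M N) :
  is_fi_submodule (fun n y => f n y = 0%R).
Proof.
split=> [n|n x y ex ey|n a x ex|m n s x ex].
- by rewrite linear0.
- by rewrite linearD ex ey addr0.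
- by rewrite linearZ /= ex scaler0.
- by rewrite fh_natural ex -(scale0r 0%R) fm_mapZ raddf0 scale0r.
Qed.

Lemma finitely_generated_free (K : fieldType) c ds :
  finitely_generated (free_fi_module K c ds).
Proof.
pose s := [seq Tagged (fun k => free_fi_module K c ds k : Type) (fgen K c j)
          | j <- enum 'I_(size ds)].
exists s => n x T HT sT; rewrite (free_decomp x).
apply: (submodule_sum HT) => t; apply: (fsZ HT).
have -> : fe K c t = @fm_map K c (free_fi_module K c ds) _ _ (tagged t) (fgen K c (tag t)).
  rewrite /= free_map_fe; congr fe; case: t => i f /=.
  rewrite /fbasis_map /=; congr Tagged; apply/val_inj/ffunP => j.
  by rewrite !ffunE.
apply: (fs_map HT); apply: sT; rewrite /finite_subset.
by apply/mapP; exists (tag t); rewrite ?mem_enum.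
Qed.

Lemma finitely_generated_surj (K : fieldType) c (M N : fi_module K c)
    (f : fi_morphism M N) : (forall n y, exists x, f n x = y) ->
  finitely_generated M -> finitely_generated N.
Proof.
move=> surj [s sM]; exists [seq Tagged (fun k => N k : Type) (f _ (tagged u)) | u <- s].
move=> n y T HT sT; have [x <-] := surj n y.
apply: (sM n x (fun n x => T n (f n x))).
  split=> [k|k u v Tu Tv|k a u Tu|k l t u Tu].
  - by rewrite linear0; apply: fs0.
  - by rewrite linearD; apply: fsD.
  - by rewrite linearZ; apply: fsZ.
  - by rewrite fh_natural; apply: fs_map.
move=> m u us; apply: sT; rewrite /finite_subset.
by apply/mapP; exists (Tagged (fun k => M k : Type) u).
Qed.

Lemma lift_comp (K : fieldType) c ds (N N' : fi_module K c)
    (f : fi_morphism N N') (x : forall j : 'I_(size ds), N (nth 0%N ds j)) n y :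
  f n (lift x n y) = lift (fun j => f _ (x j)) n y.
Proof.
rewrite /= /lift_fun linear_sum; apply: eq_bigr => t _.
by rewrite linearZ /= fh_natural.
Qed.

(** * From certificates to exactness *)

Section Exactness.
Variables (K : fieldType) (c : nat).
Local Notation F := (free_fi_module K c).

Definition gen_img ds (G : seq (nat * vec K)) (j : 'I_(size (widths G))) :
    F ds (nth 0%N (widths G) j) :=
  sem c ds _ (nth (0, [::]) G j).2.

(** Both sides are additive in [z], and [sem_act] compares them on a single term: [phi] computes, on
    lists, the morphism out of the free module on [G]. *)
Lemma lift_sem ds G n z : wfgens c ds G -> wfvec c (widths G) n z ->
  lift (gen_img ds (G := G)) n (sem c (widths G) n z) = sem c ds n (phi G z).
Proof.
move=> wG; elim: z => [|[k t] z IH].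
  by move=> _; rewrite !sem_nil linear0.
case/andP=> wt wz; rewrite sem_cons linearD IH // linearZ.
have -> : phi G ((k, t) :: z) = scalev k (phi1 G t) ++ phi G z by [].
rewrite sem_cat sem_scale.
suff -> : lift (gen_img ds (G := G)) n (semmon K c (widths G) n t) =
          sem c ds n (phi1 G t) by [].
have [m [u /= et]] := ex_smon wt.
rewrite et semmon_smon linearZ [lift _ _ _]lift_fe.
have iG : tag u < size G by rewrite -(size_map fst).
exact: (esym (sem_act m (tagged u) (wf_nth_gen wG iG))).
Qed.

Lemma gen_img_nth ds (G : seq (nat * vec K)) (T : forall n, F ds n -> Prop) :
  (forall g, g \in G -> T g.1 (sem c ds g.1 g.2)) ->
  forall j, T _ (gen_img ds (G := G) j).
Proof.
move=> TG j; rewrite /gen_img; have jG : j < size G.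
  by rewrite -(size_map fst).
by rewrite (nth_map (0, [::])) //; apply/TG/mem_nth.
Qed.

Lemma gen_in_image ds (G : seq (nat * vec K)) g : g \in G ->
  exists x, lift (gen_img ds (G := G)) g.1 x = sem c ds g.1 g.2.
Proof.
move=> gG; have iG : index g G < size (widths G) by rewrite size_map index_mem.
have : exists x, lift (gen_img ds (G := G)) _ x = gen_img ds (G := G) (Ordinal iG).
  by exists (fgen K c (Ordinal iG)); apply: lift_fgen.
by rewrite /gen_img /= nth_index // (nth_map (0, [::])) ?index_mem // nth_index.
Qed.

Lemma generated_phi ds G (T : forall n, F ds n -> Prop) : is_fi_submodule T ->
  wfgens c ds G -> (forall g, g \in G -> T g.1 (sem c ds g.1 g.2)) ->
  forall n z, wfvec c (widths G) n z -> T n (sem c ds n (phi G z)).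
Proof.
move=> HT wG TG n z wz; rewrite -lift_sem //.
exact: lift_submodule HT (gen_img_nth TG) _ _.
Qed.

Section Step.
Variables (ds : seq nat) (B ext S : seq (nat * vec K)) (N : nat).
Let G := B ++ ext.
Hypothesis wfB : wfgens c ds B.
Hypothesis chk : check c ds B ext S N.

(** Here the relations of type [isM] are used: at a generator coming from [ext], such a relation
    expresses it through [B]. *)
Lemma basis_generated (T : forall n, F ds n -> Prop) : is_fi_submodule T ->
  (forall b, b \in B -> T b.1 (sem c ds b.1 b.2)) ->
  forall g, g \in G -> T g.1 (sem c ds g.1 g.2).
Proof.
move=> HT TB g; rewrite mem_cat => /orP [/TB//|gext].
pose i := size B + index g ext; pose m := g.1.
have gi : nth (0, [::]) G i = g.
  by rewrite /G nth_cat ltnNge leq_addr /= addKn nth_index.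
have iG : i < size G by rewrite size_cat ltn_add2l index_mem.
have wm : nth 0 (widths G) i = m by rewrite (nth_map (0, [::])) // gi.
have w0 := wf_mkmat c m (fun _ _ => 0).
have wid : wfinj m m (iota 0 m).
  apply/and3P; split; rewrite ?size_iota ?iota_uniq //.
  by apply/allP => j; rewrite mem_iota.
(* The generator itself: zero exponents and the identity injection, so its image is literally
   [g.2]. *)
pose t : mon := (mkmat c m (fun _ _ => 0), (i, iota 0 m)).
have wt : wfmon c (widths G) m t by apply/and3P; split; rewrite ?size_map ?wm.
have wg : wfvec c ds m g.2.
  by have := wf_nth_gen (check_wf wfB chk) iG; rewrite wm gi.
have et : phi1 G t = g.2.
  rewrite /phi1 /= gi -[RHS]map_id; apply/eq_in_map => -[k w] /(allP wg) /=.
  case: w => [a [l pi]] /and3P [/= wa _ wpi]; congr (_, (_, (_, _))).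
    apply: (mat_ext (wf_actmat _ w0 wa) wa) => x q xc qm.
    rewrite (ent_actmat _ _ w0 wid wa) ent_mkmat // add0n.
    by rewrite -{1}[q]add0n -(nth_iota 0 0 qm) index_uniq ?size_iota ?iota_uniq.
  rewrite -[RHS]map_id; apply/eq_in_map => j jpi.
  by rewrite nth_iota //; case/and3P: wpi => _ _ /allP /(_ _ jpi).
have mN : m <= N.
  have := check_width chk iG; rewrite -/G wm; exact: leq_trans (leq_addr _ _).
have /and3P [_ /hasP [s sS /andP [/eqP sm sM]] _] :=
  check_term chk wt mN (small_mkmat (fun _ _ _ _ => leq0n N)).
have [ws ps] := check_rels chk sS; rewrite sm in ws.
case: s.2 ws ps sM => //= u z /andP [_ wz] pz /andP [/eqP eu /allP lz].
have wzB : wfvec c (widths B) m z.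
  apply/allP => v vz; have /and3P [wa _ wpi] := allP wz v vz.
  have lt : v.2.2.1 < size B := lz _ vz.
  apply/and3P; split; rewrite ?size_map //; move: wpi.
  by rewrite /widths map_cat nth_cat size_map lt.
have ez : phi G z = phi B z.
  elim: (z) lz => //= v z' IH lz; rewrite /phi /= -!/(phi _ _) IH; last first.
    by move=> x xz; apply: lz; rewrite inE xz orbT.
  congr (scalev _ _ ++ _); rewrite /phi1 /G nth_cat.
  by rewrite (lz v) // inE eqxx.
have -> : sem c ds g.1 g.2 = ((-1)%:MP *: sem c ds m (phi B z))%R.
  rewrite -sem_scale; apply: sem_ext => w; rewrite cf_scale -ez.
  have := pz w; rewrite cf_phi_cons eu /= et mul1r => /eqP.
  by rewrite addr_eq0 => /eqP ->; rewrite mulN1r.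
by apply: (fsZ HT); apply: generated_phi wzB.
Qed.

Lemma kernel_generated (T : forall n, F (widths G) n -> Prop) : is_fi_submodule T ->
  (forall s, s \in S -> T s.1 (sem c (widths G) s.1 s.2)) ->
  forall n y, lift (gen_img ds (G := G)) n y = 0%R -> T n y.
Proof.
move=> HT TS n y; have [z wz <-] := ex_sem y.
have wG : wfgens c ds G := check_wf wfB chk.
rewrite lift_sem // => /(sem_eq0 (wf_phi wG wz)) pz.
suff [] : T n (sem c (widths G) n z) /\ cf (phi G z) =1 (fun=> 0%R) by [].
(* The family is the preimage of [T] under [sem], intersected with the relations; the intersection
   provides [Nker]. *)
apply: (kernel_relations wfB chk (Nn := fun n z =>
  T n (sem c (widths G) n z) /\ cf (phi G z) =1 (fun=> 0%R))) wz pz.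
- by move=> k; rewrite sem_nil; split; [apply: (fs0 HT) | move=> w; rewrite cf_nil].
- move=> k u v [Tu pu] [Tv pv]; rewrite sem_cat; split; first exact: (fsD HT).
  by move=> w; rewrite phi_cat cf_cat pu pv addr0.
- move=> k a u [Tu pu]; rewrite sem_scale; split; first exact: (fsZ HT).
  by move=> w; rewrite cf_phi_scale pu mulr0.
- move=> k u v e [Tu pu]; rewrite -(sem_ext _ _ _ e); split=> // w.
  by rewrite -(phi_ext _ e).
- move=> k m b pi u wb wpi wu [Tu pu]; split; last first.
    move=> w; rewrite (phi_act wG wb wpi wu).
    by rewrite (acts_ext _ _ (v' := [::])) ?cf_nil // => x; rewrite pu cf_nil.
  have [s es] := ex_ord_vals wpi; rewrite -es -(rows_decm wb) sem_act //.
  by apply: (fsZ HT); apply: (fs_map HT s Tu).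
- by move=> s sS; split; [apply: TS | have [] := check_rels chk sS].
by move=> k u [].
Qed.

End Step.

(** The kernel is generated by [S], which is part of [G']; conversely [G'] generates no more than
    [S], whose elements are relations. *)
Lemma kernel_image ds B ext S N ext' S' N' :
  let G := B ++ ext in let G' := S ++ ext' in
  wfgens c ds B -> check c ds B ext S N -> check c (widths G) S ext' S' N' ->
  forall n y, lift (gen_img ds (G := G)) n y = 0%R <->
    exists x, lift (gen_img (widths G) (G := G')) n x = y.
Proof.
move=> G G' wB chk chk' n y.
have wS : wfgens c (widths G) S by apply/allP => s /(check_rels chk) [].
split=> [|[x <-]].
  apply: (kernel_generated wB chk (T := fun n y => exists x, _ n x = y)).
    exact: image_submodule.
  by move=> s sS; apply: gen_in_image; rewrite mem_cat sS.
apply: (lift_submodule (T := fun n y => lift (gen_img ds (G := G)) n y = 0%R)).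
  exact: kernel_submodule.
apply: (gen_img_nth (T := fun n y => lift (gen_img ds (G := G)) n y = 0%R)).
apply: (basis_generated wS chk' (T := fun n y => lift (gen_img ds (G := G)) n y = 0%R)).
  exact: kernel_submodule.
move=> s /(check_rels chk) [ws ps].
by rewrite lift_sem ?(check_wf wB chk) // sem_cf0.
Qed.

End Exactness.

(** * Computability of the certificate check *)

Section CheckComputable.
Variable K : fieldType.

#[global] Instance cpt_actrow :
  @cpt K _ _ _ _ (fun p => actrow p.1.1 p.1.2 p.2).
Proof. by unfold actrow; cp. Qed.

#[global] Instance cpt_actmat :
  @cpt K _ _ _ _ (fun p => actmat p.1.1 p.1.2 p.2).
Proof. by unfold actmat; cp. Qed.

#[global] Instance cpt_act : @cpt K _ _ _ _ (fun p => act p.1.1 p.1.2 p.2).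
Proof. by unfold act; cp. Qed.

#[global] Instance cpt_wfinj :
  @cpt K _ _ _ _ (fun p => wfinj p.1.1 p.1.2 p.2).
Proof. by unfold wfinj; cp. Qed.

#[global] Instance cpt_wfmat c : @cpt K _ _ _ _ (fun p => wfmat c p.1 p.2).
Proof. by unfold wfmat; cp. Qed.

#[global] Instance cpt_wfmon c :
  @cpt K _ _ _ _ (fun p => wfmon c p.1.1 p.1.2 p.2).
Proof. by unfold wfmon; cp. Qed.

(** The fold state records whether the comparison is decided, its outcome, and the unread rest of
    the second list. *)
#[global] Instance cpt_ltl : @cpt K _ _ _ _ (fun p => ltl p.1 p.2).
Proof.
pose step (st : bool * bool * seq nat) x :=
  if st.1.1 then st else lcase st.2 (true, false, [::]) (fun y t =>
    if x < y then (true, true, t) else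
    if y < x then (true, false, t) else (false, false, t)).
apply: (@cpt_ext _ _ _ _ _ (fun p : seq nat * seq nat =>
  if (foldl step (false, false, p.2) p.1).1.1
  then (foldl step (false, false, p.2) p.1).1.2
  else lcase (foldl step (false, false, p.2) p.1).2 false (fun _ _ => true))).
  have dec b t s : foldl step (true, b, t) s = (true, b, t) by elim: s.
  move=> [s t] /=; elim: s t => [|x s IH] [|y t] //=; rewrite {2 4 6}/step /=.
    by rewrite dec.
  by case: (ltngtP x y) => /= _; rewrite ?dec.
by unfold step; cp.
Qed.

#[global] Instance cpt_key : @cpt K _ _ _ _ key.
Proof. by unfold key; cp. Qed.

#[global] Instance cpt_ltmon : @cpt K _ _ _ _ (fun p => ltmon p.1 p.2).
Proof. by unfold ltmon; cp. Qed.

#[global] Instance cpt_cf : @cpt K _ _ _ _ (fun p => @cf K p.1 p.2).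
Proof.
apply: (@cpt_ext _ _ _ _ _ (fun p : vec K * mon =>
  foldl (fun s t => if t.2 == p.2 then (s + t.1)%R else s) 0%R p.1)).
  move=> [v w] /=; rewrite -[RHS]add0r; elim: v 0%R => [|t v IH] s /=.
    by rewrite cf_nil addr0.
  by rewrite cf_cons IH; case: eqP => _; rewrite ?add0r ?addrA.
by cp.
Qed.

#[global] Instance cpt_scalev : @cpt K _ _ _ _ (fun p => @scalev K p.1 p.2).
Proof. by unfold scalev; cp. Qed.

#[global] Instance cpt_acts :
  @cpt K _ _ _ _ (fun p => @acts K p.1.1 p.1.2 p.2).
Proof. by unfold acts; cp. Qed.

#[global] Instance cpt_phi1 : @cpt K _ _ _ _ (fun p => @phi1 K p.1 p.2).
Proof. by unfold phi1; cp. Qed.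

#[global] Instance cpt_phi : @cpt K _ _ _ _ (fun p => @phi K p.1 p.2).
Proof. by unfold phi; cp. Qed.

#[global] Instance cpt_widths : @cpt K _ _ _ _ (@widths K).
Proof. by unfold widths; cp. Qed.

#[global] Instance cpt_wfvec c :
  @cpt K _ _ _ _ (fun p => @wfvec K c p.1.1 p.1.2 p.2).
Proof. by unfold wfvec; cp. Qed.

#[global] Instance cpt_wfgens c : @cpt K _ _ _ _ (fun p => @wfgens K c p.1 p.2).
Proof. by unfold wfgens; cp. Qed.

#[global] Instance cpt_lists A (EA : Enc K A) :
  @cpt K _ _ _ _ (fun p => @lists A p.1 p.2).
Proof.
apply: (@cpt_ext _ _ _ _ _ (fun p : nat * seq A =>
  iter p.1 (fun acc => flatten [seq [seq x :: s | s <- acc] | x <- p.2])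
    [:: [::]])).
  by move=> [n L] /=; elim: n => //= n ->.
by cp.
Qed.

#[global] Instance cpt_listsle A (EA : Enc K A) :
  @cpt K _ _ _ _ (fun p => @listsle A p.1 p.2).
Proof. by unfold listsle; cp. Qed.

#[global] Instance cpt_prod_seq A B (EA : Enc K A) (EB : Enc K B) :
  @cpt K _ _ _ _ (fun p => @prod_seq A B p.1 p.2).
Proof. by unfold prod_seq; cp. Qed.

#[global] Instance cpt_allterms c :
  @cpt K _ _ _ _ (fun p => allterms c p.1.1 p.1.2 p.2).
Proof. by unfold allterms; cp. Qed.

#[global] Instance cpt_small : @cpt K _ _ _ _ (fun p => small p.1 p.2).
Proof. by unfold small; cp. Qed.

#[global] Instance cpt_lmt : @cpt K _ _ _ _ (fun p => @lmt K p.1 p.2).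
Proof. by unfold lmt; cp. Qed.

#[global] Instance cpt_good : @cpt K _ _ _ _ (fun p => good p.1 p.2).
Proof. by unfold good; cp. Qed.

#[global] Instance cpt_monic : @cpt K _ _ _ _ (@monic K).
Proof. by unfold monic; cp. Qed.

#[global] Instance cpt_isA :
  @cpt K _ _ _ _ (fun p => @isA K p.1.1 p.1.2 p.2).
Proof. by unfold isA; cp. Qed.

#[global] Instance cpt_isM :
  @cpt K _ _ _ _ (fun p => @isM K p.1.1 p.1.2 p.2).
Proof. by unfold isM; cp. Qed.

(** The composition rules of [cp] stop at four arguments, so functions with more are presented on
    one tuple, here and below. *)
Definition isB_uncurried (p : seq (nat * vec K) * nat * mon * mon * vec K) :=
  isB p.1.1.1.1 p.1.1.1.2 p.1.1.2 p.1.2 p.2.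

#[global] Instance cpt_isB : @cpt K _ _ _ _ isB_uncurried.
Proof. by unfold isB_uncurried, isB; cp. Qed.

#[global] Instance cpt_isnull : @cpt K _ _ _ _ (@isnull K).
Proof. by unfold isnull; cp. Qed.

Definition check_terms_uncurried c
    (p : seq (nat * vec K) * nat * seq (nat * vec K) * nat * nat * mon) :=
  [&& has (fun s => (s.1 == p.1.2) && isA p.1.1.1.1.2 p.2 s.2) p.1.1.1.2,
      has (fun s => (s.1 == p.1.2) && isM p.1.1.1.1.2 p.2 s.2) p.1.1.1.2 &
      all (fun t' => [&& good p.1.1.1.1.2 p.2, good p.1.1.1.1.2 t' &
                        lmt p.1.1.1.1.1 p.2 == lmt p.1.1.1.1.1 t'] ==>
             has (fun s => (s.1 == p.1.2) &&
                isB_uncurried (p.1.1.1.1.1, p.1.1.1.1.2, p.2, t', s.2)) p.1.1.1.2)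
        (allterms c (widths p.1.1.1.1.1) p.1.2 p.1.1.2)].

#[global] Instance cpt_check_terms c : cpt (check_terms_uncurried c).
Proof. by unfold check_terms_uncurried; cp. Qed.

Definition check_uncurried c (p : seq nat * seq (nat * vec K) *
    seq (nat * vec K) * seq (nat * vec K) * nat) :=
  check c p.1.1.1.1 p.1.1.1.2 p.1.1.2 p.1.2 p.2.

#[global] Instance cpt_check c : cpt (check_uncurried c).
Proof.
have E G nB S N k t : check_terms c G nB S N k t =
  check_terms_uncurried c (G, nB, S, N, k, t) by [].
apply: (@cpt_ext _ _ _ _ _ (fun p : seq nat * seq (nat * vec K) *
    seq (nat * vec K) * seq (nat * vec K) * nat =>
  [&& wfgens c p.1.1.1.1 p.1.1.2,
      all (fun g => monic g.2) p.1.1.2,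
      all (fun g => g.1 + g.1 <= p.2) (p.1.1.1.2 ++ p.1.1.2),
      all (fun g => all (fun t => small p.2 t.2.1) g.2) p.1.1.2,
      all (fun s => wfvec c (widths (p.1.1.1.2 ++ p.1.1.2)) s.1 s.2 &&
                    isnull (phi (p.1.1.1.2 ++ p.1.1.2) s.2)) p.1.2 &
      all (fun k => all (fun t => check_terms_uncurried c
             (p.1.1.1.2 ++ p.1.1.2, size p.1.1.1.2, p.1.2, p.2, k, t))
                        (allterms c (widths (p.1.1.1.2 ++ p.1.1.2)) k p.2))
        (iota 0 p.2.+1)])).
  by [].
by cp.
Qed.

#[global] Instance cpt_flat : @cpt K _ _ _ _ (@flat K).
Proof. by unfold flat; cp. Qed.

#[global] Instance cpt_unflat : @cpt K _ _ _ _ (@unflat K).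
Proof. by unfold unflat; cp. Qed.

End CheckComputable.

(** * The search *)

Section Enumerations.
Variable K : fieldType.
Local Notation gens := (seq (nat * vec K)).

(** Each stage keeps the previous one, so the stages increase; starting from 1 also yields 0, as the
    sum of 1 and its negative. *)
Definition enum_scal n (s : seq K) : seq K :=
  iter n (fun L => L ++ [seq (p.1 + p.2)%R | p <- prod_seq L L] ++
                   [seq (p.1 * p.2)%R | p <- prod_seq L L] ++
                   [seq (- x)%R | x <- L] ++ [seq (x^-1)%R | x <- L])
    (1%R :: s).

Definition enum_nats n := iota 0 n.

Definition enum_mon n : seq mon :=
  prod_seq (listsle n (listsle n (enum_nats n)))
    (prod_seq (enum_nats n) (listsle n (enum_nats n))).

Definition enum_gens n s : seq gens :=
  listsle n (prod_seq (enum_nats n)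
    (listsle n (prod_seq (enum_scal n s) (enum_mon n)))).

Definition enum_certs n s : seq (seq (gens * gens * nat)) :=
  listsle n (prod_seq (prod_seq (enum_gens n s) (enum_gens n s)) (enum_nats n)).

#[global] Instance cpt_enum_scal :
  @cpt K _ _ _ _ (fun p => enum_scal p.1 p.2).
Proof. by unfold enum_scal; cp. Qed.

#[global] Instance cpt_enum_nats : @cpt K _ _ _ _ enum_nats.
Proof. by unfold enum_nats; cp. Qed.

#[global] Instance cpt_enum_mon : @cpt K _ _ _ _ enum_mon.
Proof. by unfold enum_mon; cp. Qed.

#[global] Instance cpt_enum_gens :
  @cpt K _ _ _ _ (fun p => enum_gens p.1 p.2).
Proof. by unfold enum_gens; cp. Qed.

#[global] Instance cpt_enum_certs :
  @cpt K _ _ _ _ (fun p => enum_certs p.1 p.2).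
Proof. by unfold enum_certs; cp. Qed.

(** Membership from some stage on, and not merely at some stage, allows finitely many memberships to
    hold at a common stage. *)
Definition eventually (T : eqType) (E : nat -> seq T) (x : T) :=
  exists n0, forall n, n0 <= n -> x \in E n.

Lemma eventually_prod (T U : eqType) (E : nat -> seq T) (E' : nat -> seq U) x y :
  eventually E x -> eventually E' y ->
  eventually (fun n => prod_seq (E n) (E' n)) (x, y).
Proof.
move=> [m Hm] [n Hn]; exists (m + n) => k mnk.
rewrite mem_prod_seq Hm ?Hn //; first exact: leq_trans (leq_addl _ _) mnk.
exact: leq_trans (leq_addr _ _) mnk.
Qed.

Lemma eventually_seq (T : eqType) (E : nat -> seq T) s :
  (forall x, x \in s -> eventually E x) ->
  eventually (fun n => listsle n (E n)) s.
Proof.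
move=> H; suff [n0 Hn] : exists n0, forall n, n0 <= n -> all (fun x => x \in E n) s.
  exists (n0 + size s) => n le; rewrite mem_listsle Hn ?andbT.
    exact: leq_trans (leq_addl _ _) le.
  exact: leq_trans (leq_addr _ _) le.
elim: s H => [|x s IH] H; first by exists 0.
have [|m Hm] := H x; first by rewrite inE eqxx.
have [|n Hn] := IH; first by move=> y ys; apply: H; rewrite inE ys orbT.
exists (m + n) => k mnk; rewrite /= Hm ?Hn //.
  exact: leq_trans (leq_addl _ _) mnk.
exact: leq_trans (leq_addr _ _) mnk.
Qed.

Lemma eventually_nat n : eventually enum_nats n.
Proof. by exists n.+1 => m nm; rewrite mem_iota. Qed.

Lemma eventually_mon w : eventually enum_mon w.
Proof.
have H s : eventually (fun n => listsle n (enum_nats n)) s.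
  by apply: eventually_seq => x _; apply: eventually_nat.
case: w => a [i pi]; apply: eventually_prod; first exact: eventually_seq.
by apply: eventually_prod => //; apply: eventually_nat.
Qed.

Section Scalars.
Variable s : seq K.
Local Notation reachable := (eventually (fun n => enum_scal n s)).

Lemma reachableP x : reachable x <-> exists n, x \in enum_scal n s.
Proof.
split=> [[n H]|[n H]]; first by exists n; apply: H.
exists n; elim=> [|m IH].
  by rewrite leqn0 => /eqP n0; rewrite n0 in H.
rewrite leq_eqVlt => /orP [/eqP <- //|/IH xm].
by rewrite /= mem_cat -/(enum_scal m s) xm.
Qed.

Lemma reachable_scal x : x \in 1%R :: s -> reachable x.
Proof. by move=> xs; apply/reachableP; exists 0. Qed.

Lemma reachable_common x y : reachable x -> reachable y ->
  exists n, (x \in enum_scal n s) && (y \in enum_scal n s).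
Proof.
move=> [m Hm] [n Hn]; exists (m + n).
by rewrite Hm ?Hn // ?leq_addr ?leq_addl.
Qed.

Lemma reachable_add x y : reachable x -> reachable y -> reachable (x + y)%R.
Proof.
move=> rx ry; have [n /andP [xn yn]] := reachable_common rx ry.
apply/reachableP; exists n.+1; rewrite /= !mem_cat -/(enum_scal n s).
apply/orP; right; apply/orP; left; apply/mapP; exists (x, y) => //.
by rewrite mem_prod_seq xn.
Qed.

Lemma reachable_mul x y : reachable x -> reachable y -> reachable (x * y)%R.
Proof.
move=> rx ry; have [n /andP [xn yn]] := reachable_common rx ry.
apply/reachableP; exists n.+1; rewrite /= !mem_cat -/(enum_scal n s).
apply/orP; right; apply/orP; right; apply/orP; left.
by apply/mapP; exists (x, y) => //; rewrite mem_prod_seq xn.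
Qed.

Lemma reachable_opp x : reachable x -> reachable (- x)%R.
Proof.
move=> /reachableP [n xn]; apply/reachableP; exists n.+1.
rewrite /= !mem_cat -/(enum_scal n s).
do 3 (apply/orP; right); apply/orP; left; exact: map_f.
Qed.

Lemma reachable_inv x : reachable x -> reachable (x^-1)%R.
Proof.
move=> /reachableP [n xn]; apply/reachableP; exists n.+1.
rewrite /= !mem_cat -/(enum_scal n s).
do 4 (apply/orP; right); exact: (map_f (fun x => x^-1)%R).
Qed.

Definition over_gens (G : gens) := forall g, g \in G -> over reachable g.2.

Lemma eventually_gens G : over_gens G -> eventually (fun n => enum_gens n s) G.
Proof.
move=> oG; apply: eventually_seq => -[n v] /oG /= ov.
apply: eventually_prod; first exact: eventually_nat.
apply: eventually_seq => -[k w] /ov /= rk.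
by apply: eventually_prod => //; apply: eventually_mon.
Qed.

Lemma eventually_certs cs :
  (forall ct, ct \in cs -> over_gens ct.1.1 /\ over_gens ct.1.2) ->
  eventually (fun n => enum_certs n s) cs.
Proof.
move=> ocs; apply: eventually_seq => -[[ext S] N] /ocs /= [oe oS].
apply: eventually_prod; last exact: eventually_nat.
by apply: eventually_prod; apply: eventually_gens.
Qed.

End Scalars.

Variable c : nat.
Local Notation stepcert := (gens * gens * nat)%type.
Local Notation elt := (seq (seq (K * mat) * (nat * seq nat))).

(** The relations of one step are the generators to be resolved in the next, inside the free module
    on the current basis. *)
Definition run_step (st : bool * (seq nat * gens)) (ct : stepcert) :=
  (st.1 && check_uncurried c (st.2.1, st.2.2, ct.1.1, ct.1.2, ct.2),
   (widths (st.2.2 ++ ct.1.1), ct.1.2)).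

Definition valid ds (B : gens) (cs : seq stepcert) : bool :=
  (foldl run_step (true, (ds, B)) cs).1.

Definition output_step (st : seq (seq nat * seq elt) * gens) (ct : stepcert) :=
  (rcons st.1 (widths (st.2 ++ ct.1.1), [seq unflat g.2 | g <- st.2 ++ ct.1.1]),
   ct.1.2).

Definition output (B : gens) (cs : seq stepcert) : seq (seq nat * seq elt) :=
  (foldl output_step ([::], B) cs).1.

Local Notation input := (nat * (seq nat * seq (nat * elt)))%type.

Definition input_gens (x : input) : gens := [seq (b.1, flat b.2) | b <- x.2.2].

Definition input_scalars (x : input) : seq K :=
  flatten [seq [seq t.1 | t <- b.2] | b <- input_gens x].

Definition accept (x : input) (cs : seq stepcert) : bool :=
  (size cs == x.1) && valid x.2.1 (input_gens x) cs.

Definition found (x : input) n : bool :=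
  has (fun cs => accept x cs) (enum_certs n (input_scalars x)).

(** Any accepted chain is a correct answer; the fold keeps the last one of the stage. *)
Definition result (x : input) n : seq (seq nat * seq elt) :=
  foldl (fun acc cs => if accept x cs then output (input_gens x) cs else acc) [::]
    (enum_certs n (input_scalars x)).

#[global] Instance cpt_run_step : @cpt K _ _ _ _ (fun p => run_step p.1 p.2).
Proof. by unfold run_step; cp. Qed.

#[global] Instance cpt_valid :
  @cpt K _ _ _ _ (fun p => valid p.1.1 p.1.2 p.2).
Proof. by unfold valid; cp. Qed.

#[global] Instance cpt_output_step :
  @cpt K _ _ _ _ (fun p => output_step p.1 p.2).
Proof. by unfold output_step; cp. Qed.

#[global] Instance cpt_output : @cpt K _ _ _ _ (fun p => output p.1 p.2).
Proof. by unfold output; cp. Qed.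

#[global] Instance cpt_input_gens : @cpt K _ _ _ _ input_gens.
Proof. by unfold input_gens; cp. Qed.

#[global] Instance cpt_input_scalars : @cpt K _ _ _ _ input_scalars.
Proof. by unfold input_scalars; cp. Qed.

#[global] Instance cpt_accept : @cpt K _ _ _ _ (fun p => accept p.1 p.2).
Proof. by unfold accept; cp. Qed.

#[global] Instance cpt_found : @cpt K _ _ _ _ (fun p => found p.1 p.2).
Proof. by unfold found; cp. Qed.

#[global] Instance cpt_result : @cpt K _ _ _ _ (fun p => result p.1 p.2).
Proof. by unfold result; cp. Qed.

Lemma result_accepted x n : found x n ->
  exists2 cs, accept x cs & result x n = output (input_gens x) cs.
Proof.
rewrite /found /result; elim/last_ind: (enum_certs _ _) => // l cs IH.
rewrite has_rcons foldl_rcons; case: ifP => [acs _|_ /IH //].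
by exists cs.
Qed.

(** The relations found at one step again have coefficients in [k0], which is what the induction on
    [p] needs for the next step. *)
Lemma exists_valid (k0 : K -> Prop) p ds B :
  k0 1%R -> (forall x y, k0 x -> k0 y -> k0 (x + y)%R) ->
  (forall x y, k0 x -> k0 y -> k0 (x * y)%R) ->
  (forall x, k0 x -> k0 (- x)%R) -> (forall x, k0 x -> k0 (x^-1)%R) ->
  wfgens c ds B -> (forall b, b \in B -> over k0 b.2) ->
  exists cs, [/\ size cs = p, valid ds B cs &
    forall ct, ct \in cs -> (forall g, g \in ct.1.1 -> over k0 g.2) /\
                            (forall g, g \in ct.1.2 -> over k0 g.2)].
Proof.
move=> k1 kD kM kN kV; elim: p ds B => [|p IH] ds B wB oB; first by exists [::].
have [ext [extP ext_basis]] := groebner_basis c k0 ds B.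
have [S [N [chk oS]]] :=
  exists_check k1 kD kM kN kV wB oB extP ext_basis.
have wS : wfgens c (widths (B ++ ext)) S by apply/allP => s /(check_rels chk) [].
have [cs [scs vcs ocs]] := IH _ _ wS oS.
exists ((ext, S, N) :: cs); split; first by rewrite /= scs.
  by rewrite /valid /= /run_step /= /check_uncurried /= chk.
move=> ct; rewrite inE => /orP [/eqP -> /=|/ocs //]; split=> // g /extP.
by case.
Qed.

Lemma exists_found (x : input) : wfgens c x.2.1 (input_gens x) ->
  exists n, found x n.
Proof.
move=> wx; pose s := input_scalars x.
have [cs [scs vcs ocs]] := exists_valid x.1 (@reachable_scal s _ (mem_head _ _))
  (@reachable_add s) (@reachable_mul s) (@reachable_opp s) (@reachable_inv s) wx
  (fun b bx t tb => @reachable_scal s t.1 (mem_behead (s := 1%R :: s)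
     (introT flatten_mapP (ex_intro2 _ _ b bx (map_f fst tb))))).
have [n Hn] := eventually_certs ocs.
exists n; apply/hasP; exists cs; first exact: Hn.
by rewrite /accept scs eqxx.
Qed.

Lemma search_program : exists alg, forall x : input,
  wfgens c x.2.1 (input_gens x) -> exists2 cs, accept x cs &
  eval alg (encode x) (encode (output (input_gens x) cs)).
Proof.
have [g Hg] := cpt_search (P := fun x : input => wfgens c x.2.1 (input_gens x))
  cpt_found exists_found.
have [h Hh] := cpt_result.
exists (Seq g h) => x wx; have [n fx Hn] := Hg x wx.
have [cs acs ecs] := result_accepted fx.
by exists cs => //; rewrite -ecs; apply: EvSeq Hn (Hh (x, n)).
Qed.

End Enumerations.

(** * The resolution *)

Section Chain.
Variables (K : fieldType) (c : nat).
Local Notation gens := (seq (nat * vec K)).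
Local Notation stepcert := (gens * gens * nat)%type.

(** The resolution is indexed by all natural numbers; past the end of [cs] the default certificate
    still gives well-formed data. *)
Definition cert (cs : seq stepcert) k : stepcert := nth ([::], [::], 0) cs k.

Definition relations (B : gens) (cs : seq stepcert) k : gens :=
  if k is l.+1 then (cert cs l).1.2 else B.

Definition basis B cs k : gens := relations B cs k ++ (cert cs k).1.1.

Definition chain_widths B cs k := widths (basis B cs k).

Lemma relationsS B ct cs k : relations B (ct :: cs) k.+1 = relations ct.1.2 cs k.
Proof. by case: k. Qed.

Lemma basisS B ct cs k : basis B (ct :: cs) k.+1 = basis ct.1.2 cs k.
Proof. by rewrite /basis relationsS. Qed.

Lemma run_step_false (st : bool * (seq nat * gens)) cs : st.1 = false -> (foldl (run_step c) st cs).1 = false.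
Proof. by elim: cs st => //= ct cs IH st st0; rewrite IH //= st0. Qed.

Lemma valid_check ds B cs k : valid c ds B cs -> k < size cs ->
  check c (target ds (chain_widths B cs) k) (relations B cs k)
    (cert cs k).1.1 (cert cs k).1.2 (cert cs k).2.
Proof.
elim: cs ds B k => // ct cs IH ds B k; rewrite /valid /= /run_step /=.
case chk: (check_uncurried _ _); last by rewrite run_step_false.
case: k => [_ _|k v /IH - /(_ _ _ v)]; first exact: chk.
rewrite relationsS; case: k => [|k] //=.
by rewrite /chain_widths basisS.
Qed.

Lemma outputE B cs : output B cs =
  [seq (chain_widths B cs k, [seq unflat g.2 | g <- basis B cs k])
  | k <- iota 0 (size cs)].
Proof.
rewrite /output -[RHS]cat0s; elim: cs B [::] => [|ct cs IH] B o /=.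
  by rewrite cats0.
rewrite IH cat_rcons (iotaDl 1 0) -map_comp; congr (_ ++ _ :: _).
by apply: eq_map => k; rewrite /= /chain_widths basisS.
Qed.

Lemma wf_relations ds B cs k : wfgens c ds B -> valid c ds B cs ->
  wfgens c (target ds (chain_widths B cs) k) (relations B cs k).
Proof.
move=> wB v; case: k => //= k.
case: (ltnP k (size cs)) => [lt|ge]; last by rewrite /cert nth_default.
by apply/allP => s /(check_rels (valid_check v lt)) [].
Qed.

Lemma wf_basis_chain ds B cs k : wfgens c ds B -> valid c ds B cs ->
  wfgens c (target ds (chain_widths B cs) k) (basis B cs k).
Proof.
move=> wB v; have wR := wf_relations k wB v.
case: (ltnP k (size cs)) => [lt|ge].
  exact: check_wf wR (valid_check v lt).
by rewrite /basis [cert cs k]nth_default // cats0.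
Qed.

End Chain.

(** * Input and output encodings, and the theorem *)

Lemma enc_seq_map (K : fieldType) A B (f : B -> value K) (g : A -> B) s :
  enc_seq f [seq g x | x <- s] = enc_seq (fun x => f (g x)) s.
Proof. by elim: s => //= x s ->. Qed.

Lemma eq_enc_seq (K : fieldType) A (f g : A -> value K) s :
  f =1 g -> enc_seq f s = enc_seq g s.
Proof. by move=> e; elim: s => //= x s ->; rewrite e. Qed.

Lemma encode_map (K : fieldType) A B (EB : Enc K B) (g : A -> B) s :
  encode [seq g x | x <- s] = enc_seq (fun x => encode (g x)) s.
Proof. exact: enc_seq_map. Qed.

Lemma enc_eltE (K : fieldType) c ds n (q : elt_repr K c ds n) :
  enc_elt q = encode (simple_elt q).
Proof.
rewrite [RHS]encode_map; apply: eq_enc_seq => -[f t].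
congr VPair.
  rewrite [RHS]encode_map; apply: eq_enc_seq => -[k m]; congr VPair.
  rewrite [RHS]encode_map; apply: eq_enc_seq => i.
  by rewrite [RHS]encode_map.
by congr VPair; rewrite [RHS]encode_map.
Qed.

Definition simple_input (K : fieldType) c (p : nat) ds
    (B : seq {n : nat & elt_repr K c ds n}) :=
  (p, (ds, [seq (tag b, simple_elt (tagged b)) | b <- B])).

Lemma enc_inputE (K : fieldType) c p ds (B : seq {n : nat & elt_repr K c ds n}) :
  enc_input p B = encode (simple_input p B).
Proof.
congr (VPair _ (VPair _ _)); rewrite [RHS]encode_map.
by apply: eq_enc_seq => b; rewrite enc_eltE.
Qed.

Lemma enc_outputE (K : fieldType) c p ds D (phi : forall k, images K c (target ds D k) (D k)) :
  enc_output p phi =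
  encode [seq (D k, [seq simple_elt (phi k j) | j <- enum 'I_(size (D k))]) | k <- iota 0 p].
Proof.
rewrite [RHS]encode_map; apply: eq_enc_seq => k; congr VPair.
by rewrite [RHS]encode_map; apply: eq_enc_seq => j; apply: enc_eltE.
Qed.

Lemma input_gensP (K : fieldType) c p ds (B : seq {n : nat & elt_repr K c ds n})
    (T : nat * vec K -> Prop) :
  (forall b n (q : elt_repr K c ds n), b = Tagged _ q ->
     subset_of B (elt_of q) -> T (n, flat (simple_elt q))) ->
  forall g, g \in input_gens (simple_input p B) -> T g.
Proof.
move=> H g; rewrite /input_gens -map_comp => /(nthP (0, [::])) [i].
rewrite size_map => iB <-.
pose b0 : {n : nat & elt_repr K c ds n} := Tagged _ ([::] : elt_repr K c ds 0).
rewrite (nth_map b0) //=; case E: (nth b0 B i) => [n q]; apply: H (erefl _) _.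
rewrite /subset_of /finite_subset.
have -> : Tagged (fun k => free_fi_module K c ds k : Type) (elt_of q) =
    nth (Tagged (fun k => free_fi_module K c ds k : Type) (elt_of q))
      [seq Tagged (fun k => free_fi_module K c ds k : Type) (elt_of (tagged b)) | b <- B] i.
  by rewrite (nth_map b0) // E.
by apply: mem_nth; rewrite size_map.
Qed.

Lemma subset_ofP (K : fieldType) c p ds (B : seq {n : nat & elt_repr K c ds n})
    (T : forall n, free_fi_module K c ds n -> Prop) :
  (forall g, g \in input_gens (simple_input p B) -> T g.1 (sem c ds g.1 g.2)) ->
  forall n y, subset_of B (n := n) y -> T n y.
Proof.
move=> H n y.
suff T' (u : {n : nat & free_fi_module K c ds n}) :
    u \in [seq Tagged (fun k => free_fi_module K c ds k : Type)
                 (elt_of (tagged b)) | b <- B] -> T (tag u) (tagged u).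
  exact: (T' (Tagged (fun k => free_fi_module K c ds k : Type) y)).
case/(nthP u) => i; rewrite size_map => iB <-.
pose b0 : {n : nat & elt_repr K c ds n} := Tagged _ ([::] : elt_repr K c ds 0).
rewrite (nth_map b0) //=; have [_ <-] := flat_simple (tagged (nth b0 B i)).
apply: (H (tag (nth b0 B i), flat (simple_elt (tagged (nth b0 B i))))).
rewrite /input_gens -map_comp; apply/(nthP (0, [::])); exists i; rewrite ?size_map //.
by rewrite (nth_map b0).
Qed.

Lemma wf_input_gens (K : fieldType) c p ds (B : seq {n : nat & elt_repr K c ds n}) :
  wfgens c ds (input_gens (simple_input p B)).
Proof.
apply/allP; apply: input_gensP => b n q _ _ /=.
by have [] := flat_simple q.
Qed.

Theorem mainTheorem2 (K : fieldType) (c : nat) :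
  exists alg : program,
  forall (p : nat) (ds : seq nat) (B : seq {n : nat & elt_repr K c ds n}),
  (1 <= p)%N ->
  let M := fi_span (subset_of B) in
  exists (D : nat -> seq nat)
         (phi : forall k, images K c (target ds D k) (D k))
         (del : forall k, fi_morphism (resolution_obj M D k.+1)
                                      (resolution_obj M D k)),
  [/\ eval alg (enc_input p B) (enc_output p phi),
      (forall k, (k <= p)%N -> finitely_generated (resolution_obj M D k)),
      (forall j : 'I_(size (D 0%N)),
         fi_span_incl (subset_of B) _ (del 0%N _ (fgen K c j))
         = elt_of (phi 0%N j)),
      (forall k, (k.+1 < p)%N -> forall j : 'I_(size (D k.+1)),
         del k.+1 _ (fgen K c j) = elt_of (phi k.+1 j))
    & exact_sequence p del].
Proof.
have [alg Halg] := search_program K c; exists alg => p ds B p1 M.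
pose B0 := input_gens (simple_input p B).
have wB : wfgens c ds B0 := wf_input_gens p B.
have [cs /andP [/eqP /= scs v] ev] := Halg (simple_input p B) wB.
pose D := chain_widths B0 cs; pose G := basis B0 cs.
have wG k : wfgens c (target ds D k) (G k) by apply: wf_basis_chain.
have chk k : (k < p)%N -> check c (target ds D k) (relations B0 cs k)
    (cert cs k).1.1 (cert cs k).1.2 (cert cs k).2.
  by move=> kp; apply: valid_check; rewrite ?scs.
(* Among the presentations of the image, the one that encodes to exactly what the program returns is
   taken. *)
have Hphi k (j : 'I_(size (D k))) :
    {q : elt_repr K c (target ds D k) (nth 0%N (D k) j) |
     simple_elt q = unflat (nth (0%N, [::]) (G k) j).2 /\
     elt_of q = gen_img c (target ds D k) (G := G k) j}.
  apply: cid; apply: unflat_simple; apply: wf_nth_gen => //.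
  by rewrite -(size_map fst).
pose phi k : images K c (target ds D k) (D k) := fun j => sval (Hphi k j).
have TM := fi_generated_is_fi_submodule (subset_of B).
have spanB : forall g, g \in B0 -> fi_generated (subset_of B) (sem c ds g.1 g.2).
  apply: input_gensP => b n q _ Sq T HT ST /=.
  by have [_ ->] := flat_simple q; apply: ST.
have spanG := gen_img_nth (basis_generated wB (chk 0%N p1) TM spanB).
(* The last map goes to [M] and not to the ambient free module, so the images of its generators are
   lifted along the inclusion; [spanG] guarantees that they lie in [M]. *)
have HxM (j : 'I_(size (D 0%N))) : {u : M (nth 0%N (D 0%N) j) |
    fi_span_incl (subset_of B) _ u = gen_img c ds (G := G 0%N) j}.
  apply: cid; have Sj : sub_pred (fi_generated (subset_of B)) (gen_img c ds (G := G 0%N) j).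
    by apply/asboolP; apply: spanG.
  by exists (Sub (gen_img c ds (G := G 0%N) j) Sj).
pose xM j := sval (HxM j).
pose del k : fi_morphism (resolution_obj M D k.+1) (resolution_obj M D k) :=
  match k with
  | 0%N => lift (N := M) xM
  | l.+1 => lift (gen_img c (D l) (G := G l.+1))
  end.
have incl_del0 n y : fi_span_incl (subset_of B) n (del 0%N n y) =
    lift (gen_img c ds (G := G 0%N)) n y.
  rewrite [LHS](lift_comp (fi_span_incl (subset_of B)) xM y).
  congr (lift _ n y); apply: functional_extensionality_dep => j.
  exact: (svalP (HxM j)).
(* The image in the ambient free module is a submodule containing the elements of [B], because [B0]
   is part of [G 0]; hence it contains all of [M]. *)
have surj n (y : M n) : exists x, del 0%N n x = y.
  have : fi_generated (subset_of B) (val y) by apply/asboolP/(valP y).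
  move/(_ _ (image_submodule (gen_img c ds (G := G 0%N)))) => [|x ex].
    apply: (subset_ofP (p := p)) => g gB; apply: gen_in_image.
    by rewrite mem_cat gB.
  by exists x; apply: val_inj; rewrite -ex -incl_del0.
exists D, phi, del; split.
- rewrite enc_inputE enc_outputE.
  rewrite outputE scs in ev; move: ev; congr (eval _ _ (encode _)).
  apply: eq_map => k; congr (_, _); apply: (@eq_from_nth _ [::]).
    by rewrite [LHS]size_map [RHS]size_map size_enum_ord size_map.
  move=> i; rewrite size_map => iG.
  have iD : (i < size (D k))%N by rewrite size_map.
  rewrite [LHS](nth_map (0%N, [::])) // [RHS](nth_map (Ordinal iD)) ?size_enum_ord //.
  rewrite [nth _ (enum _) i](nth_ord_enum (Ordinal iD) (Ordinal iD)).
  by have [e _] := svalP (Hphi k (Ordinal iD)); exact: esym e.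
- case=> [|k] _; last exact: finitely_generated_free.
  exact: finitely_generated_surj surj (finitely_generated_free _ _ _).
- move=> j; rewrite [LHS](incl_del0 _ (fgen K c j)) lift_fgen.
  by have [_ ->] := svalP (Hphi 0%N j).
- move=> k _ j; rewrite [LHS]lift_fgen.
  by have [_ ->] := svalP (Hphi k.+1 j).
split=> // k kp n y.
have ki := kernel_image (wf_relations k wB v) (chk k (ltnW kp)) (chk k.+1 kp) y.
case: k kp y ki => [|k] kp y ki; last exact: ki.
(* At the last spot the kernel is taken in [M]; injectivity of the inclusion identifies it with the
   kernel in the ambient free module. *)
rewrite -ki -incl_del0; split=> [->|e]; first exact: linear0.
exact: val_inj.
Qed.
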